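(* The parameterized problem $p$-Edge-Induced-Subgraph — given a graph $G$ and $k\in\mathbb N$, decide whether $G$ contains a $k$-edge induced subgraph, with parameter $k$ — is fixed-parameter tractable.
   Context: All graphs are simple (finite, nonempty vertex set, undirected, no loops or multiple edges). A $k$-edge induced subgraph of $G$ is an induced subgraph $G[S]$ ($S\neq\emptyset$) with exactly $k$ edges. Fixed-parameter tractable means decidable in time $f(k)\cdot n^{O(1)}$ for a computable $f$, where $n$ is the input size. *)

(* Defs.v *)
From mathcomp Require Import all_boot.
Set Implicit Arguments. Unset Strict Implicit. Unset Printing Implicit Defensive.

(* A simple graph on vertex set 'I_n is a symmetric irreflexive relation e.
   Number of edges of the induced subgraph G[S] (unordered pairs {u,v} ⊆ S). *)
Definition edges_in (n : nat) (e : rel 'I_n) (S : {set 'I_n}) : nat :=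
  #|[set p : 'I_n * 'I_n | [&& (p.1 < p.2)%N, p.1 \in S, p.2 \in S & e p.1 p.2]]|.

Definition has_k_edge_induced_subgraph (n : nat) (e : rel 'I_n) (k : nat) : Prop :=
  exists S : {set 'I_n}, S != set0 /\ edges_in e S = k.

Inductive instr : Type :=
| IConst (r c : nat)
| IAdd (r a b : nat)
| ISub (r a b : nat)
| ILoad (r a : nat)
| IStore (a r : nat)
| IJz (r l : nat)
| IJmp (l : nat)
| IHalt.

Definition program := seq instr.
Definition memory := nat -> nat.
Definition config := (nat * memory)%type.

Definition upd (m : memory) (a v : nat) : memory :=
  fun x => if x == a then v else m x.

Definition halted (P : program) (cfg : config) : bool :=
  if nth IHalt P cfg.1 is IHalt then true else false.

Definition step (P : program) (cfg : config) : config :=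
  let: (pc, m) := cfg in
  match nth IHalt P pc with
  | IConst r c => (pc.+1, upd m r c)
  | IAdd r a b => (pc.+1, upd m r (m a + m b))
  | ISub r a b => (pc.+1, upd m r (m a - m b))
  | ILoad r a => (pc.+1, upd m r (m (m a)))
  | IStore a r => (pc.+1, upd m (m a) (m r))
  | IJz r l => (if m r == 0 then l else pc.+1, m)
  | IJmp l => (l, m)
  | IHalt => (pc, m)
  end.

Definition run (P : program) (t : nat) (m0 : memory) : config :=
  iter t (step P) (0, m0).

Definition nat_input (k : nat) : memory := fun a => if a == 0 then k else 0.

Definition adj_nat (n : nat) (e : rel 'I_n) (i j : nat) : bool :=
  match @insub nat (fun x => x < n) 'I_n i, @insub nat (fun x => x < n) 'I_n j with
  | Some x, Some y => e x y
  | _, _ => false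
  end.

(* M[0] = n, M[1] = k, M[2 + i*n + j] = adjacency bit of (i,j), all else 0. *)
Definition graph_input (n : nat) (e : rel 'I_n) (k : nat) : memory :=
  fun a => if a == 0 then n else if a == 1 then k
           else if (2 <= a < 2 + n * n) then
             nat_of_bool (adj_nat e ((a - 2) %/ n) ((a - 2) %% n))
           else 0.

(* Main.v *)
Require Import Defs.
From mathcomp Require Import all_boot zify.
Set Implicit Arguments. Unset Strict Implicit. Unset Printing Implicit Defensive.

(** Call G a no-instance if it has no induced subgraph with exactly k edges. Ramsey's theorem, applied
    to tuples of vertices ("blocks"), shows that a no-instance contains no large induced star or
    matching, no large half graph, and no large clique with a vertex having many neighbours and many
    non-neighbours in it: with k = C(a, 2) + r and r < a, each of these yields k edges. The only
    unbounded structure that remains between two vertex sets is a co-matching between two cliques.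
    Let H be the graph of nonadjacent pairs with many common neighbours. In a no-instance the
    components of H have bounded size, and an H-closed vertex set P has boundedly many traces
    N(u) \ P, u in P, because many distinct traces would give a co-matching, hence an H-edge leaving
    P.
    The algorithm adds the vertices one H-component after the other and keeps, for the vertex sets S
    within the treated part P, the distinct rows (e(S), (|N(w) & S|) for w outside P); this is all
    that matters about S later on. In a no-instance the number of rows is bounded in terms of k, so
    the algorithm accepts as soon as there are too many. *)

(** * Ramsey and edge counts *)

(** After Ramsey, adjacency between entries of different blocks is a relation [E] on positions.
    Stars and split cliques force [E] to be symmetric and transitive, and the matching pattern
    forces [E s t] whenever the positions are adjacent inside every block. Nothing excludes [E s t]
    for positions that are nonadjacent inside every block: this is the co-matching. There the two
    vertices of one block have the corresponding entries of all other blocks as common neighbours,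
    which is why H is defined by codegree: a large co-matching shows up as edges of H.

    The treated set cannot be H-closed at every moment, but at most one component is cut at any
    time. Its part of S is small enough to be recorded outright; for the rest only the number of
    vertices per trace matters. This number is bounded for a nonempty trace, since many vertices
    with a common neighbour give an induced star or a clique with more than k edges. *)

Lemma pigeonhole (T : Type) (C : finType) (f : T -> C) (m : nat) (xs : seq T) :
  #|C| * m < size xs -> exists c, m < count (fun x => f x == c) xs.
Proof.
move=> lt_m; apply/existsP; apply: contraLR lt_m; rewrite negb_exists => /forallP small.
have -> : size xs = \sum_(c : C) count (fun x => f x == c) xs.
  elim: xs {small} => [|x xs /= ->]; first by rewrite big1.
  rewrite big_split /= -add1n; congr addn.
  by rewrite (bigD1 (f x)) //= eqxx big1 // => c; rewrite eq_sym => /negbTE->.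
rewrite -leqNgt -sum_nat_const; apply: leq_sum => c _.
by have := small c; rewrite -leqNgt.
Qed.

(** Greedy step of Ramsey's theorem: keep the head and restrict the tail to one frequent colour, at
    the cost of a factor [#|C|]. The colour of a pair then depends only on its earlier element and
    is stored with it. *)
Lemma end_homogeneous (C : finType) (col : nat -> nat -> C) (q : nat) (xs : seq nat) :
  1 < #|C| -> #|C| ^ q <= size xs ->
  exists ys : seq (nat * C), [/\ size ys = q, subseq (unzip1 ys) xs &
    pairwise (fun p p' => col p.1 p'.1 == p.2) ys].
Proof.
move=> C_gt1; elim: q xs => [|q IH] [|x xs] /=; try by exists [::].
  by rewrite leqn0 expn_eq0 => /andP[/eqP c0]; rewrite c0 in C_gt1.
(* The tail has at least #|C|^(q+1) - 1 entries, which exceeds #|C| (#|C|^q - 1) because #|C| > 1;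
   so a class of size at least #|C|^q remains. *)
move=> sz; have [|c c_gt] := @pigeonhole _ _ (col x) (#|C| ^ q).-1 xs.
  by move: sz; rewrite expnS -subn1 mulnBr muln1; move: #|C| C_gt1 => c c_gt1; lia.
have [|ys [sz_ys sub_ys hom_ys]] := IH [seq y <- xs | col x y == c].
  by rewrite size_filter; lia.
exists ((x, c) :: ys); split; rewrite /= ?sz_ys ?eqxx //.
  exact: subseq_trans sub_ys (filter_subseq _ _).
rewrite hom_ys andbT; apply/allP => p p_ys.
have := mem_subseq sub_ys (map_f fst p_ys).
by rewrite mem_filter => /andP[].
Qed.

(** In an end-homogeneous sequence of length #|C| M some stored colour occurs M times, and the
    elements carrying it are homogeneous. *)
Lemma ramsey (C : finType) (col : nat -> nat -> C) (M N : nat) :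
  1 < #|C| -> #|C| ^ (#|C| * M) <= N ->
  exists (c : C) (phi : nat -> nat), (forall i, i < M -> phi i < N) /\
    forall i j, i < j -> j < M -> phi i < phi j /\ col (phi i) (phi j) = c.
Proof.
move=> C_gt1 leN; case: M leN => [|M leN].
  have /card_gt0P[c _] : 0 < #|C| by lia.
  by exists c, id.
have [||ys [sz_ys sub_ys hom_ys]] := @end_homogeneous C col (#|C| * M.+1) (iota 0 N) => //.
  by rewrite size_iota.
have [|c c_gt] := @pigeonhole _ _ snd M ys; first by rewrite sz_ys; nia.
pose zs := [seq p <- ys | p.2 == c].
have sz_zs : M < size zs by rewrite size_filter.
exists c, (fun i => (nth (0, c) zs i).1).
have sub_zs : subseq (unzip1 zs) (iota 0 N).
  by apply: subseq_trans sub_ys; apply: map_subseq; exact: filter_subseq.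
have mem_zs i : i < M.+1 -> nth (0, c) zs i \in zs by move=> iM; exact: mem_nth (leq_trans iM sz_zs).
split=> [i iM|i j ij jM].
  by have := mem_subseq sub_zs (map_f fst (mem_zs _ iM)); rewrite mem_iota.
split.
  have : sorted ltn (unzip1 zs) by apply: subseq_sorted sub_zs (iota_ltn_sorted _ _); exact: ltn_trans.
  rewrite (sorted_pairwise ltn_trans) pairwise_map.
  by move/(pairwiseP (0, c)) => /(_ i j); apply; rewrite ?inE; lia.
have : pairwise (fun p p' => col p.1 p'.1 == p.2) zs.
  exact: subseq_pairwise (filter_subseq _ _) hom_ys.
have iM := ltn_trans ij jM.
move/(pairwiseP (0, c)) => /(_ i j); rewrite !inE.
move=> /(_ (leq_trans iM sz_zs) (leq_trans jM sz_zs) ij) /eqP->.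
have := mem_zs _ iM.
by rewrite mem_filter => /andP[/eqP].
Qed.

Lemma pairwise_iota (r : rel nat) (x y : nat) :
  (forall i j, x <= i -> i < j -> j < x + y -> r i j) -> pairwise r (iota x y).
Proof.
move=> hr; apply/(pairwiseP 0) => i j; rewrite !inE size_iota => iy jy ij.
by rewrite !nth_iota //; apply: hr; lia.
Qed.

Lemma triangular_decomp (k : nat) :
  exists a r, [/\ k = 'C(a, 2) + r, r < a & a <= k.+1].
Proof.
elim: k => [|k [a [r [-> ra ak]]]]; first by exists 1, 0.
case: (ltnP r.+1 a) => [?|?]; first by exists a, r.+1; split; lia.
exists a.+1, 0; split; [rewrite binS bin1|..]; lia.
Qed.

Section EdgeCount.
Variable V : eqType.
Implicit Types (r : rel V) (s : seq V).

(** Vertex sets are duplicate-free lists here, so that adding a vertex is a [cons] and a disjoint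
    union a concatenation; [ec_perm] makes the order irrelevant for symmetric [r]. *)
Fixpoint ec r s : nat := if s is x :: s' then count (r x) s' + ec r s' else 0.

Lemma ec_cat r s1 s2 :
  ec r (s1 ++ s2) = ec r s1 + ec r s2 + sumn [seq count (r x) s2 | x <- s1].
Proof. by elim: s1 => [|x s1 IH] /=; rewrite ?addn0 // IH count_cat; lia. Qed.

Lemma ec_clique r s : pairwise r s -> ec r s = 'C(size s, 2).
Proof.
elim: s => //= x s IH; rewrite all_count => /andP[/eqP-> /IH->].
by rewrite binS bin1 addnC.
Qed.

Lemma ec_indep r s : pairwise (fun x y => ~~ r x y) s -> ec r s = 0.
Proof.
elim: s => //= x s IH /andP[hx /IH->]; rewrite addn0; apply/eqP.
by rewrite -leqn0 leqNgt -has_count -all_predC.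
Qed.

Lemma ec_compl r s : ec r s + ec (fun x y => ~~ r x y) s = 'C(size s, 2).
Proof.
elim: s => //= x s IH; rewrite binS bin1 -IH -(count_predC (r x) s) /=.
by rewrite [LHS]addnACA addnC.
Qed.

Lemma ec_sub r s1 s2 : subseq s1 s2 -> ec r s1 <= ec r s2.
Proof.
elim: s2 s1 => [|y s2 IH] [|x s1] //=; case: eqP => [->|_] sub.
  by apply: leq_add; [apply: leq_count_subseq | apply: IH].
by apply: leq_trans (IH _ sub) _; rewrite leq_addl.
Qed.

Lemma eq_in_ec r1 r2 s : uniq s -> {in s &, forall x y, x != y -> r1 x y = r2 x y} ->
  ec r1 s = ec r2 s.
Proof.
elim: s => //= x s IH /andP[xs us] eqr; congr addn.
  apply: eq_in_count => y ys; apply: eqr; rewrite ?inE ?eqxx ?ys ?orbT //.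
  by apply: contraNneq xs => ->.
by apply: IH us _ => y z ys zs; apply: eqr; rewrite inE ?ys ?zs orbT.
Qed.

Lemma ec_perm r s1 s2 : symmetric r -> perm_eq s1 s2 -> ec r s1 = ec r s2.
Proof.
move=> rsym; elim: s1 s2 => [|x s1 IH] s2 eq12.
  by have /nilP-> : size s2 == 0 by rewrite -(perm_size eq12).
have x_s2 : x \in s2 by rewrite -(perm_mem eq12) mem_head.
case/splitPr: x_s2 eq12 => [t1 t2] eq12.
have eq12' : perm_eq s1 (t1 ++ t2).
  by rewrite -(perm_cons x); apply: perm_trans eq12 _; rewrite (perm_catCA t1 [:: x] t2).
rewrite /= (IH _ eq12') ec_cat ec_cat /= (permP eq12') count_cat.
have -> : sumn [seq r y x + count (r y) t2 | y <- t1]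
  = count (r x) t1 + sumn [seq count (r y) t2 | y <- t1].
  by elim: t1 {eq12 eq12' IH} => //= y t1 ->; rewrite rsym; lia.
lia.
Qed.

End EdgeCount.

(** * Patterns with exactly k edges *)

Section Patterns.
Variables (V : finType) (e : rel V).
Hypotheses (esym : symmetric e) (eirr : irreflexive e).

(** The empty list is allowed; it can matter only for k = 0, where a single vertex does as well. *)
Definition attains k := exists2 s : seq V, uniq s & ec e s = k.

Lemma clique_uniq s : pairwise e s -> uniq s.
Proof.
rewrite uniq_pairwise; apply: sub_pairwise => x y /=.
by apply: contraTneq => ->; rewrite eirr.
Qed.

Lemma star_attains k x l :
  uniq l -> k <= size l -> all (e x) l -> pairwise (fun y z => ~~ e y z) l -> attains k.
Proof.
move=> ul kl xl indl; exists (x :: take k l) => /=.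
  rewrite take_uniq // andbT; apply/negP => /mem_take /(allP xl).
  by rewrite eirr.
rewrite ec_indep; last exact: subseq_pairwise (take_subseq _ _) indl.
rewrite addn0 -[RHS](size_takel kl); apply/eqP; rewrite -all_count.
by apply/allP => y /mem_take; exact/allP.
Qed.

(* With k = C(a, 2) + r and r < a: a vertices of the clique, of which r are adjacent to y. *)
Lemma clique_vertex_attains k y q1 q2 :
  pairwise e (q1 ++ q2) -> all (e y) q1 -> all (fun z => ~~ e y z) q2 -> y \notin q2 ->
  k < size q1 -> k < size q2 -> attains k.
Proof.
move=> cl a1 a2 yq2 k1 k2; have [a [r [kE ra ak]]] := triangular_decomp k.
set s := take r q1 ++ take (a - r) q2.
have cls : pairwise e s.
  by apply: subseq_pairwise cl; apply: cat_subseq; exact: take_subseq.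
exists (y :: s) => /=.
  rewrite clique_uniq // andbT mem_cat negb_or; apply/andP; split.
    by apply/negP => /mem_take/(allP a1); rewrite eirr.
  by apply: contra yq2; exact: mem_take.
rewrite ec_clique // size_cat count_cat.
have -> : count (e y) (take r q1) = r.
  have r1 : r <= size q1 by lia.
  rewrite -[RHS](size_takel r1).
  by apply/eqP; rewrite -all_count; apply/allP => z /mem_take/(allP a1).
have -> : count (e y) (take (a - r) q2) = 0.
  by apply/eqP; rewrite -leqn0 leqNgt -has_count -all_predC; apply/allP => z /mem_take/(allP a2).
have r1 : r <= size q1 by lia.
have r2 : a - r <= size q2 by lia.
rewrite !size_takel //.
by rewrite subnKC ?(ltnW ra) // addn0 addnC.
Qed.

(* With k = C(a + 1, 2) - m and 0 < m <= a: a clique on a + 1 vertices lacking m edges. *)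
Lemma clique_minus_attains k q1 q2 :
  pairwise e q2 -> allrel e q1 q2 -> k < size q2 ->
  (forall m, 0 < m -> m <= k.+1 -> exists s, [/\ {subset s <= q1}, uniq s, size s = m.+1 &
     ec (fun x y => ~~ e x y) s = m]) -> attains k.
Proof.
move=> c2 a12 k2 Hm.
have [a [r [kE ra ak]]] := triangular_decomp k.
(* C(a, 2) + r = C(a + 1, 2) - (a - r): the a - r + 1 vertices of [s] carry all missing edges, and r
   vertices of [q2] complete them to a + 1. *)
have [||s [sub_s us sz_s ec_s]] := Hm (a - r); [lia|lia|].
have [s2 s2E] : exists s2, s2 = take r q2 by exists (take r q2).
have sub_s2 : subseq s2 q2 by rewrite s2E take_subseq.
have c2' : pairwise e s2 by apply: subseq_pairwise c2.
have a12' : allrel e s s2.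
  apply/allrelP => x y xs ys; apply: (allrelP a12).
    exact: sub_s.
  exact: mem_subseq sub_s2 _ ys.
exists (s ++ s2).
  rewrite cat_uniq us clique_uniq // andbT.
  apply/hasPn => y ys2; apply/negP => ys.
  by have := allrelP a12' _ _ ys ys2; rewrite eirr.
have := ec_compl e (s ++ s2); rewrite [X in _ + X]ec_cat ec_s.
rewrite (@ec_indep _ (fun x y => ~~ e x y) s2); last first.
  by apply: sub_pairwise c2' => x y ->.
have -> : sumn [seq count (fun y => ~~ e x y) s2 | x <- s] = 0.
  apply/eqP; rewrite sumnE big_map; rewrite sum_nat_seq_eq0.
  apply/allP => x xs /=; rewrite -leqn0 leqNgt -has_count -all_predC.
  by apply/allP => y ys /=; rewrite negbK; exact: (allrelP a12').
have r2 : r <= size q2 by lia.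
have sz : size (s ++ s2) = a.+1 by rewrite size_cat sz_s s2E size_takel // addSn subnK // ltnW.
rewrite sz binS bin1 => h; lia.
Qed.

(** * Homogeneous families of blocks *)

Section Blocks.
Variables (k L M : nat) (E : nat -> nat -> bool) (b : nat -> nat -> V).
Hypothesis bigM : 3 * k + 6 <= M.
Hypothesis homE : forall i j s t, i < j -> j < M -> s < L -> t < L -> e (b i s) (b j t) = E s t.
Hypothesis injb : forall i j s t, i < M -> j < M -> s < L -> t < L -> b i s = b j t -> i = j /\ s = t.
Hypothesis nattains : ~ attains k.

Definition blk s x y : seq V := [seq b i s | i <- iota x y].

Lemma blk_uniq s x y : s < L -> x + y <= M -> uniq (blk s x y).
Proof.
move=> sL xyM; rewrite map_inj_in_uniq ?iota_uniq // => i j.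
rewrite !mem_iota => hi hj eqb; have [||//] := injb _ _ sL sL eqb; lia.
Qed.

Lemma blk_pairwise (r : rel V) s x y :
  (forall i j, x <= i -> i < j -> j < x + y -> r (b i s) (b j s)) -> pairwise r (blk s x y).
Proof. by move=> hr; rewrite pairwise_map; apply: pairwise_iota. Qed.

(** Otherwise entry [s] of the first block is the centre of an induced star whose leaves are the
    entries [t] of later blocks. [blocks_diag_l] is the mirror image, with the centre in a late
    block. *)
Lemma blocks_diag_r s t : s < L -> t < L -> E s t -> E t t.
Proof.
move=> sL tL Est; apply/negPn/negP => nEtt; apply: nattains.
apply: (@star_attains k (b 0 s) (blk t 1 k)).
- by rewrite blk_uniq //; lia.
- by rewrite /blk size_map size_iota.
- by apply/allP => z /mapP[i]; rewrite mem_iota => ? ->; rewrite homE //; lia.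
- by apply: blk_pairwise => i j ? ? ?; rewrite homE //; lia.
Qed.

Lemma blocks_diag_l s t : s < L -> t < L -> E s t -> E s s.
Proof.
move=> sL tL Est; apply/negPn/negP => nEss; apply: nattains.
apply: (@star_attains k (b k t) (blk s 0 k)).
- by rewrite blk_uniq //; lia.
- by rewrite /blk size_map size_iota.
- by apply/allP => z /mapP[i]; rewrite mem_iota => ? ->; rewrite esym homE //; lia.
- by apply: blk_pairwise => i j ? ? ?; rewrite homE //; lia.
Qed.

Lemma blocks_clique s x y : s < L -> E s s -> x + y <= M -> pairwise e (blk s x y).
Proof. by move=> sL Ess xyM; apply: blk_pairwise => i j ? ? ?; rewrite homE //; lia. Qed.

(* Otherwise a half graph: b_k(t) splits the clique of the b_i(s) into i < k and i > k. *)
Lemma blocks_sym s t : s < L -> t < L -> E s t -> E t s.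
Proof.
move=> sL tL Est; apply/negPn/negP => nEts; apply: nattains.
have Ess := blocks_diag_l sL tL Est.
apply: (@clique_vertex_attains k (b k.+1 t) (blk s 0 k.+1) (blk s k.+2 k.+1)).
- rewrite pairwise_cat !blocks_clique ?andbT //; try lia.
  apply/allrelP => _ _ /mapP[i hi ->] /mapP[j hj ->].
  by move: hi hj; rewrite !mem_iota => ? ?; rewrite homE //; lia.
- by apply/allP => z /mapP[i]; rewrite mem_iota => ? ->; rewrite esym homE //; lia.
- by apply/allP => z /mapP[i]; rewrite mem_iota => ? ->; rewrite homE //; lia.
- by apply/mapP => -[i]; rewrite mem_iota => ? /injb[] //; lia.
- by rewrite /blk size_map size_iota.
- by rewrite /blk size_map size_iota.
Qed.

(** Otherwise the entry [u] of a late block splits a clique: it sees the entries [t] and misses the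
    entries [s], and by symmetry of [E] these are complete to each other. Hence the positions with
    [E s s] fall into classes, each of them a clique across different blocks. *)
Lemma blocks_trans s t u : s < L -> t < L -> u < L -> E s t -> E t u -> E s u.
Proof.
move=> sL tL uL Est Etu; apply/negPn/negP => nEsu; apply: nattains.
have Ess := blocks_diag_l sL tL Est; have Ett := blocks_diag_r sL tL Est.
apply: (@clique_vertex_attains k (b (2 * k.+1) u) (blk t 0 k.+1) (blk s k.+1 k.+1)).
- rewrite pairwise_cat !blocks_clique ?andbT //; try lia.
  apply/allrelP => _ _ /mapP[i hi ->] /mapP[j hj ->].
  by move: hi hj; rewrite !mem_iota => ? ?; rewrite homE; [exact: blocks_sym|lia..].
- by apply/allP => z /mapP[i]; rewrite mem_iota => ? ->; rewrite esym homE //; lia.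
- by apply/allP => z /mapP[i]; rewrite mem_iota => ? ->; rewrite esym homE //; lia.
- by apply/mapP => -[i]; rewrite mem_iota => ? /injb[] //; lia.
- by rewrite /blk size_map size_iota.
- by rewrite /blk size_map size_iota.
Qed.

(* C(x, 2), C(y, 2) count the two sides when they are cliques, o the matching edges used. *)
Lemma matching_decomp (c d : bool) :
  exists x y o, [/\ c * 'C(x, 2) + d * 'C(y, 2) + o = k, o <= x, o <= y, x <= k.+1 & y <= k.+1].
Proof.
have [a [r [kE ra ak]]] := triangular_decomp k.
case: c; case: d.
- have [y [o [rE oy yr]]] := triangular_decomp r.
  by exists a, y, o; split; lia.
- by exists a, r, r; split; lia.
- by exists r, a, r; split; lia.
- by exists k, k, k; split; lia.
Qed.

(** Otherwise the two sides, each a clique or independent, are joined exactly by the matching of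
    equal indices. Taking the index ranges [0, x) and [x - o, x - o + y), which share o indices,
    uses exactly o matching edges. *)
Lemma blocks_matching s t : s < L -> t < L -> s != t ->
  (forall i, i < 2 * k + 2 -> e (b i s) (b i t)) -> E s t.
Proof.
move=> sL tL st D; apply/negPn/negP => nEst; apply: nattains.
have nEts : ~~ E t s by apply: contra nEst; apply: blocks_sym.
have [x [y [o [kE ox oy xk yk]]]] := matching_decomp (E s s) (E t t).
have eD i j : i < 2 * k + 2 -> j < 2 * k + 2 -> e (b i s) (b j t) = (j == i).
  move=> ? ?; case: (ltngtP j i) => [ji|ij|->]; last by rewrite D.
    by rewrite esym homE ?(negbTE nEts) //; lia.
  by rewrite homE ?(negbTE nEst) //; lia.
exists (blk s 0 x ++ blk t (x - o) y).
  rewrite cat_uniq !blk_uniq ?andbT //; try lia.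
  apply/hasPn => _ /mapP[j hj ->]; apply/mapP => -[i hi].
  move: hi hj; rewrite !mem_iota => hi hj /injb[] //; try lia.
rewrite ec_cat -{}kE.
have ecb r z w : r < L -> z + w <= M -> ec e (blk r z w) = E r r * 'C(w, 2).
  move=> rL zw; case Err: (E r r).
    by rewrite ec_clique ?blocks_clique // size_map size_iota mul1n.
  rewrite ec_indep //; apply: blk_pairwise => i j ? ? ?; rewrite homE ?Err //; lia.
rewrite !ecb //; try lia; congr addn.
rewrite -map_comp sumnE big_map.
rewrite (eq_big_seq (fun i => (i \in iota (x - o) y) : nat)); last first.
  move=> i; rewrite mem_iota => ix /=; rewrite count_map -count_uniq_mem ?iota_uniq //.
  by apply: eq_in_count => j; rewrite mem_iota => jx /=; rewrite eD //; lia.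
have -> : iota 0 x = iota 0 (x - o) ++ iota (x - o) o by have := iotaD 0 (x - o) o; rewrite subnK // add0n.
rewrite big_cat /= big1_seq ?add0n; last first.
  by move=> i /andP[_]; rewrite mem_iota => hi; apply/eqP; rewrite eqb0 mem_iota; lia.
rewrite (eq_big_seq (fun=> 1)); last by move=> i; rewrite mem_iota => hi; apply/eqP; rewrite eqb1 mem_iota; lia.
by rewrite sum1_size size_iota.
Qed.

End Blocks.
End Patterns.

(** * Geodesics and homogeneous blocks *)

Lemma card_bigcup_le (I V : finType) (A : {set I}) (F : I -> {set V}) :
  #|\bigcup_(i in A) F i| <= \sum_(i in A) #|F i|.
Proof.
elim/big_rec2: _ => [|i m X _ leX]; first by rewrite cards0.
by apply: leq_trans (leq_card_setU _ _) _; rewrite leq_add2l.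
Qed.

Section Geodesics.
Variables (V : finType) (r : rel V) (v : V).
Hypothesis rsym : symmetric r.

Fixpoint ball j : {set V} :=
  if j is j'.+1 then ball j' :|: \bigcup_(x in ball j') [set y | r x y] else [set v].

Lemma ball_mono i j : i <= j -> ball i \subset ball j.
Proof.
elim: j => [|j IH]; first by rewrite leqn0 => /eqP->.
rewrite leq_eqVlt => /orP[/eqP->//|/IH sub].
by apply: subset_trans sub _; rewrite subsetUl.
Qed.

Lemma ball_step j x y : x \in ball j -> r x y -> y \in ball j.+1.
Proof.
move=> xB rxy; rewrite /= inE; apply/orP; right.
by apply/bigcupP; exists x; rewrite ?inE.
Qed.

Lemma ball_connect j x : x \in ball j -> connect r v x.
Proof.
elim: j x => [|j IH] x /=; first by rewrite inE => /eqP->.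
rewrite inE => /orP[/IH//|/bigcupP[y /IH vy]]; rewrite inE => ryx.
exact: connect_trans vy (connect1 ryx).
Qed.

Lemma card_ball D j : (forall x, #|[set y | r x y]| <= D) -> #|ball j| <= D.+1 ^ j.
Proof.
move=> deg; elim: j => [|j IH] /=; first by rewrite cards1.
apply: leq_trans (leq_card_setU _ _) _.
rewrite expnS mulSn; apply: leq_add => //.
apply: leq_trans (card_bigcup_le _ _) _.
apply: (@leq_trans (\sum_(i in ball j) D)); first by apply: leq_sum.
by rewrite sum_nat_const mulnC leq_mul2l IH orbT.
Qed.

(** A shortest path is induced: the vertices after the predecessor of [w] lie in balls too small to
    contain a neighbour of [w]. *)
Lemma geodesic_to j w : w \in ball j -> (forall i, i < j -> w \notin ball i) ->
  exists p, [/\ size p = j, path r w p, uniq (w :: p), ec r (w :: p) = j &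
    forall y, y \in p -> exists2 i, i < j & y \in ball i].
Proof.
elim: j w => [|j IH] w wB wN; first by exists [::].
have : w \notin ball j by exact: wN.
move: (wB); rewrite /= inE => /orP[->//|/bigcupP[x xB]]; rewrite inE => rxw _.
have [|p [szp pp up ep inp]] := IH x xB.
  by move=> i ij; apply/negP => /ball_step/(_ rxw); apply/negP; exact: wN.
have inxp y : y \in x :: p -> exists2 i, i < j.+1 & y \in ball i.
  rewrite inE => /orP[/eqP->|/inp[i ij yi]]; first by exists j.
  by exists i => //; exact: leqW.
exists (x :: p); split => //.
- by rewrite /= szp.
- by rewrite /= rsym rxw.
- rewrite [uniq _]/= -/(uniq (x :: p)) up andbT; apply/negP => /inxp[i ij].
  by apply/negP; exact: wN.
- rewrite -[RHS]add1n -[in RHS]ep /= rsym rxw.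
  have -> // : count (r w) p = 0.
  apply/eqP; rewrite -leqn0 leqNgt -has_count; apply/hasPn => y /inp[i ij yi].
  apply/negP; rewrite rsym => /(ball_step yi); apply/negP; exact: wN.
Qed.

(** If no vertex has distance exactly [l] from [v], the ball of radius l - 1 is closed under [r] and
    contains the whole component, which is too large for it. *)
Lemma long_geodesic D l :
  (forall x, #|[set y | r x y]| <= D) -> D.+1 ^ l < #|[set x | connect r v x]| ->
  exists p, [/\ size p = l.+1, uniq p, ec r p = l, sorted r p & forall y, y \in p -> connect r v y].
Proof.
move=> deg big; have [w wB wN] : exists2 w, w \in ball l & forall i, i < l -> w \notin ball i.
  case: l big => [|l] big; first by exists v; rewrite // inE.
  have /subsetPn[w wB wN] : ~~ (ball l.+1 \subset ball l).
    apply: contraL big => closed_l; rewrite -leqNgt.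
    apply: (@leq_trans #|ball l|); last first.
      by apply: leq_trans (card_ball l deg) _; rewrite leq_pexp2l.
    apply: subset_leq_card; apply/subsetP => x; rewrite inE => vx.
    rewrite -(@closed_connect _ r (mem (ball l)) _ _ _ vx) ?(subsetP (ball_mono (leq0n l))) ?inE //.
    apply: intro_closed => [|a c rac aB]; first exact: sym_connect_sym.
    exact: (subsetP closed_l) (ball_step aB rac).
  by exists w => // i il; apply: contra wN; apply/subsetP; exact: ball_mono.
have [p [szp pp up ep inp]] := geodesic_to wB wN.
exists (w :: p); split => //; first by rewrite /= szp.
move=> y; by rewrite inE => /orP[/eqP->|/inp[i _]]; apply: ball_connect; eassumption.
Qed.

End Geodesics.

(** Greedy: each set has room for [F] and all the representatives chosen before. *)
Lemma distinct_representatives (V : finType) (v0 : V) (N : nat) (C : nat -> {set V}) (F : seq V) :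
  (forall i, i < N -> size F + N <= #|C i|) ->
  exists x : nat -> V, (forall i, i < N -> x i \in C i /\ x i \notin F) /\
    (forall i j, i < N -> j < N -> x i = x j -> i = j).
Proof.
elim: N => [|N IH] big; first by exists (fun=> v0).
have [i iN|x [xC xI]] := IH; first by apply: leq_trans (big i _); lia.
have /subsetPn[y yC yN] : ~~ (C N \subset F ++ map x (iota 0 N)).
  apply/negP => /subset_leq_card /leq_trans/(_ (card_size _)).
  by rewrite leqNgt size_cat size_map size_iota -addnS big.
move: yN; rewrite mem_cat negb_or => /andP[yF yx].
have ynew i : i < N -> x i != y.
  by move=> iN; apply: contraNneq yx => <-; apply: map_f; rewrite mem_iota.
exists (fun i => if i == N then y else x i); split=> [i|i j].
  case: eqP => [->//|/eqP iN] iN1; apply: xC; lia.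
case: eqP => [->|/eqP iN]; case: eqP => [->//|/eqP jN] iN1 jN1.
- by move=> yx'; have := ynew j; rewrite -yx' eqxx; lia.
- by move=> xy'; have := ynew i; rewrite xy' eqxx; lia.
- by apply: xI; lia.
Qed.

(** The Ramsey bound for 2^(L L + 1) colours: L L bits for the adjacency between the positions of
    two blocks, one more for the flag [d]. *)
Definition ram L M := (2 ^ (L * L).+1) ^ (2 ^ (L * L).+1 * M).

(** The flag of a block is part of the colour of every pair that this block begins. The last index
    begins no pair, hence [M.+1] in the bound for [M] blocks. *)
Lemma homogenize (V : Type) (e : rel V) (b : nat -> nat -> V) (d : nat -> bool) L M N :
  ram L M.+1 <= N ->
  exists (E : nat -> nat -> bool) (D : bool) (phi : nat -> nat),
    [/\ forall i, i < M -> phi i < N, forall i j, i < j -> j < M -> phi i < phi j,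
     forall i j s t, i < j -> j < M -> s < L -> t < L -> e (b (phi i) s) (b (phi j) t) = E s t &
     forall i, i < M -> d (phi i) = D].
Proof.
move=> leN; pose C : finType := ({ffun 'I_L * 'I_L -> bool} * bool)%type.
pose col i j : C := ([ffun p : 'I_L * 'I_L => e (b i p.1) (b j p.2)], d i).
have cardC : #|C| = 2 ^ (L * L).+1.
  by rewrite card_prod card_ffun card_prod !card_ord card_bool expnS mulnC.
have [||c [phi [phiN phiP]]] := @ramsey C col M.+1 N.
- by rewrite cardC -{1}(expn0 2) ltn_exp2l.
- by rewrite cardC.
exists (fun s t => if (insub s, insub t) is (Some s', Some t') then c.1 (s', t') else false).
exists c.2, phi; split=> [i iM|i j ij jM|i j s t ij jM sL tL|i iM].
- by apply: phiN; exact: leqW.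
- by apply: (phiP _ _ ij _).1; exact: leqW.
- have <- := (phiP _ _ ij (leqW jM)).2.
  by rewrite !insubT /= ffunE.
- by have <- := (phiP _ _ (ltnSn i) iM).2.
Qed.

(** * Nonadjacent pairs with many common neighbours *)

(** Each [ram] bound is taken at one more than the number of blocks wanted, as in [homogenize]: 3k +
    6 blocks of two entries here, k + 2 single vertices in [pair_bd]. *)
Definition deg_bd k := ram 2 (3 * k + 7).
Definition pair_bd k := ram 1 (k + 3).
(** A connected graph with this many vertices and degrees at most [pair_bd k] has an induced path
    with m edges for every m <= k + 1. *)
Definition block_len k := (pair_bd k).+1 ^ k.+1 + 1.
Definition path_blocks k := ram (2 * block_len k) (3 * k + 7).
Definition path_len k := path_blocks k * block_len k.
Definition comp_bd k := (deg_bd k).+1 ^ path_len k.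
(** Enough common neighbours for distinct representatives in both uses: for [deg_bd k] pairs, and
    for the [path_len k] consecutive pairs of a path whose [path_len k] + 1 vertices are to be
    avoided. *)
Definition codeg_bd k := deg_bd k + 2 * path_len k + 1.

Section Bounds.
Variables (V : finType) (e : rel V) (k : nat).
Hypotheses (esym : symmetric e) (eirr : irreflexive e) (nattains : ~ attains e k).

(* Nonadjacent vertices with many common neighbours: the only kind of pair for which the
   co-matchings of two large cliques can be large in a graph without k-edge induced subgraph. *)
Definition hedge T (u v : V) := [&& u != v, ~~ e u v & T <= #|[set x | e u x && e v x]|].

Lemma hedge_sym T : symmetric (hedge T).
Proof.
move=> u v; rewrite /hedge eq_sym esym; suff -> : [set x | e u x && e v x] = [set x | e v x && e u x] by [].
by apply/setP => x; rewrite !inE andbC.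
Qed.

Lemma clique_or_independent (vs : seq V) :
  uniq vs -> pair_bd k <= size vs ->
  exists ws, [/\ {subset ws <= vs}, uniq ws, k.+1 < size ws &
    pairwise e ws \/ pairwise (fun x y => ~~ e x y) ws].
Proof.
move=> uvs big; have v0 : V.
  by case: vs uvs big => [|v ?] // _; rewrite leqn0 /pair_bd /ram !expn_eq0.
have [|E [_ [phi [phiN phi_mono hom _]]]] :=
  @homogenize _ e (fun i _ => nth v0 vs i) (fun=> true) 1 k.+2 (size vs).
  by rewrite -addn3.
have hom' i j : i < j -> j < k.+2 -> e (nth v0 vs (phi i)) (nth v0 vs (phi j)) = E 0 0.
  by move=> ij jk; rewrite (hom i j 0 0).
have hom_pair (r : rel V) : (forall i j, i < j -> j < k.+2 ->
    r (nth v0 vs (phi i)) (nth v0 vs (phi j))) ->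
    pairwise r [seq nth v0 vs (phi i) | i <- iota 0 k.+2].
  by move=> hr; rewrite pairwise_map; apply: pairwise_iota => i j _; exact: hr.
exists [seq nth v0 vs (phi i) | i <- iota 0 k.+2]; split.
- by move=> x /mapP[i]; rewrite mem_iota => /phiN ik ->; exact: mem_nth.
- rewrite uniq_pairwise; apply: hom_pair => i j ij jk.
  by rewrite /= nth_uniq ?phiN ?(ltn_trans ij) // ltn_eqF // phi_mono.
- by rewrite size_map size_iota.
- case E00: (E 0 0); [left|right]; apply: hom_pair => i j ij jk.
    by rewrite hom'.
  by rewrite hom' // E00.
Qed.

(* Blocks (v_i, x_i) with v_i a hedge-neighbour of u and x_i a common neighbour: after Ramsey the
   x_i and v_i together form one clique, and u is adjacent to the x_i only. *)
Lemma hedge_degree T u : codeg_bd k <= T -> #|[set v | hedge T u v]| <= deg_bd k.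
Proof.
move=> bigT; rewrite leqNgt; apply/negP => big.
pose v i := nth u (enum [set v | hedge T u v]) i.
have vhp i : i < deg_bd k -> hedge T u (v i).
  move=> iN; have : v i \in enum [set v | hedge T u v].
    by apply: mem_nth; rewrite -cardE; exact: ltn_trans big.
  by rewrite mem_enum inE.
have [|x [xC xI]] := @distinct_representatives _ u (deg_bd k) (fun i => [set x | e u x && e (v i) x]) [::].
  move=> i /vhp/and3P[_ _]; apply: leq_trans; apply: leq_trans bigT.
  by rewrite add0n /codeg_bd -addnA leq_addr.
pose b i s := if s == 0 then v i else x i.
have [|E [D [phi [phiN phi_mono hom _]]]] :=
  @homogenize _ e b (fun=> true) 2 (3 * k + 6) (deg_bd k).
  by rewrite /deg_bd -addnS.
have ux i : i < deg_bd k -> e u (x i).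
  by move=> /xC[]; rewrite inE => /andP[].
have vx i : i < deg_bd k -> e (v i) (x i).
  by move=> /xC[]; rewrite inE => /andP[].
have uv i : i < deg_bd k -> ~~ e u (v i) by move=> /vhp/and3P[].
have phiI i j : i < 3 * k + 6 -> j < 3 * k + 6 -> phi i = phi j -> i = j.
  move=> iM jM eqphi; case: (ltngtP i j) => // [ij|ji].
    by have := phi_mono _ _ ij jM; rewrite eqphi ltnn.
  by have := phi_mono _ _ ji iM; rewrite eqphi ltnn.
have vI i j : i < deg_bd k -> j < deg_bd k -> v i = v j -> i = j.
  move=> iN jN /eqP; rewrite /v nth_uniq ?enum_uniq -?cardE ?(ltn_trans _ big) //; exact: eqP.
have injb i j s t : i < 3 * k + 6 -> j < 3 * k + 6 -> s < 2 -> t < 2 ->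
    b (phi i) s = b (phi j) t -> i = j /\ s = t.
  move=> iM jM; rewrite /b; case: s t => [|[|//]] [|[|//]] _ _ /=.
  - by move/vI => /(_ (phiN _ iM) (phiN _ jM))/phiI->.
  - by move=> eqvx; have := uv _ (phiN _ iM); rewrite eqvx ux // phiN.
  - by move=> eqvx; have := uv _ (phiN _ jM); rewrite -eqvx ux // phiN.
  - by move/xI => /(_ (phiN _ iM) (phiN _ jM))/phiI->.
have bigM := leqnn (3 * k + 6).
have E01 : E 0 1.
  apply: (blocks_matching esym eirr bigM hom injb nattains) => // i ik.
  by rewrite /b /= vx // phiN //; lia.
have E10 : E 1 0 by apply: (blocks_sym esym eirr bigM hom injb nattains).
have E00 : E 0 0 by apply: (blocks_diag_l esym eirr bigM hom injb nattains _ _ E01).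
have E11 : E 1 1 by apply: (blocks_diag_r eirr bigM hom injb nattains _ _ E01).
apply: nattains; apply: (@clique_vertex_attains _ e eirr k u
  [seq b (phi i) 1 | i <- iota 0 k.+1] [seq b (phi i) 0 | i <- iota k.+1 k.+1]).
- rewrite pairwise_cat !pairwise_map !pairwise_iota ?andbT; last 2 first.
  + by move=> i j ? ? ?; rewrite /= hom //; lia.
  + by move=> i j ? ? ?; rewrite /= hom //; lia.
  apply/allrelP => _ _ /mapP[i hi ->] /mapP[j hj ->].
  by move: hi hj; rewrite !mem_iota => ? ?; rewrite hom //; lia.
- by apply/allP => z /mapP[i]; rewrite mem_iota => ? ->; rewrite ux // phiN //; lia.
- by apply/allP => z /mapP[i]; rewrite mem_iota => ? ->; rewrite uv // phiN //; lia.
- apply/mapP => -[i]; rewrite mem_iota => hi uE.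
  have /vhp/and3P[] : phi i < deg_bd k by apply: phiN; lia.
  by rewrite {1}uE eqxx.
- by rewrite size_map size_iota.
- by rewrite size_map size_iota.
Qed.

Lemma mulnD_inj l i j s t : s < l -> t < l -> i * l + s = j * l + t -> i = j /\ s = t.
Proof.
move=> sl tl eqs; have eqij : i = j.
  by have := congr1 (divn^~ l) eqs; rewrite !divnMDl ?divn_small ?addn0 //; lia.
by split=> //; move: eqs; rewrite eqij => /addnI.
Qed.

(* Blocks of consecutive vertices of a long hedge-path, together with common neighbours of consecutive
   ones: after Ramsey all path vertices of different blocks are adjacent. A single block is connected
   in the complement, hence carries an induced star or path of the complement with any small number
   of edges; vertices of the other blocks complete it to a clique lacking exactly these edges. *)
Lemma hedge_component T v : codeg_bd k <= T -> #|[set u | connect (hedge T) v u]| <= comp_bd k.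
Proof.
move=> bigT; rewrite leqNgt; apply/negP => big.
have [p [szp up _ sp _]] := long_geodesic (@hedge_sym T) (fun u => hedge_degree u bigT) big.
pose l := block_len k; pose P i := nth v p i.
have l_gt0 : 0 < l by rewrite /l /block_len addn1.
have hpP i : i < path_len k -> hedge T (P i) (P i.+1).
  by move=> ip; have /(sortedP v) := sp; apply; rewrite szp ltnS.
have PI i j : i < path_len k -> j < path_len k -> P i = P j -> i = j.
  by move=> ip jp /eqP; rewrite nth_uniq ?szp ?leqW //; move/eqP.
have [|x [xC xI]] := @distinct_representatives _ v (path_len k)
    (fun i => [set x | e (P i) x && e (P i.+1) x]) p.
  move=> i /hpP/and3P[_ _]; apply: leq_trans; apply: leq_trans bigT.
  by rewrite szp /codeg_bd; lia.
have Px i : i < path_len k -> e (P i) (x i).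
  by move=> /xC[]; rewrite inE => /andP[].
have Psx i : i < path_len k -> e (P i.+1) (x i).
  by move=> /xC[]; rewrite inE => /andP[].
(* Positions below [l] hold path vertices; position l + s holds the common neighbour chosen for the
   path vertex at s and its successor. *)
pose b i s := if s < l then P (i * l + s) else x (i * l + (s - l)).
have [|E [D [phi [phiN phi_mono hom _]]]] :=
  @homogenize _ e b (fun=> true) (2 * l) (3 * k + 6) (path_blocks k).
  by rewrite /path_blocks -addnS.
have idx i s : i < path_blocks k -> s < l -> i * l + s < path_len k.
  by rewrite /path_len -/l => *; nia.
have phiI i j : i < 3 * k + 6 -> j < 3 * k + 6 -> phi i = phi j -> i = j.
  move=> iM jM eqphi; case: (ltngtP i j) => // [ij|ji].
    by have := phi_mono _ _ ij jM; rewrite eqphi ltnn.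
  by have := phi_mono _ _ ji iM; rewrite eqphi ltnn.
have injb i j s t : i < 3 * k + 6 -> j < 3 * k + 6 -> s < 2 * l -> t < 2 * l ->
    b (phi i) s = b (phi j) t -> i = j /\ s = t.
  move=> iM jM s2 t2; rewrite /b.
  have iN := phiN _ iM; have jN := phiN _ jM.
  have mP m : m < path_len k -> P m \in p by move=> mp; rewrite mem_nth // szp leqW.
  case: (ltnP s l) => sl; case: (ltnP t l) => tl.
  - by move/PI => /(_ (idx _ _ iN sl) (idx _ _ jN tl))/(mulnD_inj sl tl)[/phiI->].
  - move=> eqPx; have tl' : t - l < l by lia.
    have [_] := xC _ (idx _ _ jN tl').
    by rewrite -eqPx mP // idx.
  - move=> eqPx; have sl' : s - l < l by lia.
    have [_] := xC _ (idx _ _ iN sl').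
    by rewrite eqPx mP // idx.
  - have tl' : t - l < l by lia.
    have sl' : s - l < l by lia.
    move/xI => /(_ (idx _ _ iN sl') (idx _ _ jN tl'))/(mulnD_inj sl' tl')[/phiI->] //.
    by split=> //; lia.
have bigM := leqnn (3 * k + 6).
have Esym s t := blocks_sym esym eirr bigM hom injb nattains (s := s) (t := t).
have Etr s t u := blocks_trans esym eirr bigM hom injb nattains (s := s) (t := t) (u := u).
have Edl s t := blocks_diag_l esym eirr bigM hom injb nattains (s := s) (t := t).
have Emat s t := blocks_matching esym eirr bigM hom injb nattains (s := s) (t := t).
have Ex s : s < l -> E s (l + s).
  move=> sl; apply: Emat; [lia|lia|lia|] => i ik.
  rewrite /b sl ltnNge leq_addr /= addKn Px // idx // phiN; lia.
have Exs s : s.+1 < l -> E s.+1 (l + s).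
  move=> sl; apply: Emat; [lia|lia|lia|] => i ik.
  rewrite /b sl ltnNge leq_addr /= addKn addnS Psx // idx ?phiN; lia.
(* Consecutive path vertices are both related to their common neighbour, so transitivity relates
   them although they are nonadjacent. *)
have Estep s : s.+1 < l -> E s s.+1.
  move=> sl; apply: (Etr s (l + s)); [lia|lia|lia|apply: Ex; lia|].
  by apply: Esym; [lia|lia|exact: Exs].
have E0 s : s < l -> E 0 s.
  elim: s => [|s IH] sl; first by apply: (Edl 0 (l + 0)); [lia|lia|exact: Ex].
  by apply: (Etr 0 s); [lia|lia|lia|apply: IH; lia|exact: Estep].
have Es0 s : s < l -> E s 0 by move=> sl; apply: Esym; [lia|lia|exact: E0].
(* [q] is the path part of block 0, and [q2] a clique of first entries of k + 1 later blocks,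
   complete to [q]. *)
pose q := [seq P (phi 0 * l + s) | s <- iota 0 l].
pose q2 := [seq b (phi j) 0 | j <- iota 1 k.+1].
have phi0N : phi 0 < path_blocks k by apply: phiN; lia.
have uq : uniq q.
  rewrite map_inj_in_uniq ?iota_uniq // => s t; rewrite !mem_iota => sl tl.
  by move/PI => /(_ (idx _ _ phi0N sl) (idx _ _ phi0N tl))/addnI.
have q_q2 : allrel e q q2.
  apply/allrelP => _ _ /mapP[s hs ->] /mapP[j hj ->].
  move: hs hj; rewrite !mem_iota /= add0n => sl hj.
  have -> : P (phi 0 * l + s) = b (phi 0) s by rewrite /b sl.
  by rewrite hom ?Es0 //; lia.
have cl2 : pairwise e q2.
  by rewrite pairwise_map; apply: pairwise_iota => i j ? ? ?; rewrite /= hom ?E0 //; lia.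
have sz2 : k < size q2 by rewrite size_map size_iota.
(* The complement graph inside [q]. Its degrees are bounded: many non-neighbours of [y] contain a
   clique, which together with [q2] is split by [y], or an independent set, the leaves of a star
   centred in [q2]. *)
pose r (y z : V) := [&& y \in q, z \in q, y != z & ~~ e y z].
have rsym : symmetric r.
  by move=> y z; rewrite /r eq_sym esym; case: (y \in q); case: (z \in q).
have rdeg y : #|[set z | r y z]| <= pair_bd k.
  rewrite leqNgt; apply/negP => bigr.
  have [||ws [sub_ws uws sz_ws hom_ws]] := @clique_or_independent (enum [set z | r y z]).
  - exact: enum_uniq.
  - by rewrite -cardE; exact: ltnW.
  have wsr z : z \in ws -> r y z by move/sub_ws; rewrite mem_enum inE.
  have wsq z : z \in ws -> z \in q by move/wsr/and4P=> [].
  have h2 : b (phi 1) 0 \in q2 by apply/mapP; exists 1; rewrite ?mem_iota.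
  case: hom_ws => hom_ws; apply: nattains.
    apply: (@clique_vertex_attains _ e eirr k y q2 ws) => //; last exact: ltnW.
    - rewrite pairwise_cat cl2 hom_ws !andbT.
      by apply/allrelP => z w hz /wsq hw; rewrite esym; exact: (allrelP q_q2).
    - apply/allP => z hz; apply: (allrelP q_q2) => //.
      by case: ws sz_ws wsr {uws sub_ws wsq hom_ws} => [//|w ws] _ /(_ w (mem_head _ _))/and4P[].
    - by apply/allP => z /wsr/and4P[].
    - by apply/negP => /wsr/and4P[_ _]; rewrite eqxx.
  apply: (@star_attains _ e eirr k (b (phi 1) 0) ws) => //; first exact: ltnW (ltnW _).
  by apply/allP => z /wsq hz; rewrite esym; exact: (allrelP q_q2).
(* Edges of H are non-edges of the graph, so the path connects [q] in the complement. *)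
have rconn s : s < l -> connect r (P (phi 0 * l)) (P (phi 0 * l + s)).
  elim: s => [|s IH] sl; first by rewrite addn0.
  apply: connect_trans (IH (ltnW sl)) _; apply: connect1.
  have sl' := ltnW sl.
  have /and3P[neq nadj _] := hpP _ (idx _ _ phi0N sl').
  have Pq t : t < l -> P (phi 0 * l + t) \in q by move=> tl; apply/mapP; exists t; rewrite ?mem_iota.
  by rewrite /r !Pq // addnS neq nadj.
have rbig : l <= #|[set y | connect r (P (phi 0 * l)) y]|.
  have ql : #|[set y in q]| = l by rewrite cardsE (card_uniqP uq) size_map size_iota.
  rewrite -[X in X <= _]ql; apply: subset_leq_card; apply/subsetP => y; rewrite !inE => /mapP[s].
  rewrite mem_iota => /andP[_ sl] ->; exact: rconn.
apply: nattains; apply: (clique_minus_attains eirr cl2 q_q2 sz2) => m m_gt0 mk.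
have [|s [szs us ecs _ conns]] := @long_geodesic _ r (P (phi 0 * l)) rsym (pair_bd k) m rdeg.
  by apply: leq_trans rbig; rewrite /l /block_len addn1 ltnS leq_pexp2l.
have sq : {subset s <= q}.
  have q0 : P (phi 0 * l) \in q.
    by apply/mapP; exists 0; rewrite ?mem_iota ?addn0.
  move=> y /conns cy; have clq : closed r (mem q).
    by move=> y1 y2 /and4P[-> ->].
  by rewrite -(closed_connect clq cy).
exists s; split => //; rewrite -[RHS]ecs; apply: eq_in_ec => // y z /sq yq /sq zq yz.
by rewrite /r yz yq zq.
Qed.

End Bounds.

(** * Counting rows *)

Lemma map_uniq_factor (A B C : eqType) (f : A -> B) (g : A -> C) (s : seq A) :
  {in s &, forall x y, f x = f y -> g x = g y} -> uniq (map g s) -> uniq (map f s).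
Proof.
elim: s => //= x s IH fg /andP[gx ugs]; apply/andP; split.
  apply: contra gx => /mapP[y ys fxy]; apply/mapP; exists y => //.
  by apply: fg; rewrite ?inE ?eqxx ?ys ?orbT.
by apply: IH ugs => y z ys zs; apply: fg; rewrite inE ?ys ?zs orbT.
Qed.

Lemma choose_preimages (A : Type) (B : eqType) (p : A -> Prop) (f : A -> B) (s : seq B) :
  (forall y, y \in s -> exists2 x, p x & f x = y) ->
  exists2 xs, (forall i x0, i < size xs -> p (nth x0 xs i)) & map f xs = s.
Proof.
elim: s => [|y s IH] ex; first by exists [::].
have [x px <-] := ex y (mem_head _ _).
have [z zs|xs pxs <-] := IH; first by apply: ex; rewrite inE zs orbT.
by exists (x :: xs) => //= -[|i] x0 //=; exact: pxs.
Qed.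

(** The outer power of 2 pays for [separating_sequence], which halves the set of rows once per
    step. *)
Definition rows_bd k := 2 ^ ram 2 (codeg_bd k + (3 * k + 7)).
(** The number of codes in [class_count]: a subset of the cut component, an edge count up to k, and
    a bounded multiplicity for each row. *)
Definition class_bd k := 2 ^ comp_bd k * k.+1 * (pair_bd k).+1 ^ rows_bd k.

Section Rows.
Variables (V : finType) (e : rel V) (k : nat).
Hypotheses (esym : symmetric e) (eirr : irreflexive e) (nattains : ~ attains e k).

Definition row (P : {set V}) u := [set w | (w \notin P) && e u w].

(* Halving: some w separates us; keep the larger side, and put p_0 in the smaller one. *)
Lemma separating_sequence (P : {set V}) q (us : seq V) (v0 : V) :
  uniq (map (row P) us) -> 2 ^ q <= size us ->
  exists p w : nat -> V, (forall i, i < q -> [/\ p i \in us, w i \notin P &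
      exists x y, [/\ x \in us, y \in us & e x (w i) != e y (w i)]]) /\
    forall i j, i < j -> j < q -> w i != w j /\ e (p i) (w i) != e (p j) (w i).
Proof.
elim: q us => [|q IH] us uus big; first by exists (fun=> v0), (fun=> v0).
have [x [y [w [xus yus wP xyw]]]] : exists x y w,
    [/\ x \in us, y \in us, w \notin P & e x w && ~~ e y w].
  case: us uus big => [|x [|y us]]; rewrite ?expnS.
  - by rewrite leqn0 muln_eq0 expn_eq0.
  - by have := expn_gt0 2 q; rewrite /=; lia.
  rewrite /= inE negb_or -!andbA => /and3P[nxy _ _] _.
  have xus : x \in [:: x, y & us] by rewrite inE eqxx.
  have yus : y \in [:: x, y & us] by rewrite !inE eqxx orbT.
  have [w] : exists w, (w \in row P x) != (w \in row P y).
    apply/existsP; apply: contraNT nxy; rewrite negb_exists => /forallP eqr.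
    by apply/eqP/setP => w; apply/eqP; have := eqr w; rewrite negbK.
  rewrite !inE; case wP: (w \in P) => //=; rewrite -/(_ \notin _).
  case exw: (e x w); case eyw: (e y w) => // _.
    by exists x, y, w; rewrite wP exw eyw.
  by exists y, x, w; rewrite wP exw eyw.
have [p0 [us' [p0us sub_us us'c us'u big']]] : exists p0 us',
    [/\ p0 \in us, {subset us' <= us}, forall z, z \in us' -> e z w = ~~ e p0 w,
     uniq (map (row P) us') & 2 ^ q <= size us'].
  have fu (a : pred V) : uniq (map (row P) (filter a us)).
    by apply: subseq_uniq uus; apply: map_subseq; exact: filter_subseq.
  have := count_predC (fun z => e z w) us; case/andP: xyw => exw eyw.
  case: (leqP (2 ^ q) (count (fun z => e z w) us)) => cnt cntC.
    exists y, [seq z <- us | e z w]; split=> //.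
    - by move=> z; rewrite mem_filter => /andP[].
    - by move=> z; rewrite mem_filter eyw => /andP[].
    - by rewrite size_filter.
  exists x, [seq z <- us | ~~ e z w]; split=> //.
  - by move=> z; rewrite mem_filter => /andP[].
  - by move=> z; rewrite mem_filter exw => /andP[/negbTE].
  - rewrite size_filter (_ : count _ _ = size us - count (fun z => e z w) us).
      by move: cnt big; rewrite expnS; move: (count _ _) (size _) => c1 c2; lia.
    by rewrite -cntC addKn.
have [p [w' [pw pw']]] := IH us' us'u big'.
exists (fun i => if i is i'.+1 then p i' else p0), (fun i => if i is i'.+1 then w' i' else w).
split=> [[|i] iq|[|i] [|j] ij jq] //.
- by split=> //; exists x, y; split=> //; case/andP: xyw => -> /negbTE->.
- have [pi wi [x1 [y1 [x1us y1us ne]]]] := pw i iq.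
  by split=> //; [exact: sub_us|exists x1, y1; split=> //; exact: sub_us].
- have [pj wj [x1 [y1 [x1us y1us ne]]]] := pw j jq; split.
    by apply: contraNneq ne => <-; rewrite (us'c _ x1us) (us'c _ y1us).
  by rewrite (us'c _ pj); case: (e p0 w).
- exact: pw'.
Qed.

(** From many rows one gets homogeneous pairs (p_i, w_i) with p_i in [P] and w_i outside. Adjacent
    pairs would form an induced matching. So p_i and w_i are nonadjacent while w_i sees all later
    p_j: a co-matching, in which the later p_j are common neighbours of p_0 and w_0, and this pair
    is an edge of H leaving [P]. *)
Lemma card_rows_lt (P : {set V}) :
  (forall u w, u \in P -> w \notin P -> ~~ hedge e (codeg_bd k) u w) ->
  #|row P @: P| < rows_bd k.
Proof.
move=> closedP; rewrite ltnNge; apply/negP => big.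
have [us usP usE] : exists2 us, {subset us <= P} & map (row P) us = enum (row P @: P).
  have [|us usP usE] := @choose_preimages V _ (fun u => u \in P) (row P) (enum (row P @: P)).
    by move=> y; rewrite mem_enum => /imsetP[x xP ->]; exists x.
  by exists us => // x /(nthP x)[i ius <-]; exact: usP.
have sz_us : size us = #|row P @: P| by rewrite -(size_map (row P)) usE -cardE.
have v0 : V.
  by case: us sz_us {usP usE} => [sz0|//]; move: big; rewrite -sz0 leqn0 expn_eq0.
(* Blocks 1 to [T] will supply the common neighbours; 3k + 6 blocks are required by the patterns. *)
pose T := codeg_bd k; pose M := T + (3 * k + 6).
have [||p [w [pw pw']]] := @separating_sequence P (ram 2 M.+1) us v0.
- by rewrite usE enum_uniq.
- by move: big; rewrite sz_us /rows_bd -/T /M -addnS -addnS.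
pose b i s := if s == 0 then p i else w i.
have [|E [D [phi [phiN phi_mono hom dg]]]] :=
  @homogenize _ e b (fun i => e (p i) (w i)) 2 M (ram 2 M.+1); first by [].
have pI i j : i < j -> j < ram 2 M.+1 -> p i <> p j.
  by move=> ij jN eqp; have [_] := pw' _ _ ij jN; rewrite eqp eqxx.
have wI i j : i < j -> j < ram 2 M.+1 -> w i <> w j.
  by move=> ij jN; have [/eqP] := pw' _ _ ij jN.
have pP i : i < ram 2 M.+1 -> p i \in P by move=> /pw[/usP].
have wP i : i < ram 2 M.+1 -> w i \notin P by move=> /pw[].
have injb i j s t : i < M -> j < M -> s < 2 -> t < 2 ->
    b (phi i) s = b (phi j) t -> i = j /\ s = t.
  move=> iM jM; rewrite /b; case: s t => [|[|//]] [|[|//]] _ _ /= eqb.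
  - split=> //; case: (ltngtP i j) => // ij; exfalso.
      exact: pI (phi_mono _ _ ij jM) (phiN _ jM) eqb.
    exact: pI (phi_mono _ _ ij iM) (phiN _ iM) (Logic.eq_sym eqb).
  - by have := wP _ (phiN _ jM); rewrite -eqb pP // phiN.
  - by have := wP _ (phiN _ iM); rewrite eqb pP // phiN.
  - split=> //; case: (ltngtP i j) => // ij; exfalso.
      exact: wI (phi_mono _ _ ij jM) (phiN _ jM) eqb.
    exact: wI (phi_mono _ _ ij iM) (phiN _ iM) (Logic.eq_sym eqb).
have bigM : 3 * k + 6 <= M by rewrite leq_addl.
have M_gt : 1 < M by lia.
(* w_i distinguishes p_i from every later p_j, so its adjacency to them is opposite to the flag. *)
have E10 : E 1 0 = ~~ D.
  have [_] := pw' _ _ (phi_mono 0 1 isT M_gt) (phiN _ M_gt).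
  rewrite dg; last exact: ltnW.
  by rewrite esym -[e _ _]/(e (b (phi 0) 1) (b (phi 1) 0)) hom //; case: D {dg}; case: (E 1 0).
have Esym s t := blocks_sym esym eirr bigM hom injb nattains (s := s) (t := t).
case DT: D in E10.
  have E01 : E 0 1.
    apply: (blocks_matching esym eirr bigM hom injb nattains) => // i ik.
    by rewrite /b /= dg ?DT //; lia.
  by have := Esym 0 1 isT isT E01; rewrite E10.
have E01 : E 0 1 by apply: Esym; rewrite ?E10.
have E00 : E 0 0 by apply: (blocks_diag_l esym eirr bigM hom injb nattains _ _ E01).
have M0 : 0 < M by lia.
have := closedP _ _ (pP _ (phiN _ M0)) (wP _ (phiN _ M0)).
case/negP; apply/and3P; split.
- by apply: contraTneq (pP _ (phiN _ M0)) => ->; exact: wP (phiN _ M0).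
- by rewrite dg // DT.
pose cs := [seq b (phi j) 0 | j <- iota 1 T].
have ucs : uniq cs.
  rewrite map_inj_in_uniq ?iota_uniq // => i j; rewrite !mem_iota => hi hj.
  by move/injb => h; have [||//|//|->] := h; rewrite /M; lia.
rewrite -/T; have <- : size cs = T by rewrite size_map size_iota.
rewrite -(card_uniqP ucs); apply: subset_leq_card; apply/subsetP => x /mapP[j].
rewrite mem_iota => hj ->; rewrite inE.
rewrite -[p _]/(b (phi 0) 0) -[w _]/(b (phi 0) 1).
by rewrite !hom ?E00 ?E10 //; rewrite /M; lia.
Qed.

Definition row_count (P : {set V}) (X : {set V}) (S : seq V) :=
  count (fun u => (u \in P) && (row P u == X)) S.

(** The vertices counted share a neighbour [w] in [X]. If there are many, they contain k + 2
    independent ones, which form a star with [w], or a clique on k + 2 vertices, which has more than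
    k edges within [S]. *)
Lemma row_count_lt P X S : uniq S -> ec e S <= k -> X != set0 -> row_count P X S < (pair_bd k).+1.
Proof.
move=> uS eS /set0Pn[w wX]; rewrite ltnS leqNgt; apply/negP => big.
pose S' := [seq u <- S | (u \in P) && (row P u == X)].
have [||ws [sub_ws uws sz_ws hom_ws]] := @clique_or_independent V e k S'.
- exact: filter_uniq.
- by rewrite size_filter; exact: ltnW.
have wsw u : u \in ws -> e w u.
  move/sub_ws; rewrite mem_filter => /andP[/andP[_ /eqP rowu] _].
  by move: wX; rewrite -rowu inE esym => /andP[].
case: hom_ws => hom_ws; last first.
  apply: nattains; apply: (@star_attains _ e eirr k w ws) => //; first exact: ltnW (ltnW _).
  by apply/allP.
suff : ec e ws <= k.
  rewrite ec_clique // leqNgt => /negP; apply.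
  apply: (@leq_trans 'C(k.+2, 2)); last exact: leq_bin2l.
  by rewrite binS bin1 addnS ltnS leq_addl.
apply: leq_trans eS; rewrite (@ec_perm _ e ws [seq u <- S | u \in ws]) //.
  by apply: ec_sub; exact: filter_subseq.
apply: uniq_perm => //; first exact: filter_uniq.
move=> u; rewrite mem_filter; case uws': (u \in ws) => //=.
by have := sub_ws u uws'; rewrite mem_filter => /andP[_ ->].
Qed.

(** A vertex [w] outside [P] sees all or none of the vertices with a given row, so its neighbour
    count depends only on the multiplicities of the rows. *)
Lemma count_rows (P : {set V}) (w : V) (S : seq V) : w \notin P ->
  count (fun u => (u \in P) && e w u) S = \sum_(X in row P @: P | w \in X) row_count P X S.
Proof.
move=> wP; elim: S => [|u S IH] /=; first by rewrite big1.
rewrite big_split /= {}IH; congr addn.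
have rowE : (w \in row P u) = e w u by rewrite inE wP esym.
case uP: (u \in P) => /=; last by rewrite big1.
case wu: (e w u); rewrite wu in rowE.
  rewrite (bigD1 (row P u)) /= ?eqxx ?rowE ?andbT ?imset_f // big1 // => X /andP[_].
  by rewrite eq_sym => /negbTE->.
by rewrite big1 // => X /andP[_ wX]; apply/eqP; rewrite eqb0; apply: contraFneq rowE => ->.
Qed.

(** [S] is coded by its trace on [P :\: P1], its number of edges, and the multiplicities of the
    nonempty rows of [P1]. The code determines all neighbour counts outside [P], hence [F S], so
    there are no more values than codes. *)
Lemma class_count (R : eqType) (F : seq V -> R) (P P1 : {set V}) (L : seq R) :
  P1 \subset P -> #|P :\: P1| <= comp_bd k ->
  (forall u w, u \in P1 -> w \notin P1 -> ~~ hedge e (codeg_bd k) u w) ->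
  let valid S := [/\ uniq S, {subset S <= P} & ec e S <= k] in
  (forall S S', valid S -> valid S' -> ec e S = ec e S' ->
     (forall w, w \notin P -> count (e w) S = count (e w) S') -> F S = F S') ->
  uniq L -> (forall x, x \in L -> exists2 S, valid S & F S = x) -> size L <= class_bd k.
Proof.
move=> subP cardP2 closedP valid Fext uL FL.
have [Ss validSs FSs] := choose_preimages FL.
pose P2 := P :\: P1; pose N := (pair_bd k).+1; pose rws := row P1 @: P1.
(* Vertices with empty row may occur in [S] in any number, but they add nothing to a neighbour count
   outside [P1]. *)
pose D := rws :\ set0.
pose code S : {set V} * 'I_k.+1 * {ffun {set V} -> 'I_N} :=
  ([set u in S | u \in P2], inord (ec e S),
   [ffun X => if X \in D then inord (row_count P1 X S) else ord0]).
have validS S : S \in Ss -> valid S.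
  by move=> /(nthP [::])[i iS <-]; exact: validSs.
have ucode : uniq (map code Ss).
  apply: (@map_uniq_factor _ _ _ code F); last by rewrite FSs.
  move=> S S' /validS vS /validS vS' [eqP2 eqec eqrow].
  have [uS sS eS] := vS; have [uS' sS' eS'] := vS'.
  apply: Fext => // [|w wP]; first by move/(congr1 val): eqec; rewrite /= !inordK.
  have w1 : w \notin P1 by apply: contra wP; exact: subsetP.
  have split_count T : {subset T <= P} ->
      count (e w) T = count (fun u => (u \in P1) && e w u) T + count (fun u => (u \in P2) && e w u) T.
    elim: T => //= u T IH sub; rewrite IH; last by move=> x xT; apply: sub; rewrite inE xT orbT.
    have uP : u \in P by apply: sub; rewrite mem_head.
    by rewrite inE uP andbT; case: (u \in P1) => /=; lia.
  rewrite !split_count // !(count_rows _ w1); congr addn.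
    apply: eq_bigr => X /andP[Xr wX].
    have X0 : X != set0 by apply/set0Pn; exists w.
    have := congr1 (fun f : {ffun {set V} -> 'I_N} => val (f X)) eqrow.
    by rewrite !ffunE !inE X0 Xr /= !inordK // ?row_count_lt.
  have cardcount T : uniq T ->
      count (fun u => (u \in P2) && e w u) T = #|[set u in [set u in T | u \in P2] | e w u]|.
    move=> uT; rewrite -size_filter -(card_uniqP (filter_uniq _ uT)).
    apply: eq_card => u; rewrite [LHS]mem_filter !inE.
    by case: (u \in T); case: (e w u); rewrite ?andbF ?andbT.
  by rewrite !cardcount // eqP2.
have <- : size (map code Ss) = size L by rewrite -FSs !size_map.
rewrite -(card_uniqP ucode).
pose codes := setX (setX (powerset P2) [set: 'I_k.+1]) [set f | f \in pffun_on (ord0 : 'I_N) D predT].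
apply: (@leq_trans #|codes|).
  apply: subset_leq_card; apply/subsetP => c /mapP[S SS ->].
  rewrite !inE; apply/andP; split.
    by rewrite andbT; apply/subsetP => u; rewrite inE => /andP[].
  apply/pffun_onP; split=> //; apply/subsetP => X; rewrite inE ffunE.
  by case: ifP => //; rewrite eqxx.
have cardF : #|[set f | f \in pffun_on (ord0 : 'I_N) D predT]| = N ^ #|D|.
  by rewrite cardsE -[N in RHS]card_ord -(card_pffun_on (ord0 : 'I_N)); apply: eq_card.
rewrite !cardsX card_powerset cardsT card_ord cardF.
apply: leq_mul; first by rewrite leq_mul2r leq_pexp2l ?orbT.
rewrite leq_pexp2l //; apply: leq_trans (ltnW (card_rows_lt closedP)).
by apply: subset_leq_card; exact: subsetDl.
Qed.

End Rows.

(** * The algorithm *)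

(** Makes [attains] decidable, so that an overflow can be handled by contradiction. *)
Lemma attainsP (V : finType) (e : rel V) k : symmetric e ->
  reflect (attains e k) [exists S : {set V}, ec e (enum S) == k].
Proof.
move=> esym; apply: (iffP existsP) => [[S /eqP ecS]|[s us ecs]].
  by exists (enum S); first exact: enum_uniq.
exists [set x in s]; rewrite -ecs; apply/eqP; apply: ec_perm => //.
by apply: uniq_perm => //; [exact: enum_uniq|move=> x; rewrite mem_enum inE].
Qed.

Section EdgesIn.
Variables (n : nat) (e : rel 'I_n).
Hypothesis esym : symmetric e.

(** In an increasing list the list order is the orientation p.1 < p.2 that [edges_in] picks for each
    edge, so both counts recurse alike. *)
Lemma edges_in_sorted (s : seq 'I_n) :
  pairwise (fun x y : 'I_n => x < y) s -> edges_in e [set x in s] = ec e s.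
Proof.
elim: s => [|x s IH] /=.
  by move=> _; apply: eq_card0 => p; rewrite !inE; case: (_ < _).
case/andP=> xs ps; rewrite -IH //.
have us : uniq s.
  by rewrite uniq_pairwise; apply: sub_pairwise ps => y z /= yz; rewrite -val_eqE neq_ltn yz.
have -> : count (e x) s = #|[set (x, y) | y in [set y in s | e x y]]|.
  rewrite card_imset => [|y z [] //].
  rewrite -size_filter -(card_uniqP (filter_uniq _ us)).
  by apply: eq_card => y; rewrite !inE mem_filter andbC.
rewrite -cardsUI [X in _ + X]eq_card0 ?addn0 => [|[y z]].
  apply: eq_card => -[y z]; rewrite !inE /=.
  apply/and4P/orP => [[yz hy hz eyz]|].
    move: hy hz => /orP[/eqP yx|ys] /orP[/eqP zx|zs].
    - by subst y z; rewrite ltnn in yz.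
    - by left; subst y; apply: imset_f; rewrite !inE zs.
    - by subst z; have := allP xs _ ys; lia.
    - by right; rewrite yz ys zs eyz.
  case=> [/imsetP[z' hz' [-> ->]]|/and4P[yz ys zs eyz]].
    move: hz'; rewrite !inE => /andP[zs exz].
    by rewrite eqxx zs exz orbT (allP xs).
  by rewrite yz ys zs eyz !orbT.
rewrite !inE /=; apply/negbTE/negP => /andP[/imsetP[z' _ [-> _]] /and4P[_ xs' _ _]].
by have := allP xs _ xs'; rewrite ltnn.
Qed.

Lemma attains_has_k_edge k : 0 < n -> attains e k <-> has_k_edge_induced_subgraph e k.
Proof.
move=> n_gt0; split=> [[s us <-]|[S [_ <-]]].
  have edgesE : edges_in e [set x in s] = ec e s.
    rewrite (@ec_perm _ e s (enum [set x in s])) //; last first.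
      by apply: uniq_perm => //; [exact: enum_uniq|move=> x; rewrite mem_enum inE].
    rewrite -edges_in_sorted; first by congr edges_in; apply/setP => x; rewrite !inE mem_enum inE.
    rewrite /enum_mem; apply: subseq_pairwise (filter_subseq _ _) _.
    rewrite -enumT -(pairwise_map val ltn) val_enum_ord.
    by rewrite -(sorted_pairwise ltn_trans) iota_ltn_sorted.
  case: s us edgesE => [|x s] us edgesE; last first.
    by exists [set y in x :: s]; split=> //; apply/set0Pn; exists x; rewrite !inE eqxx.
  (* A single vertex replaces the empty set: neither has an edge. *)
  exists [set Ordinal n_gt0]; split; first by apply/set0Pn; exists (Ordinal n_gt0); rewrite inE.
  apply: eq_card0 => p; rewrite !inE; apply/negbTE/negP => /and4P[lt /eqP E1 /eqP E2 _].
  by move: lt; rewrite E1 E2 ltnn.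
exists (enum S); first exact: enum_uniq.
rewrite -edges_in_sorted; first by congr edges_in; apply/setP => x; rewrite inE mem_enum.
rewrite /enum_mem; apply: subseq_pairwise (filter_subseq _ _) _.
rewrite -enumT -(pairwise_map val ltn) val_enum_ord.
by rewrite -(sorted_pairwise ltn_trans) iota_ltn_sorted.
Qed.

End EdgesIn.

Section Algorithm.
Variables (n : nat) (adj : nat -> nat -> bool) (k T G : nat).
Implicit Types (rho : seq nat) (st : bool * seq (seq nat)) (dn : seq nat).

(** [hedge] without the test u <> w, which holds anyway between a treated and an untreated
    vertex. *)
Definition hedgen u w :=
  ~~ adj u w && (T <= count (fun x => adj u x && adj w x) (iota 0 n)).

(** The value [n] stands for none. The first untreated vertex is the default, overwritten by any
    untreated vertex with an H-edge to the treated ones; so a new component is begun only when the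
    treated set is H-closed. *)
Definition select dn :=
  foldl (fun v w => if w \in dn then v
                    else if (v == n) || has (fun u => (u \in dn) && hedgen u w) (iota 0 n)
                    then w else v) n (iota 0 n).

(* The first n entries of a row count neighbours in the chosen set (0 for treated vertices), the
   last one counts edges. *)
Definition update_row dn v (b : bool) rho :=
  mkseq (fun w => if w \in dn then 0
                  else nth 0 rho w + b * (if w == n then nth 0 rho v else adj v w : nat)) n.+1.

Definition add_row st rho :=
  if (k < nth 0 rho n) || (rho \in st.2) then st
  else if size st.2 < G then (st.1, rcons st.2 rho) else (true, st.2).

Definition treat dn v st :=
  foldl (fun st rho => add_row (add_row st (update_row dn v false rho)) (update_row dn v true rho))
    (st.1, [::]) st.2.

Definition round (c : seq nat * (bool * seq (seq nat))) :=
  let v := select c.1 in (v :: c.1, treat (v :: c.1) v c.2).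

Definition final := iter n round ([::], (false, [:: nseq n.+1 0])).

Definition accepts := final.2.1 || has (fun rho => nth 0 rho n == k) final.2.2.

Lemma select_spec dn : has (fun w => w \notin dn) (iota 0 n) ->
  [/\ select dn < n, select dn \notin dn &
    forall u w, u < n -> w < n -> u \in dn -> w \notin dn -> hedgen u w ->
      exists2 u', u' < n & (u' \in dn) && hedgen u' (select dn)].
Proof.
move=> ex.
suff: forall m, m <= n ->
    let v := foldl (fun v w => if w \in dn then v
       else if (v == n) || has (fun u => (u \in dn) && hedgen u w) (iota 0 n) then w else v) n (iota 0 m) in
    if has (fun w => w \notin dn) (iota 0 m) then
      [/\ v < n, v \notin dn & forall u w, u < n -> w < m -> u \in dn -> w \notin dn -> hedgen u w ->
      exists2 u', u' < n & (u' \in dn) && hedgen u' v]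
    else v = n.
  by move=> /(_ n (leqnn n)); rewrite ex.
elim=> [|m IH] mn; first by [].
rewrite -addn1 iotaD add0n foldl_cat has_cat /= orbF.
move: (IH (ltnW mn)); set v := foldl _ _ (iota 0 m) => /= {}IH.
case mdn: (m \in dn); rewrite ?orbF ?orbT /=.
  case: ifP IH => // _ [vn vdn sp]; split=> // u w un wm udn wdn huw.
  have wm' : w != m by apply: contraNneq wdn => ->.
  by apply: sp huw => //; lia.
case: ifP => [cond|/negbT]; last first.
  rewrite negb_or => /andP[vn noh]; case: ifP IH => [_ [vn' vdn sp]|_ /eqP]; last by rewrite (negbTE vn).
  split=> // u w un; rewrite addn1 ltnS leq_eqVlt => /orP[/eqP->|wm] udn wdn huw; last exact: sp huw.
  by case/hasP: noh; exists u; rewrite ?mem_iota ?udn ?huw.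
split; rewrite ?mdn // => u w un wm udn wdn huw.
case/orP: cond => [/eqP vn|/hasP[u' ]]; last by rewrite mem_iota => ? ?; exists u'.
case: ifP IH => [_ [vn']|/negbT/hasPn noundone _]; first by rewrite vn ltnn in vn'.
exists u => //; rewrite udn; suff -> : m = w by [].
apply/eqP; apply: contraNeq wdn => wm'; rewrite -[_ \in _]negbK; apply: noundone.
by rewrite mem_iota; lia.
Qed.

(** The witness for a newly raised flag, G + 1 distinct admissible rows, is what contradicts the
    class bound. *)
Lemma add_rows_spec (cs : seq (seq nat)) st : uniq st.2 -> size st.2 <= G ->
  let st' := foldl add_row st cs in
  [/\ uniq st'.2, size st'.2 <= G,
    (~~ st'.1 -> ~~ st.1 /\ forall rho, (rho \in st'.2) =
       (rho \in st.2) || ((rho \in cs) && (nth 0 rho n <= k))) &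
    (st'.1 -> st.1 \/ exists L, [/\ uniq L, size L = G.+1 &
       forall rho, rho \in L -> (rho \in st.2) || ((rho \in cs) && (nth 0 rho n <= k))])].
Proof.
elim: cs st => [|c cs IH] st ust sst /=.
  by split=> //; [split=> // rho; rewrite orbF|left].
have sub1 rho : rho \in (add_row st c).2 -> (rho \in st.2) || ((rho == c) && (nth 0 rho n <= k)).
  rewrite /add_row; case: ifP => [_ ->//|/negbT]; rewrite negb_or -leqNgt => /andP[ck _].
  case: ifP => _ /=; last by move->.
  by rewrite mem_rcons inE => /orP[/eqP->|->//]; rewrite eqxx ck orbT.
have [ust1 sst1 keep over] : [/\ uniq (add_row st c).2, size (add_row st c).2 <= G,
    (~~ (add_row st c).1 -> ~~ st.1 /\ forall rho, (rho \in (add_row st c).2) =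
       (rho \in st.2) || ((rho == c) && (nth 0 rho n <= k))) &
    ((add_row st c).1 -> st.1 \/ exists L, [/\ uniq L, size L = G.+1 &
       forall rho, rho \in L -> (rho \in st.2) || ((rho == c) && (nth 0 rho n <= k))])].
  rewrite /add_row; case: ifP => [skip|/negbT].
    split=> //; last by left.
    move=> nst; split=> // rho; case: eqP => [->|_]; rewrite ?orbF //.
    by case/orP: skip => [|->//]; rewrite ltnNge => /negbTE->; rewrite orbF.
  rewrite negb_or -leqNgt => /andP[ck cst]; case: ifP => [lt|/negbT].
    split=> /=; rewrite ?rcons_uniq ?cst ?size_rcons //; last by left.
    move=> nst; split=> // rho; rewrite mem_rcons inE orbC.
    by case: eqP => [->|]; rewrite ?ck.
  rewrite -leqNgt => leG; split=> //= _; right; exists (c :: st.2); split; rewrite /= ?cst //.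
    by congr _.+1; apply/eqP; rewrite eqn_leq sst.
  by move=> rho; rewrite inE => /orP[/eqP->|->//]; rewrite eqxx ck orbT.
have [ust2 sst2 keep2 over2] := IH _ ust1 sst1.
have memE rho : (rho \in c :: cs) && (nth 0 rho n <= k) =
    ((rho == c) && (nth 0 rho n <= k)) || ((rho \in cs) && (nth 0 rho n <= k)).
  by rewrite inE andb_orl.
split=> //.
  move=> /keep2[/keep[nst E1] E2]; split=> // rho.
  by rewrite E2 E1 memE orbA.
move=> /over2[/over[|[L [uL sL hL]]]|[L [uL sL hL]]]; first by left.
  by right; exists L; split=> // rho /hL; rewrite memE orbA => ->.
right; exists L; split=> // rho /hL.
by rewrite memE orbA => /orP[/sub1->//|->]; rewrite orbT.
Qed.

Lemma treatE dn v st : treat dn v st = foldl add_row (st.1, [::])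
  (flatten [seq [:: update_row dn v false rho; update_row dn v true rho] | rho <- st.2]).
Proof. by rewrite /treat; case: st => fl L; elim: L (_, _) => //= rho L IH st; rewrite IH. Qed.

End Algorithm.

(** * Correctness of the algorithm *)

Section Correctness.
Variables (n : nat) (e : rel 'I_n) (k : nat).
Hypotheses (esym : symmetric e) (eirr : irreflexive e).
Let T := codeg_bd k.
Let G := class_bd k.
Let adj := adj_nat e.

Lemma adj_natE (i j : 'I_n) : adj_nat e i j = e i j.
Proof. by rewrite /adj_nat !valK. Qed.

Definition row_of (P : {set 'I_n}) (S : seq 'I_n) : seq nat :=
  mkseq (fun w => if w == n then ec e S
    else if insub w is Some i then if i \in P then 0 else count (e i) S else 0) n.+1.

Lemma nth_row_of_n P S : nth 0 (row_of P S) n = ec e S.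
Proof. by rewrite nth_mkseq // eqxx. Qed.

Lemma nth_row_of P S (i : 'I_n) : nth 0 (row_of P S) i = if i \in P then 0 else count (e i) S.
Proof. by rewrite nth_mkseq ?ltnS ?(ltnW (ltn_ord i)) // (ltn_eqF (ltn_ord i)) valK. Qed.

Lemma row_of_ext (P : {set 'I_n}) S S' : ec e S = ec e S' ->
  (forall w, w \notin P -> count (e w) S = count (e w) S') -> row_of P S = row_of P S'.
Proof.
move=> ee ec'; apply: eq_map => w; rewrite ee; case: eqP => // _; case: insubP => // i _ _.
by case: ifP => // /negbT /ec'.
Qed.

Lemma update_row_of (P : {set 'I_n}) S dn (v : 'I_n) b :
  (forall i : 'I_n, (nat_of_ord i \in dn) = (i \in v |: P)) -> n \notin dn -> v \notin P ->
  update_row n adj dn v b (row_of P S) = row_of (v |: P) (if b then v :: S else S).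
Proof.
move=> dnP ndn vP; apply/eq_in_map => w; rewrite mem_iota add0n => /andP[_ wn].
case: (eqVneq w n) => [->|wn'].
  rewrite (negbTE ndn) nth_row_of_n nth_row_of (negbTE vP).
  by case: b; rewrite ?mul1n ?mul0n ?addn0 //= addnC.
have wlt : w < n by rewrite ltn_neqAle wn' -ltnS.
rewrite -[w]/(nat_of_ord (Ordinal wlt)) dnP valK; case: ifP => // /negbT.
rewrite !inE negb_or => /andP[_ wP]; rewrite nth_row_of (negbTE wP) /adj adj_natE.
by case: b; rewrite ?mul1n ?mul0n ?addn0 //= esym addnC.
Qed.

Lemma row_of_perm (P : {set 'I_n}) S S' : perm_eq S S' -> row_of P S = row_of P S'.
Proof. by move=> eqS; apply: row_of_ext => [|w _]; [exact: ec_perm | exact/permP]. Qed.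

Lemma hedgenE (u v : 'I_n) : hedgen n adj T u v && (u != v) = hedge e T u v.
Proof.
rewrite /hedgen /hedge /adj adj_natE andbC; congr [&& _, _ & _ <= _].
rewrite -val_enum_ord count_map cardE [in RHS]/enum_mem size_filter -enumT.
by apply: eq_count => x /=; rewrite inE !adj_natE.
Qed.

Let valid (P : {set 'I_n}) S := [/\ uniq S, {subset S <= P} & ec e S <= k].

(** At most one component of H, that of [r], is only partly treated. *)
Definition almost_closed (P : {set 'I_n}) := exists r,
  forall u, u \in P -> (forall w, connect (hedge e T) u w -> w \in P) \/ connect (hedge e T) r u.

(** Once the flag is raised the list may miss rows, and only the positive answer is kept. *)
Definition invariant (c : seq nat * (bool * seq (seq nat))) (P : {set 'I_n}) :=
  [/\ forall i : 'I_n, (nat_of_ord i \in c.1) = (i \in P), n \notin c.1, almost_closed P,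
   c.2.1 -> attains e k &
   ~~ c.2.1 -> [/\ uniq c.2.2, size c.2.2 <= G & forall rho,
     rho \in c.2.2 <-> exists2 S, valid P S & row_of P S = rho]].

Lemma almost_closed_class P : ~ attains e k -> almost_closed P -> exists P1 : {set 'I_n},
  [/\ P1 \subset P, #|P :\: P1| <= comp_bd k &
      forall u w, u \in P1 -> w \notin P1 -> ~~ hedge e T u w].
Proof.
move=> nattains [r closedP].
exists [set u in P | [forall w, connect (hedge e T) u w ==> (w \in P)]]; split.
- by apply/subsetP => u; rewrite inE => /andP[].
- apply: leq_trans (hedge_component esym eirr nattains r (leqnn _)).
  apply: subset_leq_card; apply/subsetP => u; rewrite !inE => /andP[+ uP].
  rewrite uP /= => /forallPn[w]; rewrite negb_imply => /andP[uw wP].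
  by case: (closedP u uP) => // /(_ w uw); rewrite (negbTE wP).
move=> u w; rewrite !inE => /andP[uP /forallP cu] wN; apply/negP => uw.
case/negP: wN; rewrite (implyP (cu w)) ?connect1 //=; apply/forallP => x; apply/implyP => wx.
exact: (implyP (cu x)) (connect_trans (connect1 uw) wx).
Qed.

Lemma round_invariant c P : P != setT -> invariant c P ->
  exists2 v : 'I_n, v \notin P & invariant (round n adj k T G c) (v |: P).
Proof.
case: c => dn [fl L] PT [/= dnP ndn closedP flyes rows].
have ex : has (fun w => w \notin dn) (iota 0 n).
  have [x xP] : exists x, x \notin P.
    apply/existsP; apply: contraNT PT; rewrite negb_exists => /forallP allP.
    by apply/eqP/setP => x; rewrite inE; have := allP x; rewrite negbK.
  by apply/hasP; exists (val x); rewrite ?mem_iota ?ltn_ord // dnP.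
have [vn vdn sp] := select_spec adj T ex.
pose v := Ordinal vn; have vE : select n adj T dn = v by [].
have vP : v \notin P by rewrite -dnP.
exists v => //; rewrite /round /= vE.
have dnP' (i : 'I_n) : (nat_of_ord i \in (v : nat) :: dn) = (i \in v |: P).
  by rewrite !inE dnP.
have ndn' : n \notin (v : nat) :: dn by rewrite inE negb_or ndn eq_sym (ltn_eqF vn).
have hconn : connect_sym (hedge e T) by apply: sym_connect_sym; exact: hedge_sym.
have closedP' : almost_closed (v |: P).
  case: closedP => r closedP.
  (* If an H-edge leaves [P], then [v] has an H-neighbour in [P], which lies in the unfinished
     component of [r], and so does [v]. Otherwise [P] is H-closed and [v] begins a new component. *)
  case: (pickP (fun u => (u \in P) && [exists w, (w \notin P) && hedge e T u w])) => [u|none].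
    case/andP=> uP /existsP[w /andP[wP uw]].
    have [|||||u' u'n /andP[u'dn]] := sp u w; rewrite ?dnP //.
      by move: uw; rewrite -hedgenE => /andP[].
    rewrite vE -[u']/(nat_of_ord (Ordinal u'n)) in u'dn * => hu'v.
    have u'P : Ordinal u'n \in P by rewrite -dnP.
    have u'v : hedge e T (Ordinal u'n) v.
      by rewrite -hedgenE hu'v; apply: contraNneq vP => <-.
    have ru' : connect (hedge e T) r (Ordinal u'n).
      by case: (closedP _ u'P) => // /(_ v (connect1 u'v)); rewrite (negbTE vP).
    exists r => x; rewrite !inE => /orP[/eqP->|xP].
      by right; apply: connect_trans ru' (connect1 u'v).
    case: (closedP x xP) => [clx|]; [left|by right].
    by move=> w' /clx w'P; rewrite inE w'P orbT.
  exists v => x; rewrite !inE => /orP[/eqP->|xP]; [by right|left=> w xw].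
  have clP : closed (hedge e T) (mem P).
    apply: intro_closed => // a b ab aP; apply: contraFT (none a) => bP.
    by rewrite aP; apply/existsP; exists b; rewrite bP.
  by rewrite inE -(closed_connect clP xw) xP orbT.
pose cs := flatten [seq [:: update_row n adj ((v : nat) :: dn) v false rho;
  update_row n adj ((v : nat) :: dn) v true rho] | rho <- L].
have csE : ~~ fl -> forall rho, ((rho \in cs) && (nth 0 rho n <= k)) <->
    exists2 S, valid (v |: P) S & row_of (v |: P) S = rho.
  move=> /rows[_ _ memL] rho; split.
    case/andP=> /flattenP[_ /mapP[rho0 /memL[S [uS sS eS] <-] ->]].
    have vS : v \notin S by apply: contra vP; exact: sS.
    rewrite !inE !(update_row_of _ _ dnP' ndn' vP) => /orP[]/eqP-> /=; rewrite nth_row_of_n => le_k.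
      by exists S => //; split=> // x /sS; rewrite inE orbC => ->.
    exists (v :: S) => //; split=> //=; first by rewrite vS.
    by move=> x; rewrite !inE => /orP[->//|/sS->]; rewrite orbT.
  case=> S [uS sS eS] <-; rewrite nth_row_of_n eS andbT.
  pose S0 := [seq x <- S | x != v].
  have validS0 : valid P S0.
    split; first exact: filter_uniq.
      by move=> x; rewrite mem_filter => /andP[/negbTE xv /sS]; rewrite !inE xv.
    by apply: leq_trans eS; apply: ec_sub; exact: filter_subseq.
  have inL : row_of P S0 \in L by apply/memL; exists S0.
  apply/flattenP; eexists; first exact: (map_f _ inL).
  rewrite !inE !(update_row_of _ _ dnP' ndn' vP).
  case vS: (v \in S); apply/orP; [right|left]; apply/eqP; apply: row_of_perm.
    apply: uniq_perm => //=; first by rewrite mem_filter eqxx filter_uniq.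
    by move=> x; rewrite inE mem_filter; case: eqP => [->|].
  rewrite (_ : S0 = S) //; apply/all_filterP; apply/allP => x xS.
  by apply: contraFneq vS => <-.
have [ut st keep over] := @add_rows_spec n k G cs (fl, [::]) isT (leq0n G).
split=> //=; rewrite treatE -/cs; last first.
  move/keep=> [/= nfl memE]; split=> // rho.
  by rewrite memE; exact: csE.
(* A fresh overflow exhibits G + 1 rows of valid sets, more than [class_count] permits in a
   no-instance. *)
move=> /over[/=/flyes//|[L' [uL' sL' L'cs]]].
case flE: fl in flyes rows csE *; first exact: flyes.
case: (attainsP k esym) => // nattains.
have [P1 [subP cardP cl]] := almost_closed_class nattains closedP'.
suff : size L' <= G by rewrite sL' ltnn.
apply: (class_count esym eirr nattains subP cardP cl (F := row_of (v |: P))) => //.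
  by move=> S S' _ _; exact: row_of_ext.
by move=> rho /L'cs /(csE isT).
Qed.

Lemma initial_invariant : 0 < n -> invariant ([::], (false, [:: nseq n.+1 0])) set0.
Proof.
move=> n_gt0; split=> //=.
- by move=> i; rewrite inE.
- by exists (Ordinal n_gt0) => u; rewrite inE.
move=> _; split=> //; first by rewrite /G /class_bd !muln_gt0 !expn_gt0.
have row0 : row_of set0 [::] = nseq n.+1 0.
  apply: (@eq_from_nth _ 0); rewrite size_mkseq ?size_nseq // => w wn.
  rewrite nth_nseq wn nth_mkseq //; case: eqP => // _.
  by case: insubP => // i _ _; rewrite if_same.
move=> rho; rewrite inE; split=> [/eqP->|[S [_ sS _] <-]]; first by exists [::].
apply/eqP; rewrite -[RHS]row0; by case: S sS => // x S /(_ x (mem_head _ _)); rewrite inE.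
Qed.

Lemma accepts_correct : 0 < n -> accepts n adj k T G <-> attains e k.
Proof.
move=> n_gt0; have [P cardP [_ _ _ flyes rows]] :
    exists2 P : {set 'I_n}, #|P| = n & invariant (final n adj k T G) P.
  suff : forall m, m <= n -> exists2 P : {set 'I_n}, #|P| = m &
      invariant (iter m (round n adj k T G) ([::], (false, [:: nseq n.+1 0]))) P.
    by apply.
  elim=> [|m IH] mn.
    by exists set0; [exact: cards0 | exact: initial_invariant].
  have [P cardP inv] := IH (ltnW mn).
  have [|v vP inv'] := round_invariant _ inv.
    by apply/eqP => PT; move: cardP; rewrite PT cardsT card_ord; lia.
  by exists (v |: P) => //; rewrite cardsU1 vP cardP.
have PT : P = setT by apply/eqP; rewrite eqEcard subsetT cardsT card_ord cardP leqnn.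
rewrite /accepts; case flE: (final n adj k T G).2.1 => /=; first by split=> // _; exact: flyes.
have [|_ _ memL] := rows; first by rewrite flE.
split=> [/hasP[rho /memL[S [uS _ _] <-]]|[S uS ecS]].
  by rewrite nth_row_of_n => /eqP ecS; exists S.
apply/hasP; exists (row_of P S); last by rewrite nth_row_of_n ecS.
by apply/memL; exists S => //; split; rewrite ?ecS // => x; rewrite PT inE.
Qed.

End Correctness.

(** * A structured language compiled to the RAM *)

(* Variable x lives in register x < nvars, temporaries in registers nvars .. low - 1, and cell i of
   the memory at address low + i. The memory is viewed as eight interleaved arrays: entry i of array
   t is cell 8 * i + t. *)
Definition nvars := 60.
Definition low := 70.

(** [EG t a] reads entry [a] of array [t]. [ER a] reads cell [a] directly, which is needed for the
    input before it is arranged into arrays. *)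
Inductive exp : Type :=
| EC (c : nat) | EV (x : nat) | EA (a b : exp) | ES (a b : exp)
| EG (t : nat) (a : exp) | ER (a : exp).

Inductive cmd : Type :=
| Asg (x : nat) (a : exp)
| Put (t : nat) (a b : exp)
| Seq (c d : cmd)
| If (a : exp) (c d : cmd)
| For (x y : nat) (c : cmd).

Definition state := (memory * memory)%type.
Implicit Types (s : state) (m : memory) (P : program).

Definition setv s x v : state := (upd s.1 x v, s.2).

Fixpoint eval s (a : exp) : nat :=
  match a with
  | EC c => c
  | EV x => s.1 x
  | EA a b => eval s a + eval s b
  | ES a b => eval s a - eval s b
  | EG t a => s.2 (8 * eval s a + t)
  | ER a => s.2 (eval s a)
  end.

Definition incr x s : state := setv s x (s.1 x).+1.

Fixpoint sem (c : cmd) s : state :=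
  match c with
  | Asg x a => setv s x (eval s a)
  | Put t a b => (s.1, upd s.2 (8 * eval s a + t) (eval s b))
  | Seq c d => sem d (sem c s)
  | If a c d => if eval s a == 0 then sem d s else sem c s
  | For x y c => iter (s.1 y) (fun s => incr x (sem c s)) (setv s x 0)
  end.

Fixpoint writes (c : cmd) : seq nat :=
  match c with
  | Asg x _ => [:: x]
  | Put _ _ _ => [::]
  | Seq c d | If _ c d => writes c ++ writes d
  | For x _ c => x :: writes c
  end.

Fixpoint arrays (c : cmd) : seq nat :=
  match c with
  | Asg _ _ => [::]
  | Put t _ _ => [:: t]
  | Seq c d | If _ c d => arrays c ++ arrays d
  | For _ _ c => arrays c
  end.

Fixpoint bounds (c : cmd) : seq nat :=
  match c with
  | Asg _ _ | Put _ _ _ => [::]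
  | Seq c d | If _ c d => bounds c ++ bounds d
  | For _ y c => y :: bounds c
  end.

Lemma upd_same m x v : upd m x v x = v.
Proof. by rewrite /upd eqxx. Qed.

Lemma upd_other m x v y : y != x -> upd m x v y = m y.
Proof. by rewrite /upd => /negbTE->. Qed.

Lemma setv_other s x v y : y != x -> (setv s x v).1 y = s.1 y.
Proof. exact: upd_other. Qed.

Lemma iter_keep (T : Type) (B : Type) (f : T -> T) (g : T -> B) n x :
  (forall y, g (f y) = g y) -> g (iter n f x) = g x.
Proof. by move=> fg; elim: n => //= n <-. Qed.

Lemma sem_frame c s x : x \notin writes c -> (sem c s).1 x = s.1 x.
Proof.
elim: c s => [y a|t a b|c IHc d IHd|a c IHc d IHd|y z c IH] s //=.
- by rewrite inE => xy; rewrite upd_other.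
- by rewrite mem_cat negb_or => /andP[xc xd]; rewrite IHd // IHc.
- by rewrite mem_cat negb_or => /andP[xc xd]; case: ifP => _; [rewrite IHd|rewrite IHc].
- rewrite inE negb_or => /andP[xy xc].
  by rewrite (iter_keep (g := fun s => s.1 x)) => [|s']; rewrite /= upd_other ?IH.
Qed.

Fixpoint arrays_ok (c : cmd) : bool :=
  match c with
  | Asg _ _ => true
  | Put t _ _ => t < 8
  | Seq c d | If _ c d => arrays_ok c && arrays_ok d
  | For _ _ c => arrays_ok c
  end.

Lemma sem_frame_array c s t i : arrays_ok c -> t < 8 -> t \notin arrays c ->
  (sem c s).2 (8 * i + t) = s.2 (8 * i + t).
Proof.
move=> + t8; elim: c s => [y a|u a b|c IHc d IHd|a c IHc d IHd|y z c IH] s //=.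
- rewrite inE => u8 tu; rewrite upd_other //; apply: contra tu => /eqP; lia.
- by move=> /andP[? ?]; rewrite mem_cat negb_or => /andP[xc xd]; rewrite IHd // IHc.
- move=> /andP[? ?]; rewrite mem_cat negb_or => /andP[xc xd].
  by case: ifP => _; [rewrite IHd|rewrite IHc].
- move=> ok tc; rewrite (iter_keep (g := fun s => s.2 (8 * i + t))) // => s'.
  by rewrite /= IH.
Qed.

Lemma sem_nomem c s : arrays c = [::] -> (sem c s).2 = s.2.
Proof.
elim: c s => [y a|u a b|c IHc d IHd|a c IHc d IHd|y z c IH] s //=.
- by case: (arrays c) IHc => // IHc /IHd->; exact: IHc.
- by case: (arrays c) IHc => // IHc /IHd IHd'; case: ifP => _; [exact: IHd'|exact: IHc].
- by move=> ok; rewrite (iter_keep (g := fun s => s.2)) // => s'; rewrite /= IH.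
Qed.

(** [sem] reads a loop bound once, the compiled code at every test. They agree because the body
    changes neither the bound nor the counter. *)
Fixpoint loops_ok (c : cmd) : bool :=
  match c with
  | Asg _ _ | Put _ _ _ => true
  | Seq c d | If _ c d => loops_ok c && loops_ok d
  | For x y c => [&& x != y, x \notin writes c, y \notin writes c & loops_ok c]
  end.

Lemma for_counter x c N s : x \notin writes c ->
  (iter N (fun s => incr x (sem c s)) (setv s x 0)).1 x = N.
Proof.
move=> xc; elim: N => [|N IH] /=; first by rewrite upd_same.
by rewrite upd_same sem_frame // IH.
Qed.

Lemma sem_for (I : nat -> state -> Prop) x y c s :
  x \notin writes c -> I 0 (setv s x 0) ->
  (forall i s', i < s.1 y -> s'.1 x = i -> I i s' -> I i.+1 (incr x (sem c s'))) ->
  I (s.1 y) (sem (For x y c) s).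
Proof.
move=> xc I0 IS /=; have : s.1 y <= s.1 y by [].
elim: {1 3 4}(s.1 y) => [|N IH] leN //=.
by apply: IS; [exact: leN | exact: for_counter | apply: IH; exact: ltnW].
Qed.

(** * Compilation and its correctness *)

Fixpoint edepth (a : exp) : nat :=
  match a with
  | EC _ | EV _ => 1
  | EA a b | ES a b => maxn (edepth a) (edepth b).+1
  | EG _ a | ER a => maxn (edepth a) 2
  end.

Fixpoint evars_ok (a : exp) : bool :=
  match a with
  | EC _ => true
  | EV x => x < nvars
  | EA a b | ES a b => evars_ok a && evars_ok b
  | EG _ a | ER a => evars_ok a
  end.

(** The temporaries form a stack: the value ends in temporary [d], and those below [d] are
    preserved. The factor 8 of the interleaving is three doublings. *)
Fixpoint cexp (d : nat) (a : exp) : program :=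
  let r := nvars + d in
  match a with
  | EC c => [:: IConst r c]
  | EV x => [:: IConst r 0; IAdd r r x]
  | EA a b => cexp d a ++ cexp d.+1 b ++ [:: IAdd r r r.+1]
  | ES a b => cexp d a ++ cexp d.+1 b ++ [:: ISub r r r.+1]
  | EG t a => cexp d a ++
      [:: IAdd r r r; IAdd r r r; IAdd r r r; IConst r.+1 (low + t); IAdd r r r.+1; ILoad r r]
  | ER a => cexp d a ++ [:: IConst r.+1 low; IAdd r r r.+1; ILoad r r]
  end.

Definition cassign x a : program := cexp 0 a ++ [:: IConst x 0; IAdd x x nvars].

Fixpoint ccmd (pc : nat) (c : cmd) : program :=
  match c with
  | Asg x a => cassign x a
  | Put t a b => cexp 0 a ++ cexp 1 b ++
      [:: IAdd nvars nvars nvars; IAdd nvars nvars nvars; IAdd nvars nvars nvars;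
          IConst nvars.+2 (low + t); IAdd nvars nvars nvars.+2; IStore nvars nvars.+1]
  | Seq c d => let p := ccmd pc c in p ++ ccmd (pc + size p) d
  | If a c d =>
      let p := cexp 0 a in
      let q := ccmd (pc + size p).+1 c in
      let pd := (pc + size p + size q).+2 in
      let q' := ccmd pd d in
      p ++ [:: IJz nvars pd] ++ q ++ [:: IJmp (pd + size q')] ++ q'
  | For x y c =>
      let p := cexp 0 (ES (EV y) (EV x)) in
      let q := ccmd (pc + size p).+2 c ++ cassign x (EA (EV x) (EC 1)) in
      [:: IConst x 0] ++ p ++ [:: IJz nvars (pc + size p + size q).+3] ++ q ++ [:: IJmp pc.+1]
  end.

Definition test_cost := size (cexp 0 (ES (EV 0) (EV 0))).
Definition incr_cost := size (cassign 0 (EA (EV 0) (EC 1))).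

(** The exact number of steps, so that runs compose; bounds are derived later. *)
Fixpoint cost (c : cmd) s : nat :=
  match c with
  | Asg x a => size (cassign x a)
  | Put t a b => size (cexp 0 a) + size (cexp 1 b) + 6
  | Seq c d => cost c s + cost d (sem c s)
  | If a c d => (size (cexp 0 a)).+1 + (if eval s a == 0 then cost d s else (cost c s).+1)
  | For x y c => 1 + \sum_(i < s.1 y) (test_cost.+2 + incr_cost +
        cost c (iter i (fun s => incr x (sem c s)) (setv s x 0))) + test_cost.+1
  end.

(** There are ten temporaries between [nvars] and [low]. The second operand of [Put] is evaluated
    while one of them is occupied, hence depth 9. *)
Fixpoint cmd_ok (c : cmd) : bool :=
  match c with
  | Asg x a => [&& x < nvars, evars_ok a & edepth a <= 10]
  | Put t a b => [&& evars_ok a, evars_ok b, edepth a <= 10 & edepth b <= 9]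
  | Seq c d => cmd_ok c && cmd_ok d
  | If a c d => [&& evars_ok a, edepth a <= 10, cmd_ok c & cmd_ok d]
  | For x y c => [&& x < nvars, y < nvars & cmd_ok c]
  end.

Definition models s m := (forall x, x < nvars -> m x = s.1 x) /\ (forall i, m (low + i) = s.2 i).

Definition code_at P pc (q : program) :=
  forall i, i < size q -> nth IHalt P (pc + i) = nth IHalt q i.

Lemma code_at_cat P pc q1 q2 :
  code_at P pc (q1 ++ q2) <-> code_at P pc q1 /\ code_at P (pc + size q1) q2.
Proof.
split=> [h|[h1 h2] i].
  split=> i iq; first by rewrite h ?size_cat ?nth_cat ?iq //; lia.
  by rewrite -addnA h ?size_cat ?nth_cat ?ltn_add2l // ltnNge leq_addr /= addKn.
rewrite size_cat nth_cat; case: (ltnP i (size q1)) => iq1 iq; first exact: h1.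
by rewrite -h2; [congr nth; lia|lia].
Qed.

Lemma code_at_cons P pc a q : code_at P pc (a :: q) <-> nth IHalt P pc = a /\ code_at P pc.+1 q.
Proof.
rewrite -cat1s code_at_cat /= addn1; split=> -[h ?]; split=> //.
  by have := h 0 isT; rewrite addn0.
by case=> // _; rewrite addn0.
Qed.

Definition goes P t pc m pc' m' := iter t (step P) (pc, m) = (pc', m').

Lemma goes_trans P t1 t2 pc1 m1 pc2 m2 pc3 m3 :
  goes P t1 pc1 m1 pc2 m2 -> goes P t2 pc2 m2 pc3 m3 -> goes P (t1 + t2) pc1 m1 pc3 m3.
Proof. by rewrite /goes addnC iterD => ->. Qed.

Lemma goes1 P pc m pc' m' : step P (pc, m) = (pc', m') -> goes P 1 pc m pc' m'.
Proof. by []. Qed.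

Lemma cexp_correct P pc d a s m : code_at P pc (cexp d a) -> evars_ok a -> d + edepth a <= 10 ->
  models s m -> exists m', [/\ goes P (size (cexp d a)) pc m (pc + size (cexp d a)) m', models s m',
    m' (nvars + d) = eval s a & forall j, j < d -> m' (nvars + j) = m (nvars + j)].
Proof.
have rel_upd s' m' v j : j < 10 -> models s' m' -> models s' (upd m' (nvars + j) v).
  move=> j10 [rv rm]; split=> [x xn|i]; rewrite upd_other.
  - exact: rv.
  - by rewrite neq_ltn (leq_trans xn) ?leq_addr.
  - exact: rm.
  - by rewrite /nvars /low; lia.
have other m' v j j' : j != j' -> upd m' (nvars + j) v (nvars + j') = m' (nvars + j').
  by move=> jj; rewrite upd_other // eqn_add2l eq_sym.
elim: a pc d s m => [c|x|a IHa b IHb|a IHa b IHb|t a IHa|a IHa] pc d s m /=.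
- rewrite code_at_cons => -[cP _] _ d10 r; exists (upd m (nvars + d) c); split.
  + by rewrite addn1; apply: goes1; rewrite /step cP.
  + by apply: (rel_upd) => //; lia.
  + exact: upd_same.
  + by move=> j jd; rewrite other //; lia.
- rewrite !code_at_cons => -[c1 [c2 _]] xn d10 r.
  exists (upd (upd m (nvars + d) 0) (nvars + d) (s.1 x)); split.
  + rewrite addn2 /goes /= c1 /= c2; congr (_, upd _ _ _).
    by rewrite upd_same (upd_other) ?r.1 // neq_ltn (leq_trans xn) ?leq_addr.
  + by do 2 (apply: (rel_upd); first lia).
  + exact: upd_same.
  + by move=> j jd; rewrite !other //; lia.
- rewrite !code_at_cat code_at_cons => -[ca [cb [c1 _]]] /andP[oka okb] d10 r.
  have [m1 [g1 r1 v1 k1]] := IHa _ _ _ _ ca oka ltac:(lia) r.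
  have [m2 [g2 r2 v2 k2]] := IHb _ _ _ _ cb okb ltac:(lia) r1.
  exists (upd m2 (nvars + d) (eval s a + eval s b)); split.
  + rewrite !size_cat !addnA; apply: goes_trans (goes_trans g1 g2) _.
    rewrite addn1; apply: goes1; rewrite /step c1; congr (_, upd _ _ _).
    by rewrite -[(_ + d).+1]addnS v2 k2 // v1.
  + by apply: (rel_upd) => //; lia.
  + exact: upd_same.
  + by move=> j jd; rewrite other ?k2 ?k1 //; lia.
- rewrite !code_at_cat code_at_cons => -[ca [cb [c1 _]]] /andP[oka okb] d10 r.
  have [m1 [g1 r1 v1 k1]] := IHa _ _ _ _ ca oka ltac:(lia) r.
  have [m2 [g2 r2 v2 k2]] := IHb _ _ _ _ cb okb ltac:(lia) r1.
  exists (upd m2 (nvars + d) (eval s a - eval s b)); split.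
  + rewrite !size_cat !addnA; apply: goes_trans (goes_trans g1 g2) _.
    rewrite addn1; apply: goes1; rewrite /step c1; congr (_, upd _ _ _).
    by rewrite -[(_ + d).+1]addnS v2 k2 // v1.
  + by apply: (rel_upd) => //; lia.
  + exact: upd_same.
  + by move=> j jd; rewrite other ?k2 ?k1 //; lia.
- rewrite code_at_cat !code_at_cons => -[ca [c1 [c2 [c3 [c4 [c5 [c6 _]]]]]]] oka d10 r.
  have [m1 [g1 r1 v1 k1]] := IHa _ _ _ _ ca oka ltac:(lia) r.
  move: (eval s a) v1 => v v1; pose r0 := nvars + d.
  exists (upd (upd (upd (upd (upd (upd m1 r0 (v + v)) r0 (v + v + (v + v))) r0 (8 * v)) r0.+1 (low + t))
    r0 (low + (8 * v + t))) r0 (s.2 (8 * v + t))); split.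
  + rewrite size_cat addnA; apply: goes_trans g1 _.
    rewrite /goes /= c1 /= c2 /= c3 /= c4 /= c5 /= c6 /= -/r0.
    have ne : r0 != r0.+1 by rewrite neq_ltn ltnSn.
    rewrite !upd_same !(upd_other _ _ ne) !upd_same v1 -/r0.
    have -> : v + v + (v + v) + (v + v + (v + v)) = 8 * v by lia.
    have -> : 8 * v + (low + t) = low + (8 * v + t) by lia.
    rewrite !upd_other ?r1.2; [by rewrite (_ : pc + _ + 6 = (pc + size (cexp d a)).+4.+2) //; lia
      |by rewrite /r0 /low /nvars; clear -d10; lia..].
  + do 2 (apply: (rel_upd); first lia).
    rewrite /r0 -addnS; apply: (rel_upd); first lia.
    by do 3 (apply: (rel_upd); first lia).
  + exact: upd_same.
  + by move=> j jd; rewrite /r0 -addnS !other ?k1 //; lia.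
- rewrite code_at_cat !code_at_cons => -[ca [c4 [c5 [c6 _]]]] oka d10 r.
  have [m1 [g1 r1 v1 k1]] := IHa _ _ _ _ ca oka ltac:(lia) r.
  move: (eval s a) v1 => v v1; pose r0 := nvars + d.
  exists (upd (upd (upd m1 r0.+1 low) r0 (low + v)) r0 (s.2 v)); split.
  + rewrite size_cat addnA; apply: goes_trans g1 _.
    rewrite /goes /= c4 /= c5 /= c6 /= -/r0.
    have ne : r0 != r0.+1 by rewrite neq_ltn ltnSn.
    rewrite !upd_same !(upd_other _ _ ne) v1 [v + low]addnC.
    rewrite !upd_other ?r1.2; [by rewrite (_ : pc + _ + 3 = (pc + size (cexp d a)).+3) //; lia
      |by rewrite /r0 /low /nvars; clear -d10; lia..].
  + do 2 (apply: (rel_upd); first lia).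
    by rewrite /r0 -addnS; apply: (rel_upd); first lia.
  + exact: upd_same.
  + by move=> j jd; rewrite /r0 -addnS !other ?k1 //; lia.
Qed.

Lemma rel_setv s m x v : x < nvars -> models s m -> models (setv s x v) (upd m x v).
Proof.
move=> xn [rv rm]; split=> [y yn|i] /=; first by rewrite /upd; case: eqP => // _; exact: rv.
by rewrite upd_other ?rm //; move: xn; rewrite /nvars /low; lia.
Qed.

Lemma cassign_correct P pc x a s m : code_at P pc (cassign x a) -> x < nvars -> evars_ok a ->
  edepth a <= 10 -> models s m ->
  exists2 m', goes P (size (cassign x a)) pc m (pc + size (cassign x a)) m' &
    models (setv s x (eval s a)) m'.
Proof.
rewrite /cassign code_at_cat !code_at_cons => -[ca [c1 [c2 _]]] xn oka da r.
have [m1 [g1 r1 v1 _]] := cexp_correct ca oka (d := 0) da r.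
exists (upd (upd m1 x 0) x (eval s a)); last first.
  have [rv rm] := rel_setv (eval s a) xn (rel_setv 0 xn r1).
  by split=> [y yn|i]; [rewrite rv //= /upd; case: (y == x) | exact: rm].
rewrite size_cat addnA; apply: goes_trans g1 _.
rewrite addn2 /goes /= c1 /= c2 /= upd_same upd_other; last by rewrite neq_ltn xn orbT.
by rewrite add0n -[nvars]addn0 v1.
Qed.

Lemma ccmd_correct P pc c s m : code_at P pc (ccmd pc c) -> cmd_ok c -> loops_ok c -> models s m ->
  exists2 m', goes P (cost c s) pc m (pc + size (ccmd pc c)) m' & models (sem c s) m'.
Proof.
elim: c pc s m => [x a|t a b|c IHc d IHd|a c IHc d IHd|x y c IH] pc s m.
- by move=> cP /and3P[xn oka da] _ r; exact: cassign_correct.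
- move=> /= + /and4P[oka okb da db] _ r.
  rewrite !code_at_cat !code_at_cons => -[ca [cb [c1 [c2 [c3 [c4 [c5 [c6 _]]]]]]]].
  have [m1 [g1 r1 v1 _]] := cexp_correct (d := 0) ca oka da r.
  have [m2 [g2 r2 v2 k2]] := cexp_correct (d := 1) cb okb db r1.
  have {k2} w2 : m2 nvars = eval s a by rewrite -[nvars]addn0 k2.
  move: v2; rewrite addn1; move: (eval s a) (eval s b) w2 => v w w2 v2.
  pose r0 := nvars.
  exists (upd (upd (upd (upd (upd (upd m2 r0 (v + v)) r0 (v + v + (v + v))) r0 (8 * v)) r0.+2 (low + t))
    r0 (low + (8 * v + t))) (low + (8 * v + t)) w).
    rewrite !size_cat !addnA; apply: goes_trans (goes_trans g1 g2) _.
    rewrite /goes /= c1 /= c2 /= c3 /= c4 /= c5 /= c6 /= -/r0.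
    have ne : r0 != r0.+2 by [].
    have ne1 : r0.+1 != r0.+2 by [].
    have ne2 : r0.+1 != r0 by [].
    rewrite !upd_same !(upd_other _ _ ne) !upd_same !(upd_other _ _ ne2) !(upd_other _ _ ne1).
    rewrite !(upd_other _ _ ne2) w2 v2.
    have -> : v + v + (v + v) + (v + v + (v + v)) = 8 * v by lia.
    have -> : 8 * v + (low + t) = low + (8 * v + t) by lia.
    by rewrite -addn4 -addn2 -!addnA.
  have [rv2 rm2] := r2; split=> [x xn|i] /=.
    by rewrite !upd_other ?rv2 //; move: xn; rewrite /r0 /low /nvars; lia.
  rewrite [LHS]/upd [RHS]/upd eqn_add2l; case: ifP => // _.
  by rewrite !upd_other ?rm2 // /r0 /low /nvars; lia.
- move=> /= + /andP[okc okd] /andP[lc ld] r; rewrite code_at_cat => -[cc cd].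
  have [m1 g1 r1] := IHc _ _ _ cc okc lc r.
  have [m2 g2 r2] := IHd _ _ _ cd okd ld r1.
  by exists m2 => //; rewrite size_cat addnA; exact: goes_trans g1 g2.
- move=> /= + /and4P[oka da okc okd] /andP[lc ld] r.
  set p := cexp 0 a; set q := ccmd _ c; set pd := (_ + _).+2; set q' := ccmd pd d.
  rewrite code_at_cat code_at_cons code_at_cat code_at_cons => -[ca [c1 [cc [c2 cd]]]].
  have [m1 [g1 r1 v1 _]] := cexp_correct (d := 0) ca oka da r.
  rewrite addn0 in v1.
  have endE : pc + size (p ++ [:: IJz nvars pd] ++ q ++ [:: IJmp (pd + size q')] ++ q') = pd + size q'.
    by rewrite /pd !size_cat /=; lia.
  rewrite endE; case: ifP => va.
    have cd' : code_at P pd q' by move: cd; rewrite /pd addSn.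
    have [m2 g2 r2] := IHd _ _ _ cd' okd ld r1.
    exists m2 => //; rewrite -addn1; apply: goes_trans (goes_trans g1 _) g2.
    by apply: goes1; rewrite /step c1 v1 va.
  have [m2 g2 r2] := IHc _ _ _ cc okc lc r1.
  exists m2 => //; rewrite -addn1 -[(cost c s).+1]addn1.
  apply: goes_trans (goes_trans g1 _) (goes_trans g2 _).
    by apply: goes1; rewrite /step c1 v1 va.
  by apply: goes1; rewrite /step c2.
- move=> cP /and3P[xn yn okc] /and4P[xy xc yc lc] r.
  pose p := cexp 0 (ES (EV y) (EV x)).
  pose q := ccmd (pc + size p).+2 c ++ cassign x (EA (EV x) (EC 1)).
  pose endp := (pc + size p + size q).+3.
  have cE : ccmd pc (For x y c) =
    [:: IConst x 0] ++ p ++ [:: IJz nvars endp] ++ q ++ [:: IJmp pc.+1] by [].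
  move: cP; rewrite cE !cat1s code_at_cons code_at_cat code_at_cons code_at_cat code_at_cons.
  case=> c0 [cp [c1 [cq [c2 _]]]]; rewrite [cost _ _]/= [sem _ _]/=.
  move: cq; rewrite /q code_at_cat => -[cc ci].
  pose body s := incr x (sem c s); set s0 := setv s x 0; set N := s.1 y.
  have test i (s' : state) m' : models s' m' -> s'.1 x = i -> s'.1 y = N ->
      exists2 m1, goes P test_cost.+1 pc.+1 m' (if N - i == 0 then endp else (pc + size p).+2) m1 &
        models s' m1.
    move=> r' xi yN.
    have [||m1 [g1 r1 v1 _]] := @cexp_correct P pc.+1 0 (ES (EV y) (EV x)) s' m' cp _ _ r' => //.
      by rewrite /= xn yn.
    exists m1 => //; rewrite -addn1; apply: goes_trans g1 _.
    apply: goes1; rewrite /step; move: c1 v1; rewrite addn0 /= addSn => -> ->.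
    by rewrite yN xi; case: ifP.
  (* After [j] iterations control is back at the loop test, whose code begins at [pc.+1]. *)
  have reach j : j <= N -> exists2 m1,
      goes P (1 + \sum_(i < j) (test_cost.+2 + incr_cost + cost c (iter i body s0))) pc m pc.+1 m1 &
      models (iter j body s0) m1.
    elim: j => [|j IHj] jN.
      exists (upd m x 0); last exact: rel_setv.
      by rewrite big_ord0; apply: goes1; rewrite /step c0.
    have [m1 g1 r1] := IHj (ltnW jN).
    have xj : (iter j body s0).1 x = j by exact: for_counter.
    have yj : (iter j body s0).1 y = N.
      rewrite (iter_keep (g := fun s => s.1 y)) => [|s'] /=.
        by rewrite upd_other // eq_sym.
      by rewrite upd_other ?sem_frame // eq_sym.
    have [m2 g2 r2] := test _ _ _ r1 xj yj.
    have [m3 g3 r3] := IH _ _ _ cc okc lc r2.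
    have [||m4 g4 r4] := @cassign_correct P _ x (EA (EV x) (EC 1)) _ m3 ci xn _ _ r3 => //.
      by rewrite /= xn.
    exists m4; last by move: r4; rewrite /= addn1.
    rewrite big_ord_recr /= addnA; apply: goes_trans g1 _.
    have -> : test_cost.+2 + incr_cost + cost c (iter j body s0) =
      test_cost.+1 + (cost c (iter j body s0) + (incr_cost + 1)) by lia.
    apply: goes_trans g2 _; rewrite subn_eq0 leqNgt jN /=.
    apply: goes_trans g3 _; apply: goes_trans g4 _; apply: goes1; rewrite /step.
    move: c2; rewrite /q size_cat !addnA => -> //.
  have [m1 g1 r1] := reach N (leqnn _).
  have xN : (iter N body s0).1 x = N by exact: for_counter.
  have yN : (iter N body s0).1 y = N.
    rewrite (iter_keep (g := fun s => s.1 y)) => [|s'] /=.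
      by rewrite upd_other // eq_sym.
    by rewrite upd_other ?sem_frame // eq_sym.
  have [m2 g2 r2] := test _ _ _ r1 xN yN.
  exists m2 => //; apply: goes_trans g1 _; move: g2; rewrite subnn eqxx.
  suff <- : pc + size ([:: IConst x 0] ++ p ++ [:: IJz nvars endp] ++ q ++ [:: IJmp pc.+1]) = endp by [].
  have endE (u v : program) a1 a2 a3 :
    pc + size ([:: a1] ++ u ++ [:: a2] ++ v ++ [:: a3]) = (pc + size u + size v).+3.
    by rewrite /= size_cat /= size_cat /=; lia.
  exact: endE.
Qed.

(** * Static time bounds *)

Fixpoint csize (c : cmd) : nat :=
  match c with
  | Asg x a => size (cassign x a)
  | Put t a b => size (cexp 0 a) + size (cexp 1 b) + 6
  | Seq c d => csize c + csize d
  | If a c d => (size (cexp 0 a)).+2 + csize c + csize d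
  | For _ _ c => test_cost.+2 + incr_cost + csize c + (test_cost + 2)
  end.

Fixpoint nesting (c : cmd) : nat :=
  match c with
  | Asg _ _ | Put _ _ _ => 0
  | Seq c d | If _ c d => maxn (nesting c) (nesting d)
  | For _ _ c => (nesting c).+1
  end.

(** Loop bounds are never written, so they keep their initial values, at most [B], and a nest of
    depth d repeats its body at most B^d times. *)
Lemma static_cost c s B : 0 < B -> all (fun y => y \notin writes c) (bounds c) ->
  (forall y, y \in bounds c -> s.1 y <= B) -> cost c s <= csize c * B ^ nesting c.
Proof.
move=> B_gt0.
(* [W] keeps the writes of the whole command: a bound inside must also survive what the enclosing
   and preceding commands write. *)
have gen (W : seq nat) : forall s, {subset writes c <= W} -> all (fun y => y \notin W) (bounds c) ->
    (forall y, y \in bounds c -> s.1 y <= B) -> cost c s <= csize c * B ^ nesting c.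
  have pw i j : i <= j -> B ^ i <= B ^ j by move=> ij; exact: leq_pexp2l.
  have pos i : 0 < B ^ i by rewrite expn_gt0 B_gt0.
  elim: c {s} => [x a|t a b|c IHc d IHd|a c IHc d IHd|x y c IH] s /=.
  - by rewrite muln1.
  - by rewrite muln1.
  - move=> wW; rewrite all_cat => /andP[bc bd] leB; rewrite mulnDl; apply: leq_add.
      apply: leq_trans (IHc s _ bc _) _; last by rewrite leq_mul2l pw ?orbT ?leq_maxl.
        by move=> x xc; apply: wW; rewrite mem_cat xc.
      by move=> y yc; apply: leB; rewrite mem_cat yc.
    apply: leq_trans (IHd _ _ bd _) _; last by rewrite leq_mul2l pw ?orbT ?leq_maxr.
      by move=> x xd; apply: wW; rewrite mem_cat xd orbT.
    move=> y yd; rewrite sem_frame; first by apply: leB; rewrite mem_cat yd orbT.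
    by apply: contra (allP bd y yd) => yc; apply: wW; rewrite mem_cat yc.
  - move=> wW; rewrite all_cat => /andP[bc bd] leB.
    have hc : cost c s <= csize c * B ^ maxn (nesting c) (nesting d).
      apply: leq_trans (IHc s _ bc _) _; last by rewrite leq_mul2l pw ?orbT ?leq_maxl.
        by move=> x xc; apply: wW; rewrite mem_cat xc.
      by move=> y yc; apply: leB; rewrite mem_cat yc.
    have hd : cost d s <= csize d * B ^ maxn (nesting c) (nesting d).
      apply: leq_trans (IHd s _ bd _) _; last by rewrite leq_mul2l pw ?orbT ?leq_maxr.
        by move=> x xd; apply: wW; rewrite mem_cat xd orbT.
      by move=> y yd; apply: leB; rewrite mem_cat yd orbT.
    have := pos (maxn (nesting c) (nesting d)); rewrite !mulnDl.
    by move: (B ^ _) hc hd (size _) => b hc hd z b_gt0; case: ifP => _; nia.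
  - move=> wW /andP[yW bc] leB.
    have sum_le : \sum_(i < s.1 y) (test_cost.+2 + incr_cost +
        cost c (iter i (fun s => incr x (sem c s)) (setv s x 0))) <=
        B * (test_cost.+2 + incr_cost + csize c * B ^ nesting c).
      apply: (@leq_trans (\sum_(i < s.1 y) (test_cost.+2 + incr_cost + csize c * B ^ nesting c))).
        apply: leq_sum => i _; rewrite leq_add2l; apply: IH => //.
          by move=> z zc; apply: wW; rewrite inE zc orbT.
        move=> z zc; rewrite (iter_keep (g := fun s => s.1 z)) => [|s'] /=.
          rewrite upd_other; first by apply: leB; rewrite inE zc orbT.
          by apply: contraNneq (allP bc z zc) => ->; apply: wW; rewrite mem_head.
        rewrite upd_other ?sem_frame //.
          by apply: contra (allP bc z zc) => zc'; apply: wW; rewrite inE zc' orbT.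
        by apply: contraNneq (allP bc z zc) => ->; apply: wW; rewrite mem_head.
      by rewrite sum_nat_const card_ord leq_mul2r leB ?orbT ?mem_head.
    set S := bigop _ _ _ in sum_le *.
    have := pos (nesting c); rewrite expnS; move: S sum_le; move: (B ^ _) (csize c) test_cost incr_cost.
    move=> b z tc ic S S_le b_gt0; have leBb : B <= B * b by rewrite leq_pmulr.
    have : (tc + 2 + ic) * B <= (tc + 2 + ic) * (B * b) by rewrite leq_mul2l leBb orbT.
    have : tc + 2 <= (tc + 2) * (B * b) by rewrite leq_pmulr // muln_gt0 B_gt0.
    lia.
by apply: gen.
Qed.

(** * Computing the thresholds *)

(** The code ends where the program ends, and there [nth] returns its default [IHalt]; a halted
    machine stands still, so every [t] beyond the cost will do. *)
Lemma run_cmd (P pre : program) c (m0 m1 : memory) (s : state) t0 t :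
  P = pre ++ ccmd (size pre) c -> cmd_ok c -> loops_ok c ->
  goes P t0 0 m0 (size pre) m1 -> models s m1 -> t0 + cost c s <= t ->
  halted P (run P t m0) /\ (run P t m0).2 0 = (sem c s).1 0.
Proof.
move=> PE okc lc g0 r le_t.
have cP : code_at P (size pre) (ccmd (size pre) c).
  by move=> i _; rewrite PE nth_cat ltnNge leq_addr /= addKn.
have [m2 g2 r2] := ccmd_correct cP okc lc r.
have haltP : nth IHalt P (size pre + size (ccmd (size pre) c)) = IHalt.
  by rewrite nth_default // PE size_cat.
have -> : run P t m0 = (size pre + size (ccmd (size pre) c), m2).
  have := goes_trans g0 g2; rewrite /run /goes -[in X in _ -> X](subnK le_t) [in X in _ -> X]iterD => ->.
  have stepE : step P (size pre + size (ccmd (size pre) c), m2) =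
    (size pre + size (ccmd (size pre) c), m2) by rewrite /step haltP.
  by elim: (t - _) => // i IH; rewrite iterS IH.
by rewrite /halted /= haltP; split=> //; apply: r2.1.
Qed.

(** Thresholds are written as expressions that can be evaluated and compiled. The cost of computing
    an expression is bounded by an expression again ([acost]), so that the time bound f is
    computable by the same compiler. *)
Inductive aexp : Type :=
| AK | ANum (c : nat) | ASucc (a : aexp) | AAdd (a b : aexp) | AMul (a b : aexp) | APow (a b : aexp).

Fixpoint aeval (k : nat) (a : aexp) : nat :=
  match a with
  | AK => k
  | ANum c => c
  | ASucc a => (aeval k a).+1
  | AAdd a b => aeval k a + aeval k b
  | AMul a b => aeval k a * aeval k b
  | APow a b => aeval k a ^ aeval k b
  end.

Definition mul_loop d :=
  Seq (Asg (d + 2) (EC 0)) (Seq (For (d + 3) (d + 1) (Asg (d + 2) (EA (EV (d + 2)) (EV d))))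
    (Asg d (EV (d + 2)))).

(** Each multiplication adds the accumulator to itself base many times, so the loops are bounded by
    base and exponent and not by the power itself. *)
Definition pow_body d :=
  Seq (Asg (d + 2) (EC 1))
    (For (d + 3) (d + 1) (Seq (Asg (d + 4) (EC 0)) (Seq
       (For (d + 5) d (Asg (d + 4) (EA (EV (d + 4)) (EV (d + 2)))))
       (Asg (d + 2) (EV (d + 4)))))).

Definition pow_loop d := Seq (pow_body d) (Asg d (EV (d + 2))).

(* The argument k is variable 1; the result goes to variable d > 1, and no variable below d changes. *)
Fixpoint caexp d (a : aexp) : cmd :=
  match a with
  | AK => Asg d (EV 1)
  | ANum c => Asg d (EC c)
  | ASucc a => Seq (caexp d a) (Asg d (EA (EV d) (EC 1)))
  | AAdd a b => Seq (caexp d a) (Seq (caexp (d + 1) b) (Asg d (EA (EV d) (EV (d + 1)))))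
  | AMul a b => Seq (caexp d a) (Seq (caexp (d + 1) b) (mul_loop d))
  | APow a b => Seq (caexp d a) (Seq (caexp (d + 1) b) (pow_loop d))
  end.

Lemma caexp_writes d a : all (leq d) (writes (caexp d a)).
Proof.
elim: a d => [|c|a IHa|a IHa b IHb|a IHa b IHb|a IHa b IHb] d /=; rewrite ?leqnn //.
- by rewrite all_cat IHa /= leqnn.
all: rewrite !all_cat IHa /= ?leqnn ?leq_addr ?andbT //=.
all: by apply: sub_all (IHb _) => x /=; rewrite addn1 => /ltnW.
Qed.

Lemma caexp_frame d a s x : x < d -> (sem (caexp d a) s).1 x = s.1 x.
Proof.
move=> xd; apply: sem_frame; apply/negP => /(allP (caexp_writes d a)).
by rewrite leqNgt xd.
Qed.

Lemma caexp_arrays d a : arrays (caexp d a) = [::].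
Proof. by elim: a d => //= [a IHa|a IHa b IHb|a IHa b IHb|a IHa b IHb] d; rewrite IHa ?IHb. Qed.

Lemma mul_loop_sem d s : (sem (mul_loop d) s).1 d = s.1 d * s.1 (d + 1).
Proof.
rewrite /mul_loop; set s1 := sem (Asg (d + 2) (EC 0)) s.
have s1E : s1.1 (d + 2) = 0 by rewrite /= upd_same.
have s1N x : x != d + 2 -> s1.1 x = s.1 x by move=> xd; rewrite /= upd_other.
pose I i (s' : state) := s'.1 (d + 2) = s.1 d * i /\ s'.1 d = s.1 d.
have [e1 e2] : I (s1.1 (d + 1)) (sem (For (d + 3) (d + 1) (Asg (d + 2) (EA (EV (d + 2)) (EV d)))) s1).
  apply: (@sem_for I) => [||i s' iN xi [h1 h2]]; first by rewrite /= inE; (clear; lia).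
    by split; [rewrite setv_other ?muln0 // | rewrite setv_other ?s1N //]; clear; lia.
  split; rewrite /= upd_other; try (clear; lia).
    by rewrite upd_same h1 h2 mulnS addnC.
  by rewrite upd_other //; (clear; lia).
by rewrite [LHS]upd_same [LHS]e1 s1N //; (clear; lia).
Qed.

Lemma pow_loop_sem d s : (sem (pow_loop d) s).1 d = s.1 d ^ s.1 (d + 1).
Proof.
rewrite /pow_loop /pow_body; set s1 := sem (Asg (d + 2) (EC 1)) s.
have s1E : s1.1 (d + 2) = 1 by rewrite /= upd_same.
have s1N x : x != d + 2 -> s1.1 x = s.1 x by move=> xd; rewrite /= upd_other.
set body := Seq (Asg (d + 4) _) _.
pose I i (s' : state) := s'.1 (d + 2) = s.1 d ^ i /\ s'.1 d = s.1 d.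
have [e1 e2] : I (s1.1 (d + 1)) (sem (For (d + 3) (d + 1) body) s1).
  apply: (@sem_for I) => [||i s' iN xi [h1 h2]]; first by rewrite /= !inE; (clear; lia).
    by split; [rewrite setv_other ?expn0 // | rewrite setv_other ?s1N //]; clear; lia.
  pose s2 := sem (Asg (d + 4) (EC 0)) s'.
  have s2N x : x != d + 4 -> s2.1 x = s'.1 x by move=> xd; rewrite /= upd_other.
  pose J j (s'' : state) := [/\ s''.1 (d + 4) = s'.1 (d + 2) * j, s''.1 (d + 2) = s'.1 (d + 2) &
    s''.1 d = s'.1 d].
  have [f1 f2 f3] : J (s2.1 d) (sem (For (d + 5) d (Asg (d + 4) (EA (EV (d + 4)) (EV (d + 2))))) s2).
    apply: (@sem_for J) => [||j s3 jN xj [g1 g2 g3]]; first by rewrite /= inE; (clear; lia).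
      by split; [rewrite setv_other ?muln0 ?[LHS]upd_same //|rewrite setv_other ?s2N //..]; clear; lia.
    split; rewrite /= upd_other; try (clear; lia).
    - by rewrite upd_same g1 g2 mulnS addnC.
    - by rewrite upd_other //; (clear; lia).
    - by rewrite upd_other //; (clear; lia).
  have s2d : s2.1 d = s'.1 d by apply: s2N; (clear; lia).
  split.
    rewrite [LHS]upd_other; last (clear; lia).
    by rewrite [LHS]upd_same [LHS]f1 s2d h1 h2 expnS mulnC.
  rewrite [LHS]upd_other; last (clear; lia).
  by rewrite [LHS]upd_other; [rewrite [LHS]f3 h2|(clear; lia)].
by rewrite [LHS]upd_same [LHS]e1 s1N //; (clear; lia).
Qed.

Lemma caexp_sem d a s : 1 < d -> (sem (caexp d a) s).1 d = aeval (s.1 1) a.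
Proof.
have k_keep d' b s' : 1 < d' -> (sem (caexp d' b) s').1 1 = s'.1 1 by exact: caexp_frame.
elim: a d s => [|c|a IHa|a IHa b IHb|a IHa b IHb|a IHa b IHb] d s d1.
- exact: upd_same.
- exact: upd_same.
- by rewrite [LHS]upd_same /= IHa // addn1.
all: have d2 : 1 < d + 1 by lia.
all: have dd : d < d + 1 by lia.
- by rewrite [LHS]upd_same [LHS]/= IHb // (caexp_frame _ _ dd) IHa // k_keep.
- by rewrite [LHS]mul_loop_sem IHb // (caexp_frame _ _ dd) IHa // k_keep.
- by rewrite [LHS]pow_loop_sem IHb // (caexp_frame _ _ dd) IHa // k_keep.
Qed.

(** 100 exceeds every code size involved, and the square accounts for the two nested loops of a
    power, both bounded by a + b + 1. *)
Fixpoint acost (a : aexp) : aexp :=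
  match a with
  | AK | ANum _ => ANum 100
  | ASucc a => AAdd (acost a) (ANum 100)
  | AAdd a b => AAdd (AAdd (acost a) (acost b)) (ANum 100)
  | AMul a b | APow a b => AAdd (AAdd (acost a) (acost b))
      (AMul (ANum 100) (AMul (ASucc (AAdd a b)) (ASucc (AAdd a b))))
  end.

Lemma caexp_cost d a s : 1 < d -> cost (caexp d a) s <= aeval (s.1 1) (acost a).
Proof.
have k_keep d' b s' : 1 < d' -> (sem (caexp d' b) s').1 1 = s'.1 1 by exact: caexp_frame.
elim: a d s => [|c|a IHa|a IHa b IHb|a IHa b IHb|a IHa b IHb] d s d1 //.
  by apply: leq_add; [exact: IHa|].
all: have d2 : 1 < d + 1 by lia.
all: have dd : d < d + 1 by lia.
all: rewrite [cost _ _]/= -/(cost _ _) addnA; apply: leq_add; first by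
  apply: leq_add; [exact: IHa | rewrite -(k_keep _ a s d1); exact: IHb].
- by [].
all: set s1 := sem (caexp (d + 1) b) _.
all: have e1 : s1.1 d = aeval (s.1 1) a by rewrite /s1 caexp_frame // caexp_sem.
all: have e2 : s1.1 (d + 1) = aeval (s.1 1) b by rewrite /s1 caexp_sem // k_keep.
- apply: (@leq_trans (csize (mul_loop d) * (aeval (s.1 1) a + aeval (s.1 1) b).+1 ^ 1)).
    apply: (@static_cost (mul_loop d) s1) => //=; first by rewrite !inE andbT; clear; lia.
    by move=> y; rewrite !inE => /eqP->; rewrite e2 leqW // leq_addl.
  by rewrite expn1 leq_mul // leq_pmulr.
(* [pow_loop] finally overwrites [d], a loop bound, so [static_cost] is applied to [pow_body]; the 4
   pays for the last assignment. *)
- have le2 : csize (pow_body d) + 4 <= 100 by [].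
  set X := (aeval (s.1 1) a + aeval (s.1 1) b).+1.
  apply: (@leq_trans (csize (pow_body d) * X ^ 2 + 4 * X ^ 2)).
    apply: leq_add; last by rewrite leq_pmulr // expn_gt0.
    apply: (@static_cost (pow_body d) s1) => //=; first by rewrite !inE !andbT; clear; lia.
    by move=> y; rewrite !inE => /orP[]/eqP->; rewrite ?e1 ?e2 leqW // ?leq_addl ?leq_addr.
  by rewrite -mulnDl expnS expn1 leq_mul.
Qed.

Lemma aexp_computable a : cmd_ok (caexp 2 a) -> loops_ok (caexp 2 a) -> forall k, exists t,
  let P := Asg 1 (EV 0) in
  let Q := Seq P (Seq (caexp 2 a) (Asg 0 (EV 2))) in
  halted (ccmd 0 Q) (run (ccmd 0 Q) t (nat_input k)) /\
  (run (ccmd 0 Q) t (nat_input k)).2 0 = aeval k a.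
Proof.
move=> ok lok k.
pose s : state := (nat_input k, fun i => nat_input k (low + i)).
pose Q := Seq (Asg 1 (EV 0)) (Seq (caexp 2 a) (Asg 0 (EV 2))).
exists (cost Q s) => /=.
have [|||//|||h1 h2] := @run_cmd (ccmd 0 Q) [::] Q (nat_input k) (nat_input k) s 0 (cost Q s) => //.
- by rewrite /= ok.
- by rewrite /= lok.
split=> //; apply: etrans h2 _.
rewrite [LHS]upd_same; exact: caexp_sem.
Qed.

(** * The program *)

Definition arr (s : state) t i := s.2 (8 * i + t).

Definition agree (c : cmd) (s' s : state) :=
  (forall x, x \notin writes c -> s'.1 x = s.1 x) /\
  (forall t i, t < 8 -> t \notin arrays c -> arr s' t i = arr s t i).

Lemma sem_agree c s : arrays_ok c -> agree c (sem c s) s.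
Proof. by move=> ok; split=> [x|t i t8 tc]; [exact: sem_frame | exact: sem_frame_array]. Qed.

(** The loop rule with the frame built in: invariants need to mention only what the loop changes. *)
Lemma sem_for_agree (I : nat -> state -> Prop) x y c s :
  x \notin writes c -> arrays_ok c -> I 0 (setv s x 0) ->
  (forall i s', i < s.1 y -> s'.1 x = i -> agree (For x y c) s' s -> I i s' ->
    I i.+1 (incr x (sem c s'))) ->
  I (s.1 y) (sem (For x y c) s).
Proof.
move=> xc ok I0 IS.
pose J i s' := agree (For x y c) s' s /\ I i s'.
suff [] : J (s.1 y) (sem (For x y c) s) by [].
apply: (@sem_for J) => // [|i s' iy xi [ag Ii]].
  split=> //; split=> // z; rewrite inE negb_or => /andP[zx _]; exact: setv_other.
split; last exact: IS.
split=> [z zw|t j t8 tc].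
  move: (zw); rewrite inE negb_or => /andP[zx zc].
  by rewrite setv_other // sem_frame // ag.1.
by rewrite -(ag.2 t j t8 tc); exact: sem_frame_array.
Qed.

Lemma arr_put s t i v u j : t < 8 -> u < 8 ->
  upd s.2 (8 * i + t) v (8 * j + u) = if (j == i) && (u == t) then v else arr s u j.
Proof.
move=> t8 u8; rewrite /upd /arr; case: andP => [[/eqP-> /eqP->]|h]; first by rewrite eqxx.
by case: eqP => // eqa; case: h; split; apply/eqP; lia.
Qed.

Lemma sem_asg x a s : sem (Asg x a) s = setv s x (eval s a).
Proof. by []. Qed.

Lemma sem_put t a b s : sem (Put t a b) s = (s.1, upd s.2 (8 * eval s a + t) (eval s b)).
Proof. by []. Qed.

Lemma sem_seq c d s : sem (Seq c d) s = sem d (sem c s).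
Proof. by []. Qed.

Lemma sem_if a c d s : sem (If a c d) s = if eval s a == 0 then sem d s else sem c s.
Proof. by []. Qed.

Local Arguments sem : simpl never.

Definition skip := Asg 59 (EC 0).
Definition differ a b := EA (ES a b) (ES b a).

Lemma eval_differ s a b : (eval s (differ a b) == 0) = (eval s a == eval s b).
Proof. by rewrite /= addn_eq0 !subn_eq0 -eqn_leq. Qed.

Lemma iota0S i : iota 0 i.+1 = iota 0 i ++ [:: i].
Proof. by rewrite -[i.+1]addn1 iotaD. Qed.

Section Main.
Variables (n : nat) (adj : nat -> nat -> bool) (k T G : nat).

(* Variables: 0 n, 1 k, 3 T, 4 G, 5 n + 1, 6 number of rows, 7 number of new rows, 8 overflow flag,
   9 selected vertex, 19 the constant 2. Arrays: 0 adjacency matrix, 1 rows, 2 new rows,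
   3 candidate row, 4 treated vertices, 5 multiples of n. *)
Definition env (s : state) :=
  [/\ [/\ s.1 0 = n, s.1 1 = k & s.1 3 = T], [/\ s.1 4 = G, s.1 5 = n.+1 & s.1 19 = 2],
    forall i j, i < n -> j < n -> arr s 0 (i * n + j) = adj i j &
    forall i, i < n -> arr s 5 i = i * n].

Definition env_ok (c : cmd) := arrays_ok c &&
  all (fun x => x \notin writes c) [:: 0; 1; 3; 4; 5; 19] && (0 \notin arrays c) && (5 \notin arrays c).

Lemma env_agree c s s' : env_ok c -> agree c s' s -> env s -> env s'.
Proof.
case/andP=> /andP[/andP[_ /allP okv] ok0] ok5 [agv aga] [[e0 e1 e3] [e4 e5 e19] eA eR].
split.
- by split; rewrite agv ?okv.
- by split; rewrite agv ?okv.
- by move=> i j iN jN; rewrite aga ?eA.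
- by move=> i iN; rewrite aga ?eR.
Qed.

Definition treated (dn : seq nat) (s : state) := forall w, w <= n -> arr s 4 w = (w \in dn).

(** The pair is in variables 12 and 11. Array 5 supplies row offsets because the machine cannot
    multiply. The sum of two bits minus 1 is nonzero exactly when both are 1. *)
Definition codeg_c :=
  Seq (Asg 15 (EC 0)) (For 13 0 (If
    (ES (EA (EG 0 (EA (EG 5 (EV 12)) (EV 13))) (EG 0 (EA (EG 5 (EV 11)) (EV 13)))) (EC 1))
    (Asg 15 (EA (EV 15) (EC 1))) skip)).


Lemma env_sem c s : env_ok c -> env s -> env (sem c s).
Proof.
by move=> okc; apply: (env_agree okc); apply: sem_agree; case/andP: okc => /andP[/andP[]].
Qed.

Lemma codeg_sem s u w : env s -> s.1 12 = u -> s.1 11 = w -> u < n -> w < n ->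
  (sem codeg_c s).1 15 = count (fun x => adj u x && adj w x) (iota 0 n).
Proof.
move=> es su sw un wn; rewrite /codeg_c sem_seq sem_asg; set c := For _ _ _.
set s0 := setv s 15 _; have es0 : env s0 by exact: (env_sem (c := Asg 15 (EC 0))).
have s0n : s0.1 0 = n by case: es0 => [[]].
pose I i (s' : state) := s'.1 15 = count (fun x => adj u x && adj w x) (iota 0 i).
rewrite -[in RHS]s0n; apply: (@sem_for_agree I) => // i s' iN xi ag IH.
rewrite s0n in iN; have [_ _ eA eR] := env_agree (c := c) isT ag es0.
have s'12 : s'.1 12 = u by rewrite ag.1.
have s'11 : s'.1 11 = w by rewrite ag.1.
rewrite /I iota0S count_cat -IH sem_if /=.
rewrite -!/(arr s' _ _) s'12 s'11 xi !eR // !eA //.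
by case: (adj u i); case: (adj w i); rewrite /= ?addn0.
Qed.

(** Variable 14 is raised but never lowered, so repeated calls accumulate a disjunction. *)
Definition hedge_c :=
  If (EG 0 (EA (EG 5 (EV 12)) (EV 11))) skip (Seq codeg_c
    (If (ES (EV 3) (EV 15)) skip (Asg 14 (EC 1)))).

Lemma hedge_sem s u w : env s -> s.1 12 = u -> s.1 11 = w -> u < n -> w < n ->
  (sem hedge_c s).1 14 = if hedgen n adj T u w then 1 else s.1 14.
Proof.
move=> es su sw un wn; have [[_ _ e3] _ eA eR] := es.
rewrite /hedgen /hedge_c sem_if /= -!/(arr s _ _) su sw eR // eA //.
case: (adj u w) => //=; rewrite sem_seq sem_if /= (codeg_sem es su sw) //.
have -> : (sem codeg_c s).1 3 = T by rewrite sem_frame.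
rewrite subn_eq0; case: ifP => _ //.
exact: (sem_frame (c := codeg_c)).
Qed.

Definition select_body :=
  If (EG 4 (EV 11)) skip (Seq (If (differ (EV 9) (EV 0)) (Asg 14 (EC 0)) (Asg 14 (EC 1)))
    (Seq (For 12 0 (If (EG 4 (EV 12)) hedge_c skip))
      (If (EV 14) (Asg 9 (EV 11)) skip))).

Definition select_c := Seq (Asg 9 (EV 0)) (For 11 0 select_body).

Lemma select_sem s dn : env s -> treated dn s -> (sem select_c s).1 9 = select n adj T dn.
Proof.
move=> es ts; rewrite /select_c sem_seq sem_asg; set c := For _ _ _.
set s0 := setv s 9 _; have es0 : env s0 by exact: (env_sem (c := Asg 9 (EV 0))).
have s0n : s0.1 0 = n by case: es0 => [[]].
pose f v w := if w \in dn then v else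
  if (v == n) || has (fun u => (u \in dn) && hedgen n adj T u w) (iota 0 n) then w else v.
pose I i (s' : state) := s'.1 9 = foldl f n (iota 0 i).
rewrite /select -/f -[X in _ = foldl f n (iota 0 X)]s0n.
apply: (@sem_for_agree I) => // w s' iN xi ag IH.
rewrite s0n in iN; have es' := env_agree (c := c) isT ag es0; have [[e0 _ _] _ _ _] := es'.
have ts' : treated dn s' by move=> x xn; rewrite (ag.2 4 x) //; exact: ts.
rewrite /I iota0S foldl_cat -IH /= {1}/f sem_if /= -/(arr s' 4 _) xi ts' 1?ltnW //.
case wdn: (w \in dn) => //=.
rewrite !sem_seq; set s1 := sem (If _ _ _) s'.
have es1 : env s1 by exact: (env_sem (c := If (differ (EV 9) (EV 0)) (Asg 14 (EC 0)) (Asg 14 (EC 1)))).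
have s1h : s1.1 14 = (s'.1 9 == n).
  by rewrite /s1 sem_if eval_differ /= e0; case: eqP.
have ts1 : treated dn s1.
  by move=> x xn; rewrite -ts' //; apply: (sem_frame_array (c := If _ (Asg 14 (EC 0)) (Asg 14 (EC 1)))).
have s1w : s1.1 11 = w by rewrite -xi; apply: (sem_frame (c := If _ (Asg 14 (EC 0)) (Asg 14 (EC 1)))).
have s1v : s1.1 9 = s'.1 9 by apply: (sem_frame (c := If _ (Asg 14 (EC 0)) (Asg 14 (EC 1)))).
have s1n : s1.1 0 = n by case: es1 => [[]].
clearbody s1; set d := For _ _ _; set s2 := sem d s1.
pose g u := (u \in dn) && hedgen n adj T u w.
pose J i (s'' : state) := s''.1 14 = (s'.1 9 == n) || has g (iota 0 i).
have s2h : J (s1.1 0) s2.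
  apply: (@sem_for_agree J) => // [|u s3 uN xu ag3 IH3]; first by rewrite /J orbF.
  rewrite s1n in uN; have es3 := env_agree (c := d) isT ag3 es1.
  have ts3 : treated dn s3 by move=> x xn; rewrite (ag3.2 4 x) // ts1.
  have s3w : s3.1 11 = w by rewrite ag3.1.
  rewrite /J iota0S has_cat orbA setv_other // sem_if /= -/(arr s3 4 _) xu ts3 1?ltnW // orbF /g.
  case: (u \in dn) => /=; last by rewrite orbF; exact: IH3.
  rewrite (hedge_sem es3 xu s3w) //; case: hedgen; first by rewrite orbT.
  by rewrite orbF; exact: IH3.
rewrite s1n /J in s2h; rewrite sem_if /= s2h -/g.
have s2v : s2.1 9 = s'.1 9 by rewrite -s1v; exact: (sem_frame (c := d)).
have s2w : s2.1 11 = w by rewrite -s1w; exact: (sem_frame (c := d)).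
by case: (_ || _); rewrite /= ?sem_asg //= ?[LHS]upd_same.
Qed.

Definition cand_c := For 20 5 (If (EG 4 (EV 20)) (Put 3 (EV 20) (EC 0))
  (If (EV 18)
    (If (differ (EV 20) (EV 0))
      (Put 3 (EV 20) (EA (EG 1 (EA (EV 17) (EV 20))) (EG 0 (EA (EG 5 (EV 9)) (EV 20)))))
      (Put 3 (EV 20) (EA (EG 1 (EA (EV 17) (EV 20))) (EG 1 (EA (EV 17) (EV 9))))))
    (Put 3 (EV 20) (EG 1 (EA (EV 17) (EV 20)))))).

Definition candidate rho (s : state) := forall w, w <= n -> arr s 3 w = nth 0 rho w.

Lemma cand_sem s dn v (b : bool) rho : env s -> treated dn s -> s.1 9 = v -> v < n -> s.1 18 = b ->
  (forall w, w <= n -> arr s 1 (s.1 17 + w) = nth 0 rho w) ->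
  candidate (update_row n adj dn v b rho) (sem cand_c s).
Proof.
move=> es ts sv vn sb srho; have [_ [_ e5 _] _ _] := es.
pose I i (s' : state) := forall w, w < i -> arr s' 3 w = nth 0 (update_row n adj dn v b rho) w.
have : I (s.1 5) (sem cand_c s); last by rewrite e5 => H w wn; exact: H.
apply: (@sem_for_agree I) => // i s' iN xi ag IH w; rewrite e5 in iN.
have [[e0 _ _] _ eA eR] := env_agree (c := cand_c) isT ag es.
have ts' : arr s' 4 i = (i \in dn) by rewrite (ag.2 4 i) //; exact: ts.
have s'v : s'.1 9 = v by rewrite ag.1.
have s'b : s'.1 18 = b by rewrite ag.1.
have s'rho x : x <= n -> arr s' 1 (s'.1 17 + x) = nth 0 rho x.
  by move=> xn; rewrite (ag.2 1) // ag.1 //; exact: srho.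
have putE z : (forall x, x < i.+1 ->
    arr (incr 20 (s'.1, upd s'.2 (8 * i + 3) z)) 3 x = if x == i then z else arr s' 3 x).
  by move=> x xi'; rewrite {1}/arr /= arr_put // andbT.
have newE : nth 0 (update_row n adj dn v b rho) i = if i \in dn then 0
   else nth 0 rho i + b * (if i == n then nth 0 rho v else adj v i : nat).
  by rewrite nth_mkseq.
suff : exists2 z, sem (If (EG 4 (EV 20)) (Put 3 (EV 20) (EC 0))
  (If (EV 18)
    (If (differ (EV 20) (EV 0))
      (Put 3 (EV 20) (EA (EG 1 (EA (EV 17) (EV 20))) (EG 0 (EA (EG 5 (EV 9)) (EV 20)))))
      (Put 3 (EV 20) (EA (EG 1 (EA (EV 17) (EV 20))) (EG 1 (EA (EV 17) (EV 9))))))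
    (Put 3 (EV 20) (EG 1 (EA (EV 17) (EV 20)))))) s' = (s'.1, upd s'.2 (8 * i + 3) z) &
    z = nth 0 (update_row n adj dn v b rho) i.
  case=> z -> zE wi; rewrite putE //; case: eqP => [->//|/eqP wi'].
  by apply: IH; rewrite ltn_neqAle wi' -ltnS.
rewrite newE !sem_if !sem_put eval_differ /= -!/(arr s' _ _) xi ts' s'v s'b e0.
case: (i \in dn) => /=; first by exists 0.
rewrite s'rho //; case: {+}b => /=; last by rewrite addn0; exists (nth 0 rho i).
case: (eqVneq i n) => [iE|iE]; eexists; rewrite ?mul1n //.
  by rewrite s'rho // ltnW.
by rewrite eR // eA // ltn_neqAle iE -ltnS.
Qed.

Definition rows_at t (L : seq (seq nat)) (s : state) := forall r w, r < size L -> w <= n ->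
  arr s t (r * n.+1 + w) = nth 0 (nth [::] L r) w.

Definition eq_c := Seq (Asg 24 (EC 1)) (For 25 5
  (If (differ (EG 3 (EV 25)) (EG 2 (EA (EV 23) (EV 25)))) (Asg 24 (EC 0)) skip)).

Lemma eq_sem s : env s ->
  (sem eq_c s).1 24 = all (fun w => arr s 3 w == arr s 2 (s.1 23 + w)) (iota 0 n.+1).
Proof.
move=> es; rewrite /eq_c sem_seq sem_asg; set c := For _ _ _; set s0 := setv s 24 _.
have s0n : s0.1 5 = n.+1 by case: es => [_ []].
pose I i (s' : state) := s'.1 24 = all (fun w => arr s 3 w == arr s 2 (s.1 23 + w)) (iota 0 i).
rewrite -[X in iota 0 X]s0n.
apply: (@sem_for_agree I) => // i s' iN xi ag IH.
have c3 : arr s' 3 i = arr s 3 i by rewrite ag.2.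
have c2 : arr s' 2 (s'.1 23 + i) = arr s 2 (s.1 23 + i) by rewrite ag.2 // ag.1.
rewrite /I iota0S all_cat setv_other // sem_if eval_differ /= -!/(arr s' _ _) xi c3 c2 andbT.
case: eqP => _; first by rewrite andbT; exact: IH.
by rewrite andbF.
Qed.

Lemma eq_rows rho sigma : size rho = n.+1 -> size sigma = n.+1 ->
  all (fun w => nth 0 rho w == nth 0 sigma w) (iota 0 n.+1) = (rho == sigma).
Proof.
move=> sr ss; apply/allP/eqP => [eqn|->//].
apply: (@eq_from_nth _ 0); rewrite ?ss ?sr // => i iN; apply/eqP/eqn.
by rewrite mem_iota.
Qed.

(** Loops over rows run up to [G] with a guard: the number of rows changes during the program and is
    not admissible as a bound in [static_cost]. *)
Definition dup_step :=
  If (ES (EV 7) (EV 22)) (Seq eq_c (If (EV 24) (Asg 21 (EC 1)) skip)) skip.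

Definition dup_c := Seq (Asg 21 (EC 0)) (Seq (Asg 23 (EC 0)) (For 22 4
  (Seq dup_step (Asg 23 (EA (EV 23) (EV 5)))))).

Definition rows_ok (L : seq (seq nat)) :=
  all (fun sigma => size sigma == n.+1) L /\ size L <= G.

Lemma dup_sem s rho L : env s -> candidate rho s -> size rho = n.+1 -> rows_at 2 L s ->
  rows_ok L -> s.1 7 = size L -> (sem dup_c s).1 21 = (rho \in L).
Proof.
move=> es cs sr rs [/allP szL LG] sL; rewrite /dup_c !sem_seq !sem_asg; set c := For _ _ _.
set s0 := setv _ 23 _.
have es0 : env s0 by exact: (env_sem (c := Seq (Asg 21 (EC 0)) (Asg 23 (EC 0)))).
have s0G : s0.1 4 = G by case: es0 => [_ []].
pose I i (s' : state) := s'.1 21 = (rho \in take i L) /\ s'.1 23 = i * n.+1.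
suff [] : I (s0.1 4) (sem c s0) by rewrite s0G take_oversize.
apply: (@sem_for_agree I) => // [|i s' iN xi ag [IH1 IH2]]; first by rewrite /I take0.
have es' := env_agree (c := c) isT ag es0; have [_ [_ e5 _] _ _] := es'.
have s'L : s'.1 7 = size L by rewrite ag.1.
have cs' : candidate rho s' by move=> w wn; rewrite (ag.2 3) //; exact: cs.
have rs' : rows_at 2 L s' by move=> r w rL wn; rewrite (ag.2 2) //; exact: rs.
rewrite sem_seq sem_asg; split; last first.
  rewrite setv_other // [LHS]upd_same /= !(sem_frame (c := dup_step)) //.
  by rewrite IH2 e5 mulSn addnC.
rewrite setv_other // setv_other // /dup_step sem_if /= xi s'L subn_eq0.
case: leqP => iL /=; first by rewrite take_oversize ?leqW //; rewrite take_oversize // in IH1.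
rewrite sem_seq sem_if /= eq_sem // (take_nth [::]) // mem_rcons inE.
have -> : all (fun w => arr s' 3 w == arr s' 2 (s'.1 23 + w)) (iota 0 n.+1) = (rho == nth [::] L i).
  rewrite -eq_rows //; last by apply/eqP/szL/mem_nth.
  by apply: eq_in_all => w; rewrite mem_iota => wn; rewrite IH2 cs' // rs'.
case: (rho == _) => //=; rewrite -IH1; exact: (@sem_frame (Seq eq_c skip) s' 21).
Qed.

Definition store_c := Seq (For 27 5 (Put 2 (EA (EV 26) (EV 27)) (EG 3 (EV 27))))
  (Seq (Asg 7 (EA (EV 7) (EC 1))) (Asg 26 (EA (EV 26) (EV 5)))).

Lemma store_sem s rho L : env s -> candidate rho s -> rows_at 2 L s ->
  s.1 7 = size L -> s.1 26 = size L * n.+1 ->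
  let s' := sem store_c s in
  [/\ rows_at 2 (rcons L rho) s', s'.1 7 = (size L).+1 & s'.1 26 = (size L).+1 * n.+1].
Proof.
move=> es cs rs sL sb; rewrite /store_c !sem_seq !sem_asg; set c := For _ _ _.
have [_ [_ e5 _] _ _] := es.
pose I i (s' : state) := rows_at 2 L s' /\ forall w, w < i -> arr s' 2 (size L * n.+1 + w) = nth 0 rho w.
have [I1 I2] : I (s.1 5) (sem c s).
  apply: (@sem_for_agree I) => // i s' iN xi ag [IH1 IH2]; rewrite e5 in iN.
  have cs' : arr s' 3 i = nth 0 rho i by rewrite (ag.2 3) //; exact: cs.
  have s'b : s'.1 26 = size L * n.+1 by rewrite ag.1.
  rewrite sem_put /= -!/(arr s' _ _) xi s'b cs'; split=> [r w rL wn|w wi]; rewrite {1}/arr /= arr_put //.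
    rewrite andbT ifF; first exact: IH1.
    by apply/eqP; nia.
  by rewrite andbT eqn_add2l; case: eqP => [->//|/eqP wi']; apply: IH2; lia.
have s1b : (sem c s).1 26 = size L * n.+1 by rewrite -sb; exact: (sem_frame (c := c)).
have s1L : (sem c s).1 7 = size L by rewrite -sL; exact: (sem_frame (c := c)).
have s15 : (sem c s).1 5 = n.+1 by rewrite -e5; exact: (sem_frame (c := c)).
split.
- move=> r w; rewrite size_rcons ltnS leq_eqVlt nth_rcons => /orP[/eqP->|rL] wn.
    by rewrite ltnn eqxx; apply: I2; rewrite e5.
  by rewrite rL; exact: I1.
- by rewrite setv_other // [LHS]upd_same /= s1L addn1.
- by rewrite [LHS]upd_same -[LHS]/((sem c s).1 26 + (sem c s).1 5) s1b s15 mulSn addnC.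
Qed.

Definition add_c := If (ES (EG 3 (EV 0)) (EV 1)) skip (Seq dup_c (If (EV 21) skip
  (If (ES (EV 4) (EV 7)) store_c (Asg 8 (EC 1))))).

Definition new_rows (st : bool * seq (seq nat)) (s : state) :=
  [/\ s.1 8 = st.1, s.1 7 = size st.2, s.1 26 = size st.2 * n.+1, rows_at 2 st.2 s & rows_ok st.2].

Lemma add_sem s rho st : env s -> candidate rho s -> size rho = n.+1 -> new_rows st s ->
  new_rows (add_row n k G st rho) (sem add_c s).
Proof.
move=> es cs sr [fs sL sb rs okL]; have [[e0 e1 _] [e4 _ _] _ _] := es.
rewrite /add_row /add_c sem_if /= -/(arr s _ _) e0 e1 cs // subn_eq0 [k < _]ltnNge.
case: (nth 0 rho n <= k) => /=; last by split.
rewrite sem_seq sem_if /= (dup_sem es cs sr rs okL sL).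
set s1 := sem dup_c s; have ag1 : agree dup_c s1 s by exact: sem_agree.
have es1 : env s1 by exact: (env_agree _ ag1 es).
have cs1 : candidate rho s1 by move=> w wn; rewrite (ag1.2 3) //; exact: cs.
have rs1 : rows_at 2 st.2 s1 by move=> r w rL wn; rewrite (ag1.2 2) //; exact: rs.
have fs1 : s1.1 8 = st.1 by rewrite ag1.1.
have sL1 : s1.1 7 = size st.2 by rewrite ag1.1.
have sb1 : s1.1 26 = size st.2 * n.+1 by rewrite ag1.1.
have e41 : s1.1 4 = G by rewrite ag1.1.
case: (rho \in st.2) => /=; first by split.
rewrite sem_if /= e41 sL1 subn_eq0 [size _ < _]ltnNge; case: leqP => /= [_|lt]; first by split.
have [r1 r2 r3] := store_sem es1 cs1 rs1 sL1 sb1.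
split; rewrite ?size_rcons //; first by rewrite (sem_frame (c := store_c)).
by case: okL => okL _; split; rewrite ?size_rcons // all_rcons sr eqxx.
Qed.

(** The loop runs over b = 0, 1; a bound must be a variable, hence the constant 2 in variable 19. *)
Definition treat_inner := For 18 19 (Seq cand_c add_c).

Definition treat_step := If (ES (EV 6) (EV 16)) treat_inner skip.

Definition treat_init := Seq (Asg 7 (EC 0)) (Seq (Asg 26 (EC 0)) (Asg 17 (EC 0))).

Definition treat_c := Seq treat_init
  (For 16 4 (Seq treat_step (Asg 17 (EA (EV 17) (EV 5))))).

Lemma treat_inner_sem s dn v rho st : env s -> treated dn s -> s.1 9 = v -> v < n ->
  (forall w, w <= n -> arr s 1 (s.1 17 + w) = nth 0 rho w) -> new_rows st s ->
  new_rows (add_row n k G (add_row n k G st (update_row n adj dn v false rho))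
    (update_row n adj dn v true rho)) (sem treat_inner s).
Proof.
move=> es ts sv vn srho nrs; have [_ [_ _ e19] _ _] := es.
pose st1 := add_row n k G st (update_row n adj dn v false rho).
pose I i := new_rows (if i is i'.+1 then
  if i' is 0 then st1 else add_row n k G st1 (update_row n adj dn v true rho) else st).
have : I (s.1 19) (sem treat_inner s); last by rewrite e19.
apply: (@sem_for_agree I) => // i s' iN xi ag IH; rewrite e19 in iN.
have es' := env_agree (c := treat_inner) isT ag es.
have ts' : treated dn s' by move=> w wn; rewrite (ag.2 4) //; exact: ts.
have s'v : s'.1 9 = v by rewrite ag.1.
have s'rho w : w <= n -> arr s' 1 (s'.1 17 + w) = nth 0 rho w.
  by move=> wn; rewrite ag.1 // (ag.2 1) //; exact: srho.
have s'b : s'.1 18 = (i == 1) by rewrite xi; case: i iN {xi IH} => [|[]].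
have cs' := cand_sem es' ts' s'v vn s'b s'rho.
set s1 := sem cand_c s' in cs'; have ag1 : agree cand_c s1 s' by exact: sem_agree.
have es1 : env s1 by exact: (env_agree (c := cand_c) isT ag1 es').
have nrs1 : new_rows (if i is 0 then st else st1) s1.
  have : new_rows (if i is 0 then st else st1) s'.
    by move: IH; rewrite /I; case: i iN {xi s'b cs'} => [|[]].
  case=> h1 h2 h3 h4 h5; split; rewrite ?ag1.1 // => r w rL wn.
  by rewrite (ag1.2 2) //; exact: h4.
have szr : size (update_row n adj dn v (i == 1) rho) = n.+1 by rewrite size_mkseq.
have := add_sem es1 cs' szr nrs1.
rewrite /I sem_seq -/s1; case: i iN {xi IH s'b cs' nrs1 szr} => [|[|//]] _ //=.
Qed.

Lemma treat_sem s dn v (st : bool * seq (seq nat)) : env s -> treated dn s -> s.1 9 = v -> v < n ->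
  s.1 8 = st.1 -> s.1 6 = size st.2 -> rows_at 1 st.2 s -> rows_ok st.2 ->
  new_rows (treat n adj k G dn v st) (sem treat_c s).
Proof.
move=> es ts sv vn fs sL rs [_ LG]; rewrite /treat_c sem_seq; set c := For _ _ _.
set s0 := sem treat_init s; have ag0 : agree treat_init s0 s by exact: sem_agree.
have es0 : env s0 by exact: (env_agree (c := treat_init) isT ag0 es).
have s0G : s0.1 4 = G by case: es0 => [_ []].
pose F st rho := add_row n k G (add_row n k G st (update_row n adj dn v false rho))
    (update_row n adj dn v true rho).
pose I i (s' : state) := new_rows (foldl F (st.1, [::]) (take i st.2)) s' /\ s'.1 17 = i * n.+1.
suff [] : I (s0.1 4) (sem c s0) by rewrite s0G take_oversize.
apply: (@sem_for_agree I) => // [|i s' iN xi ag [IH1 IH2]].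
  by rewrite /I take0; split=> //; split.
have es' := env_agree (c := c) isT ag es0; have [_ [_ e5 _] _ _] := es'.
have ts' : treated dn s' by move=> w wn; rewrite (ag.2 4) // (ag0.2 4) //; exact: ts.
have s'v : s'.1 9 = v by rewrite ag.1 // ag0.1.
have s'L : s'.1 6 = size st.2 by rewrite ag.1 // ag0.1.
have rs' : rows_at 1 st.2 s'.
  by move=> r w rL wn; rewrite (ag.2 1) // (ag0.2 1) //; exact: rs.
rewrite sem_seq sem_asg; set s1 := sem treat_step s'.
have ag1 : agree treat_step s1 s' by exact: sem_agree.
split; last by rewrite [LHS]upd_same /= !ag1.1 // IH2 e5 mulSn addnC.
suff : new_rows (foldl F (st.1, [::]) (take i.+1 st.2)) s1 by case.
rewrite /s1 /treat_step sem_if /= xi s'L subn_eq0; case: leqP => iL /=.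
  by move: IH1; rewrite !take_oversize // ?leqW //; case.
rewrite (take_nth [::]) // foldl_rcons.
by apply: treat_inner_sem => // w wn; rewrite IH2 rs'.
Qed.

(** All [G] slots are copied, however many are in use, again to have a fixed loop bound. *)
Definition copy_c := Seq (Asg 29 (EC 0)) (Seq (For 28 4 (Seq
  (For 30 5 (Put 1 (EA (EV 29) (EV 30)) (EG 2 (EA (EV 29) (EV 30)))))
  (Asg 29 (EA (EV 29) (EV 5))))) (Asg 6 (EV 7))).

Lemma copy_sem s L : env s -> rows_at 2 L s -> s.1 7 = size L -> size L <= G ->
  rows_at 1 L (sem copy_c s) /\ (sem copy_c s).1 6 = size L.
Proof.
move=> es rs sL LG; rewrite /copy_c !sem_seq !sem_asg; set c := For 28 4 _; set s0 := setv s 29 _.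
have es0 : env s0 by exact: (env_sem (c := Asg 29 (EC 0))).
have s0G : s0.1 4 = G by case: es0 => [_ []].
pose I i (s' : state) := (forall j, j < i * n.+1 -> arr s' 1 j = arr s 2 j) /\ s'.1 29 = i * n.+1.
have [I1 _] : I (s0.1 4) (sem c s0).
  apply: (@sem_for_agree I) => // i s' iN xi ag [IH1 IH2].
  have es' := env_agree (c := c) isT ag es0; have [_ [_ e5 _] _ _] := es'.
  rewrite sem_seq sem_asg; set d := For _ _ _.
  pose J w (s'' : state) := forall j, j < i * n.+1 + w -> arr s'' 1 j = arr s 2 j.
  have J1 : J (s'.1 5) (sem d s').
    apply: (@sem_for_agree J) => // [j|w s'' wN xw ag' IH]; first by rewrite addn0; exact: IH1.
    rewrite sem_put /= -/(arr s'' _ _) xw ag'.1 // IH2 => j jw; rewrite {1}/arr /= arr_put // andbT.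
    case: eqP => [->|/eqP ne]; last by apply: IH; lia.
    by rewrite (ag'.2 2) // (ag.2 2).
  rewrite e5 in J1; split; first by move=> j jn; apply: J1; rewrite addnC -mulSn.
  by rewrite [LHS]upd_same /= !(sem_frame (c := d)) // IH2 e5 mulSn addnC.
split; last by rewrite [LHS]upd_same /= (sem_frame (c := c)).
move=> r w rL wn; rewrite -rs //; apply: I1; rewrite s0G; nia.
Qed.

Definition round_c := Seq select_c (Seq (Put 4 (EV 9) (EC 1)) (Seq treat_c copy_c)).

Definition represents_run (c : seq nat * (bool * seq (seq nat))) (s : state) :=
  [/\ env s, treated c.1 s, s.1 8 = c.2.1, s.1 6 = size c.2.2 & rows_at 1 c.2.2 s /\ rows_ok c.2.2].

Lemma round_sem s c : represents_run c s -> select n adj T c.1 < n ->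
  represents_run (round n adj k T G c) (sem round_c s).
Proof.
case: c => dn [fl L] [/= es ts fs sL [rs okL]] vn; rewrite /round /=; set v := select n adj T dn in vn *.
rewrite /round_c !sem_seq; set s1 := sem select_c s.
have ag1 : agree select_c s1 s by exact: sem_agree.
have es1 : env s1 := env_agree (c := select_c) isT ag1 es.
have s1v : s1.1 9 = v by exact: select_sem.
set s2 := sem (Put 4 _ _) s1.
have ag2 : agree (Put 4 (EV 9) (EC 1)) s2 s1 by exact: sem_agree.
have es2 : env s2 := env_agree (c := Put 4 (EV 9) (EC 1)) isT ag2 es1.
have ts2 : treated (v :: dn) s2.
  move=> w wn; rewrite /s2 sem_put /arr /= arr_put // andbT s1v inE.
  by case: eqP => //= _; rewrite (ag1.2 4) //; exact: ts.
have rs2 : rows_at 1 L s2.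
  by move=> r w rL wn; rewrite (ag2.2 1) // (ag1.2 1) //; exact: rs.
have s2v : s2.1 9 = v by [].
have s2f : s2.1 8 = fl by rewrite ag2.1 // ag1.1.
have s2L : s2.1 6 = size L by rewrite ag2.1 // ag1.1.
have nrs := treat_sem (st := (fl, L)) es2 ts2 s2v vn s2f s2L rs2 okL.
set s3 := sem treat_c s2 in nrs *; set st := treat _ _ _ _ _ _ _ in nrs *.
have ag3 : agree treat_c s3 s2 by exact: sem_agree.
have es3 : env s3 := env_agree (c := treat_c) isT ag3 es2.
have [f3 L3 _ rs3 ok3] := nrs.
have [rs4 L4] := copy_sem es3 rs3 L3 ok3.2.
have ag4 : agree copy_c (sem copy_c s3) s3 by exact: sem_agree.
split.
- exact: (env_agree (c := copy_c) isT ag4 es3).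
- by move=> w wn; rewrite (ag4.2 4) // (ag3.2 4) //; exact: ts2.
- by rewrite (ag4.1 8).
- exact: L4.
- by split.
Qed.

Lemma select_lt dn : size dn < n -> select n adj T dn < n.
Proof.
move=> dnn; have [|//] := @select_spec n adj T dn.
apply: contraLR dnn => /hasPn all_in; rewrite -leqNgt -(size_iota 0 n).
apply: uniq_leq_size; first exact: iota_uniq.
by move=> w /all_in; rewrite negbK.
Qed.

Lemma rounds_sem s : represents_run ([::], (false, [:: nseq n.+1 0])) s ->
  represents_run (final n adj k T G) (sem (For 10 0 round_c) s).
Proof.
move=> rep0; have [[[e0 _ _] _ _ _] _ _ _ _] := rep0.
pose I i (s' : state) := let c := iter i (round n adj k T G) ([::], (false, [:: nseq n.+1 0])) in
  size c.1 = i /\ represents_run c s'.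
suff [] : I (s.1 0) (sem (For 10 0 round_c) s) by rewrite e0.
have incr_rep c s' : represents_run c s' -> represents_run c (incr 10 s').
  by move=> [es ts fs sL [rs okL]]; split.
apply: (@sem_for_agree I) => // i s' iN xi ag [IH1 IH2].
split; first by rewrite /= IH1.
apply: incr_rep; apply: round_sem => //; by apply: select_lt; rewrite IH1; move: iN; rewrite e0.
Qed.

Definition accept_step := If (ES (EV 6) (EV 16))
  (If (differ (EG 1 (EA (EV 17) (EV 0))) (EV 1)) skip (Asg 33 (EC 1))) skip.

Definition accept_c := Seq (Asg 33 (EV 8)) (Seq (Asg 17 (EC 0))
  (For 16 4 (Seq accept_step (Asg 17 (EA (EV 17) (EV 5)))))).

Lemma accept_sem s : represents_run (final n adj k T G) s ->
  (sem accept_c s).1 33 = accepts n adj k T G.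
Proof.
rewrite /accepts; move: (final _ _ _ _ _) => [dn [fl L]] [/= es ts fs sL [rs [_ LG]]].
rewrite /accept_c !sem_seq !sem_asg; set c := For _ _ _; set s0 := setv _ 17 _.
have es0 : env s0 by exact: (env_sem (c := Seq (Asg 33 (EV 8)) (Asg 17 (EC 0)))).
have s0G : s0.1 4 = G by case: es0 => [_ []].
pose p rho := nth 0 rho n == k.
pose I i (s' : state) := s'.1 33 = fl || has p (take i L) /\ s'.1 17 = i * n.+1.
suff [] : I (s0.1 4) (sem c s0) by rewrite s0G take_oversize.
apply: (@sem_for_agree I) => // [|i s' iN xi ag [IH1 IH2]].
  by rewrite /I take0 orbF; split.
have [[e0 e1 _] [_ e5 _] _ _] := env_agree (c := c) isT ag es0.
have s'L : s'.1 6 = size L by rewrite ag.1.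
have rs' : rows_at 1 L s' by move=> r w rL wn; rewrite (ag.2 1) //; exact: rs.
rewrite sem_seq sem_asg; split; last first.
  by rewrite [LHS]upd_same /= !(sem_frame (c := accept_step)) // IH2 e5 mulSn addnC.
rewrite -[LHS]/((sem accept_step s').1 33) /accept_step sem_if [eval _ _]/= xi s'L subn_eq0.
case: leqP => iL; first by rewrite take_oversize ?leqW //; rewrite take_oversize // in IH1.
rewrite sem_if eval_differ [eval _ _]/= -/(arr s' _ _) IH2 e0 rs' // [eval _ _]/= e1.
rewrite (take_nth [::]) // has_rcons -/(p _); case: (p _) => /=; first by rewrite orbT.
exact: IH1.
Qed.

Definition setup_init := Seq (Asg 8 (EC 0)) (Seq (Asg 6 (EC 1)) (Asg 31 (EC 0))).

(** The arrays other than 0 may still contain pieces of the input, so the treated marks and the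
    first row are cleared explicitly. *)
Definition setup_c := Seq setup_init
  (Seq (For 32 0 (Seq (Put 5 (EV 32) (EV 31)) (Asg 31 (EA (EV 31) (EV 0)))))
     (For 32 5 (Seq (Put 4 (EV 32) (EC 0)) (Put 1 (EV 32) (EC 0))))).

Definition main_c := Seq setup_c (Seq (For 10 0 round_c) accept_c).

Lemma setup_sem s : 0 < G ->
  [/\ s.1 0 = n, s.1 1 = k & s.1 3 = T] -> [/\ s.1 4 = G, s.1 5 = n.+1 & s.1 19 = 2] ->
  (forall i j, i < n -> j < n -> arr s 0 (i * n + j) = adj i j) ->
  represents_run ([::], (false, [:: nseq n.+1 0])) (sem setup_c s).
Proof.
move=> G_gt0 e013 e4519 eA; rewrite /setup_c sem_seq (sem_seq (For _ _ _)).
set s0 := sem setup_init s; have ag0 : agree setup_init s0 s by exact: sem_agree.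
have [e0 e1 e3] := e013; have [e4 e5 e19] := e4519.
set c := For 32 0 _; set d := For 32 5 _; set s1 := sem c s0; set s2 := sem d s1.
have ag1 : agree c s1 s0 by exact: sem_agree.
have ag2 : agree d s2 s1 by exact: sem_agree.
pose I i (s' : state) := (forall j, j < i -> arr s' 5 j = j * n) /\ s'.1 31 = i * n.
have s00 : s0.1 0 = n by rewrite ag0.1.
have [I1 _] : I (s0.1 0) s1.
  apply: (@sem_for_agree I) => // i s' iN xi ag [IH1 IH2].
  rewrite sem_seq sem_put sem_asg; split.
    move=> j ji; rewrite {1}/arr /= arr_put // andbT xi IH2; case: eqP => [->//|/eqP ne].
    by apply: IH1; lia.
  by rewrite [LHS]upd_same /= IH2 ag.1 // s00 mulSn addnC.
pose J i (s' : state) := forall j, j < i -> arr s' 4 j = 0 /\ arr s' 1 j = 0.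
have s15 : s1.1 5 = n.+1 by rewrite ag1.1 // ag0.1.
have J1 : J (s1.1 5) s2.
  apply: (@sem_for_agree J) => // i s' iN xi ag IH j ji.
  rewrite sem_seq sem_put sem_put /= xi.
  rewrite !(@arr_put (s'.1, upd s'.2 (8 * i + 4) 0)) // andbF andbT /arr /=.
  rewrite !arr_put // andbF andbT.
  by case: eqP => // /eqP ne; apply: IH; lia.
rewrite s15 in J1; rewrite s00 in I1.
split=> /=.
- split.
  + by split; rewrite ag2.1 // ag1.1 // ag0.1.
  + by split; rewrite ag2.1 // ag1.1 // ag0.1.
  + by move=> i j iN jN; rewrite (ag2.2 0) // (ag1.2 0) // (ag0.2 0) // eA.
  + by move=> i iN; rewrite (ag2.2 5) // I1.
- by move=> w wn; rewrite in_nil (J1 w _).1.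
- by rewrite ag2.1 // ag1.1.
- by rewrite ag2.1 // ag1.1.
split; last by split; rewrite //= size_nseq eqxx.
move=> [|//] w _ wn; rewrite mul0n add0n (J1 w _).2 //=.
by case: w wn => //= w _; rewrite nth_nseq if_same.
Qed.

Lemma main_sem s : 0 < G ->
  [/\ s.1 0 = n, s.1 1 = k & s.1 3 = T] -> [/\ s.1 4 = G, s.1 5 = n.+1 & s.1 19 = 2] ->
  (forall i j, i < n -> j < n -> arr s 0 (i * n + j) = adj i j) ->
  (sem main_c s).1 33 = accepts n adj k T G.
Proof.
move=> G_gt0 e013 e4519 eA; rewrite /main_c !sem_seq.
by apply: accept_sem; apply: rounds_sem; apply: setup_sem.
Qed.

End Main.

(** * Unpacking the input, and the running time *)

Section Packing.
Variable m : memory.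

(** Horner's rule in base 2, the first cell being the most significant digit. *)
Definition pack c l := foldl (fun c i => c + c + m i) c l.

Lemma pack_add c l : pack c l = c * 2 ^ size l + pack 0 l.
Proof.
elim: l c => [|i l IH] c /=; first by rewrite muln1 addn0.
by rewrite /pack /= -!/(pack _ _) IH [in RHS]IH expnS; lia.
Qed.

Lemma pack_lt l : (forall i, i \in l -> m i <= 1) -> pack 0 l < 2 ^ size l.
Proof.
elim: l => [|i l IH] //= bits; rewrite /pack /= -/(pack _ _) pack_add expnS.
have := bits i (mem_head _ _); have := IH (fun j jl => bits j (mem_behead (s := i :: l) jl)).
by move: (2 ^ _) => b; nia.
Qed.

End Packing.

Lemma eq_in_pack m m' c l : {in l, m =1 m'} -> pack m c l = pack m' c l.
Proof.
elim: l c => //= i l IH c eqm; rewrite /pack /= -!/(pack _ _ _) (eqm i) ?mem_head //.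
by apply: IH => j jl; apply: eqm; rewrite inE jl orbT.
Qed.

(* Cells 3 .. low - 1 may hold matrix entries, yet every variable is needed. Cell 2 holds entry (0, 0)
   of the matrix, which is 0, so these entries can be collected there as the digits of a number. *)
Definition pack_code (l : seq nat) : program := flatten [seq [:: IAdd 2 2 2; IAdd 2 2 i] | i <- l].

Lemma pack_code_correct P pc l m : code_at P pc (pack_code l) -> 2 \notin l ->
  exists2 m', goes P (size (pack_code l)) pc m (pc + size (pack_code l)) m' &
    m' 2 = pack m (m 2) l /\ forall x, x != 2 -> m' x = m x.
Proof.
elim: l pc m => [|i l IH] pc m; first by exists m; rewrite /goes //= addn0.
rewrite /= !code_at_cons inE negb_or => -[c1 [c2 cl]] /andP[i2 l2].
pose m1 := upd (upd m 2 (m 2 + m 2)) 2 (m 2 + m 2 + m i).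
have m1N x : x != 2 -> m1 x = m x by move=> x2; rewrite /m1 !upd_other.
have [m' g [m'2 m'N]] := IH pc.+2 m1 cl l2.
exists m'; last first.
  split=> [|x x2]; last by rewrite m'N ?m1N.
  have m12 : m1 2 = m 2 + m 2 + m i by rewrite /m1 upd_same.
  rewrite m'2 m12 -[RHS]/(pack m (m 2 + m 2 + m i) l); apply: eq_in_pack => x xl.
  by apply: m1N; apply: contraNneq l2 => <-.
have -> : (size (pack_code l)).+2 = 2 + size (pack_code l) by [].
rewrite addnA addn2; apply: goes_trans g.
by rewrite /goes /= c1 /= c2 /= upd_same upd_other // eq_sym.
Qed.

Definition square_c := Seq (Asg 6 (EC 0)) (For 7 0 (Asg 6 (EA (EV 6) (EV 0)))).

(* Entry q of the matrix sits in cell q + 2, i.e. in cell q - (low - 2) of the memory; it moves to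
   cell 8 * q, the large q first. *)
Definition move_c := For 7 6 (Seq (Asg 8 (ES (ES (EV 6) (EC 1)) (EV 7)))
  (If (ES (EC (low - 2)) (EV 8)) skip (Put 0 (EV 8) (ER (ES (EV 8) (EC (low - 2))))))).

(** Variable 10 becomes the weight 2^(c - q) of digit q among c, by doubling during the first c - q
    rounds only; the digit is 1 exactly when the remaining number reaches this weight. *)
Definition digit_c :=
  Seq (Asg 8 (EA (EV 7) (EC 1))) (Seq (Asg 10 (EC 1)) (Seq
    (For 11 9 (If (ES (ES (EV 9) (EV 8)) (EV 11)) (Asg 10 (EA (EV 10) (EV 10))) skip))
    (If (ES (EV 10) (EV 2)) (Put 0 (EV 8) (EC 0))
      (Seq (Put 0 (EV 8) (EC 1)) (Asg 2 (ES (EV 2) (EV 10))))))).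

Definition unpack_c := For 7 9 digit_c.

Lemma square_sem s : (sem square_c s).1 6 = s.1 0 * s.1 0.
Proof.
rewrite /square_c sem_seq sem_asg; set c := For _ _ _; set s0 := setv s 6 _.
pose I i (s' : state) := s'.1 6 = i * s.1 0.
rewrite -[X in X * _]/(s0.1 0).
apply: (@sem_for_agree I) => // i s' iN xi ag IH.
by rewrite sem_asg /I -[LHS]/(s'.1 6 + s'.1 0) IH ag.1 // mulSn addnC.
Qed.

Lemma move_sem s (bit : nat -> nat) : (forall i, s.2 i = bit (i + (low - 2))) ->
  forall q, low - 2 <= q -> q < s.1 6 -> arr (sem move_c s) 0 q = bit q.
Proof.
move=> mem; pose N := s.1 6.
(* The second part makes the in-place move safe: entry q = N - 1 - j comes from cell q - (low - 2),
   which lies below 8 (N - j) and is still intact. *)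
pose I j (s' : state) := (forall q, low - 2 <= q -> q < N -> N - j <= q -> arr s' 0 q = bit q) /\
  forall i, i < 8 * (N - j) -> s'.2 i = s.2 i.
suff [H _] : I (s.1 6) (sem move_c s) by move=> q q1 q2; apply: H => //; rewrite subnn.
apply: (@sem_for_agree I) => // [|j s' jN xj ag [IH1 IH2]].
  by split=> // q _ q2; rewrite subn0 leqNgt q2.
rewrite -/N in jN; rewrite sem_seq sem_asg; set s1 := setv s' 8 _.
have s18 : s1.1 8 = N - 1 - j.
  by rewrite /s1 [LHS]upd_same -[LHS]/(s'.1 6 - 1 - s'.1 7) xj ag.1.
have IH1' q : low - 2 <= q -> q < N -> N - j <= q -> arr s1 0 q = bit q by exact: IH1.
have IH2' i : i < 8 * (N - j) -> s1.2 i = s.2 i by exact: IH2.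
clearbody s1; rewrite sem_if (_ : (eval s1 _ == 0) = (low - 2 <= N - 1 - j)); last first.
  by rewrite -s18 -subn_eq0.
have q0N : N - 1 - j < N by clear - jN; lia.
have next q : N - j.+1 <= q -> q <> N - 1 - j -> N - j <= q by clear; lia.
case: (leqP (low - 2) (N - 1 - j)) => hq; last first.
  split=> [q q1 q2 q3|i hi]; last by apply: IH2'; clear - hi; lia.
  by apply: IH1' => //; apply: next => // qE; move: hq; rewrite -qE ltnNge q1.
rewrite sem_put -[eval s1 (EV 8)]/(s1.1 8) s18.
rewrite -[eval s1 _]/(s1.2 (s1.1 8 - (low - 2))) s18 IH2'; last by clear - jN; lia.
rewrite mem subnK //; split=> [q q1 q2 q3|i hi].
  rewrite -[LHS]/(upd s1.2 (8 * (N - 1 - j) + 0) (bit (N - 1 - j)) (8 * q + 0)) arr_put // andbT.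
  by case: eqP => [->//|/(next _ q3)]; exact: IH1'.
rewrite -[LHS]/(upd s1.2 (8 * (N - 1 - j) + 0) (bit (N - 1 - j)) i) upd_other ?IH2' //.
  by clear - hi; lia.
by clear - hi jN; lia.
Qed.

Lemma digit_sem s q b r : s.1 7 + 1 = q -> q <= s.1 9 -> b <= 1 -> r < 2 ^ (s.1 9 - q) ->
  s.1 2 = b * 2 ^ (s.1 9 - q) + r ->
  [/\ (sem digit_c s).1 2 = r, arr (sem digit_c s) 0 q = b &
    forall j, j != q -> arr (sem digit_c s) 0 j = arr s 0 j].
Proof.
move=> sq q9 b1 rlt code; rewrite /digit_c !sem_seq !sem_asg; set c := For _ _ _.
set s0 := setv _ 10 _; have s08 : s0.1 8 = q by rewrite -sq.
have s02 : s0.1 2 = s.1 2 by [].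
have s09 : s0.1 9 = s.1 9 by [].
have s0a j : arr s0 0 j = arr s 0 j by [].
have s010 : s0.1 10 = 1 by [].
clearbody s0; set s1 := sem c s0.
have ag1 : agree c s1 s0 by exact: sem_agree.
pose I i (s' : state) := s'.1 10 = 2 ^ minn i (s.1 9 - q).
have p1 : I (s0.1 9) s1.
  apply: (@sem_for_agree I) => // [|i s' iN xi ag IH]; first by rewrite /I min0n.
  rewrite sem_if -[eval s' _]/(s'.1 9 - s'.1 8 - s'.1 11) xi !ag.1 // s08 s09 subn_eq0.
  rewrite /I; case: leqP => h.
    rewrite -[LHS]/(s'.1 10) IH (minn_idPr h) (minn_idPr _) //.
    exact: leqW.
  rewrite -[LHS]/(s'.1 10 + s'.1 10) IH (minn_idPl h) (minn_idPl (ltnW h)).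
  by rewrite expnS mul2n addnn.
rewrite /I s09 (minn_idPr (leq_subr _ _)) in p1.
have s12 : s1.1 2 = s.1 2 by rewrite ag1.1 ?s02.
have s18 : s1.1 8 = q by rewrite ag1.1.
have s1a j : arr s1 0 j = arr s 0 j by rewrite (ag1.2 0) ?s0a.
clearbody s1; rewrite sem_if -[eval s1 _]/(s1.1 10 - s1.1 2) p1 s12 code subn_eq0.
case: b b1 code => [|[|//]] _ code; rewrite ?mul0n ?mul1n ?add0n.
  rewrite ifF ?[_ <= r]leqNgt ?rlt // sem_put -[eval s1 (EV 8)]/(s1.1 8) s18; split.
  - by rewrite -[LHS]/(s1.1 2) s12 code.
  - by rewrite /arr /= arr_put // eqxx.
  - by move=> j jq; rewrite {1}/arr /= arr_put // andbT (negbTE jq) s1a.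
rewrite ifT ?leq_addr // sem_seq sem_put sem_asg -[eval s1 (EV 8)]/(s1.1 8) s18; split.
- by rewrite [LHS]upd_same -[LHS]/(s1.1 2 - s1.1 10) s12 p1 code mul1n addKn.
- by rewrite /arr /= arr_put // eqxx.
- by move=> j jq; rewrite {1}/arr /= arr_put // andbT (negbTE jq) s1a.
Qed.

Lemma unpack_sem s (m : memory) c : s.1 9 = c -> s.1 2 = pack m 0 (iota 3 c) ->
  (forall i, 3 <= i -> i < c + 3 -> m i <= 1) ->
  (forall q, 0 < q -> q <= c -> arr (sem unpack_c s) 0 q = m (q + 2)) /\
  (forall q, (q == 0) || (c < q) -> arr (sem unpack_c s) 0 q = arr s 0 q).
Proof.
move=> s9 s2 bits.
pose I i (s' : state) := [/\ s'.1 2 = pack m 0 (iota (3 + i) (c - i)),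
  forall q, 0 < q -> q <= i -> arr s' 0 q = m (q + 2) &
  forall q, (q == 0) || (i < q) -> arr s' 0 q = arr s 0 q].
rewrite -s9; suff [] : I (s.1 9) (sem unpack_c s) by [].
apply: (@sem_for_agree I) => // [|i s' iN xi ag [IH1 IH2 IH3]].
  by split=> //; [rewrite subn0 addn0 | case].
rewrite s9 in iN.
have ci : c - i = (c - i.+1).+1 by rewrite subnSK.
have s'9 : s'.1 9 = c by rewrite ag.1.
have [|||||d1 d2 d3] := @digit_sem s' i.+1 (m (3 + i)) (pack m 0 (iota (3 + i.+1) (c - i.+1))).
- by rewrite xi addn1.
- by rewrite s'9.
- by apply: bits; clear - iN; lia.
- rewrite s'9 -{2}(size_iota (3 + i.+1) (c - i.+1)); apply: pack_lt => j.
  by rewrite mem_iota => hj; apply: bits; clear - hj; lia.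
- by rewrite IH1 s'9 ci /= /pack /= -/(pack _ _ _) pack_add size_iota addnS.
split=> // [q q0|q hq].
  rewrite leq_eqVlt => /orP[/eqP->|qi].
    by rewrite -[LHS]/(arr (sem digit_c s') 0 i.+1) d2; congr (m _); clear; lia.
  rewrite -[LHS]/(arr (sem digit_c s') 0 q) d3; first exact: IH2.
  by rewrite neq_ltn qi.
rewrite -[LHS]/(arr (sem digit_c s') 0 q) d3; first by apply: IH3; clear - hq; lia.
by clear - hq; lia.
Qed.

(** The high entries are moved first, since unpacking writes to cells that may still hold input.
    Entry 0, whose cell served for packing, is set to its value 0 last. *)
Definition prep_c := Seq square_c (Seq move_c (Seq (Asg 9 (EC (low - 3)))
  (Seq unpack_c (Put 0 (EC 0) (EC 0))))).

Lemma prep_sem (m0 m1 : memory) n : m0 0 = n -> m0 2 = 0 -> (forall i, 2 <= i -> m0 i <= 1) ->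
  (forall x, x != 2 -> m1 x = m0 x) -> m1 2 = pack m0 0 (iota 3 (low - 3)) ->
  forall q, q < n * n -> arr (sem prep_c (m1, fun i => m1 (low + i))) 0 q = m0 (q + 2).
Proof.
move=> m0n m02 bits m1N m12 q qn; rewrite /prep_c !sem_seq; set s := (m1, _).
set s1 := sem square_c s.
have ag1 : agree square_c s1 s by exact: sem_agree.
have s16 : s1.1 6 = n * n by rewrite /s1 square_sem /= m1N // m0n.
have s1m : s1.2 = s.2 by exact: sem_nomem.
set s2 := sem move_c s1.
have ag2 : agree move_c s2 s1 by exact: sem_agree.
have high p : low - 2 <= p -> p < n * n -> arr s2 0 p = m0 (p + 2).
  move=> p1 p2; apply: (@move_sem s1 (fun p => m0 (p + 2))) => //; last by rewrite s16.
  move=> i; rewrite s1m /= m1N; last by rewrite /low; clear; lia.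
  by congr (m0 _); rewrite /low; clear; lia.
rewrite sem_asg; set s3 := setv s2 9 _.
have s32 : s3.1 2 = pack m0 0 (iota 3 (low - 3)).
  by rewrite -m12 -[LHS]/(s2.1 2) ag2.1 // ag1.1.
have [|low_digits other] := @unpack_sem s3 m0 (low - 3) (Logic.eq_refl _) s32.
  by move=> i i3 _; apply: bits; exact: ltnW.
rewrite sem_put -[LHS]/(upd (sem unpack_c s3).2 (8 * 0 + 0) 0 (8 * q + 0)) arr_put // andbT.
case: (eqVneq q 0) => [->|q0]; first by rewrite add0n m02.
case: (leqP q (low - 3)) => hq; first by apply: low_digits => //; rewrite lt0n.
by rewrite other ?hq ?orbT // -[LHS]/(arr s2 0 q) high.
Qed.

(** The bounds once more, as expressions: this gives both a program and a running time for each of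
    them. *)
Definition ram_a L M := APow (APow (ANum 2) (ASucc (AMul L L))) (AMul (APow (ANum 2) (ASucc (AMul L L))) M).
Definition deg_a := ram_a (ANum 2) (AAdd (AMul (ANum 3) AK) (ANum 7)).
Definition pair_a := ram_a (ANum 1) (AAdd AK (ANum 3)).
Definition block_a := AAdd (APow (ASucc pair_a) (ASucc AK)) (ANum 1).
Definition path_blocks_a := ram_a (AMul (ANum 2) block_a) (AAdd (AMul (ANum 3) AK) (ANum 7)).
Definition path_a := AMul path_blocks_a block_a.
Definition comp_a := APow (ASucc deg_a) path_a.
Definition codeg_a := AAdd (AAdd deg_a (AMul (ANum 2) path_a)) (ANum 1).
Definition rows_a := APow (ANum 2) (ram_a (ANum 2) (AAdd codeg_a (AAdd (AMul (ANum 3) AK) (ANum 7)))).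
Definition class_a := AMul (AMul (APow (ANum 2) comp_a) (ASucc AK)) (APow (ASucc pair_a) rows_a).

Lemma ram_aE k L M : aeval k (ram_a L M) = ram (aeval k L) (aeval k M).
Proof. reflexivity. Qed.

Lemma deg_aE k : aeval k deg_a = deg_bd k.
Proof. exact: ram_aE. Qed.

Lemma pair_aE k : aeval k pair_a = pair_bd k.
Proof. exact: ram_aE. Qed.

Lemma block_aE k : aeval k block_a = block_len k.
Proof. by rewrite -[LHS]/((aeval k pair_a).+1 ^ k.+1 + 1) pair_aE. Qed.

Lemma path_aE k : aeval k path_a = path_len k.
Proof.
rewrite -[LHS]/(aeval k path_blocks_a * aeval k block_a) block_aE.
have -> // : aeval k path_blocks_a = path_blocks k.
by rewrite ram_aE -[aeval k (AMul _ _)]/(2 * aeval k block_a) block_aE.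
Qed.

Lemma comp_aE k : aeval k comp_a = comp_bd k.
Proof. by rewrite -[LHS]/((aeval k deg_a).+1 ^ aeval k path_a) path_aE deg_aE. Qed.

Lemma codeg_aE k : aeval k codeg_a = codeg_bd k.
Proof. by rewrite -[LHS]/(aeval k deg_a + 2 * aeval k path_a + 1) deg_aE path_aE. Qed.

Lemma rows_aE k : aeval k rows_a = rows_bd k.
Proof.
rewrite -[LHS]/(2 ^ aeval k (ram_a (ANum 2) (AAdd codeg_a (AAdd (AMul (ANum 3) AK) (ANum 7))))).
by rewrite ram_aE -[aeval k (AAdd codeg_a _)]/(aeval k codeg_a + (3 * k + 7)) codeg_aE.
Qed.

Lemma class_aE k : aeval k class_a = class_bd k.
Proof.
rewrite -[LHS]/(2 ^ aeval k comp_a * k.+1 * (aeval k pair_a).+1 ^ aeval k rows_a).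
by rewrite comp_aE pair_aE rows_aE.
Qed.

(** Scratch variables start at 10, so the input in 0 and 1 and the results in 3 and 4 survive. *)
Definition thresholds a b :=
  Seq (caexp 10 a) (Seq (Asg 3 (EV 10)) (Seq (caexp 10 b) (Asg 4 (EV 10)))).

Definition thresholds_c := thresholds codeg_a class_a.

Definition consts_c := Seq (Asg 5 (EA (EV 0) (EC 1))) (Asg 19 (EC 2)).

Definition solve_c :=
  Seq prep_c (Seq thresholds_c (Seq consts_c (Seq main_c (Asg 0 (EV 33))))).

(** The exponent 5 is the nesting depth of [main_c], whose loop bounds n, G, n + 1 and 2 are all at
    most (G + 2)(n + 1). The 400 covers the packing code and the loop-free commands. *)
Definition time_a :=
  AAdd (AAdd (AAdd (acost codeg_a) (acost class_a))
      (ANum (400 + csize square_c + csize move_c + csize unpack_c * low ^ 2)))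
    (AMul (ANum (csize main_c)) (APow (AAdd class_a (ANum 2)) (ANum 5))).


Lemma thresholds_sem a b s : let s' := sem (thresholds a b) s in
  [/\ s'.1 0 = s.1 0, s'.1 1 = s.1 1, s'.1 3 = aeval (s.1 1) a, s'.1 4 = aeval (s.1 1) b &
      s'.2 = s.2].
Proof.
rewrite /thresholds !sem_seq !sem_asg.
set s1 := sem (caexp 10 a) s; set s2 := setv s1 3 _; set s3 := sem _ s2.
have k1 : s1.1 1 = s.1 1 by exact: caexp_frame.
have s2k : s2.1 1 = s.1 1 by rewrite -k1.
split.
- by rewrite -[LHS]/(s3.1 0) caexp_frame // -[LHS]/(s1.1 0) caexp_frame.
- by rewrite -[LHS]/(s3.1 1) caexp_frame.
- by rewrite -[LHS]/(s3.1 3) caexp_frame // [LHS]upd_same [LHS]caexp_sem.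
- by rewrite [LHS]upd_same [LHS]caexp_sem // s2k.
- by rewrite [LHS]sem_nomem ?caexp_arrays // [LHS]sem_nomem ?caexp_arrays.
Qed.

Lemma constants_sem a b s : let s' := sem consts_c (sem (thresholds a b) s) in
  [/\ [/\ s'.1 0 = s.1 0, s'.1 1 = s.1 1 & s'.1 3 = aeval (s.1 1) a],
    [/\ s'.1 4 = aeval (s.1 1) b, s'.1 5 = (s.1 0).+1 & s'.1 19 = 2] & s'.2 = s.2].
Proof.
have [t0 t1 t3 t4 tm] := thresholds_sem a b s.
move: (sem (thresholds a b) s) t0 t1 t3 t4 tm => s1 t0 t1 t3 t4 tm.
by split=> //; split=> //; rewrite -[LHS]/(s1.1 0 + 1) t0 addn1.
Qed.

Lemma thresholds_cost a b s :
  cost (thresholds a b) s <= aeval (s.1 1) (acost a) + aeval (s.1 1) (acost b) + 8.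
Proof.
rewrite -[cost _ s]/(cost (caexp 10 a) s + (4 + (cost (caexp 10 b) (setv (sem (caexp 10 a) s) 3
  ((sem (caexp 10 a) s).1 10)) + 4))).
have ca := caexp_cost a s (isT : 1 < 10).
set s2 := setv _ _ _; have := caexp_cost b s2 (isT : 1 < 10).
have -> : s2.1 1 = s.1 1 by rewrite -[LHS]/((sem (caexp 10 a) s).1 1) caexp_frame.
by clearbody s2; move: ca; lia.
Qed.

Lemma solve_ok : cmd_ok solve_c && loops_ok solve_c.
Proof. by vm_compute. Qed.

Lemma time_ok : cmd_ok (caexp 2 time_a) && loops_ok (caexp 2 time_a).
Proof. by vm_compute. Qed.

Lemma time_aE k : aeval k time_a = aeval k (acost codeg_a) + aeval k (acost class_a) +
  (400 + csize square_c + csize move_c + csize unpack_c * low ^ 2) +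
  csize main_c * (class_bd k + 2) ^ 5.
Proof. by rewrite -class_aE. Qed.

Lemma sem_seq5 a b c d e s : sem (Seq a (Seq b (Seq c (Seq d e)))) s =
  sem e (sem d (sem c (sem b (sem a s)))).
Proof. by []. Qed.

Lemma cost_seq5 a b c d e s : cost (Seq a (Seq b (Seq c (Seq d e)))) s =
  cost a s + cost b (sem a s) + cost c (sem b (sem a s)) + cost d (sem c (sem b (sem a s))) +
  cost e (sem d (sem c (sem b (sem a s)))).
Proof. by rewrite /= !addnA. Qed.

Lemma prep_cost s n : s.1 0 = n ->
  cost prep_c s <= (20 + csize square_c + csize move_c + csize unpack_c * low ^ 2) * n.+1 ^ 2.
Proof.
move=> s0; rewrite /prep_c cost_seq5.
set s1 := sem square_c s; set s2 := sem move_c s1; set s3 := sem (Asg _ _) s2; set s4 := sem _ s3.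
have c1 : cost square_c s <= csize square_c * n.+1 ^ 1.
  by apply: (@static_cost square_c s n.+1) => // y; rewrite inE => /eqP->; rewrite s0.
have s16 : s1.1 6 = n * n by rewrite /s1 square_sem s0.
have c2 : cost move_c s1 <= csize move_c * (n.+1 ^ 2) ^ 1.
  apply: (@static_cost move_c s1 (n.+1 ^ 2)) => // y; rewrite inE => /eqP->; rewrite s16; nia.
have c3 : cost unpack_c s3 <= csize unpack_c * low ^ 2.
  by apply: (@static_cost unpack_c s3 low) => // y; rewrite !inE => /orP[]/eqP->.
have c4 : cost (Asg 9 (EC (low - 3))) s2 = 3 by [].
have c5 : cost (Put 0 (EC 0) (EC 0)) s4 = 8 by [].
clearbody s1 s2 s3 s4; rewrite c4 c5.
move: c1 c2 c3; rewrite !expn1; have : n.+1 <= n.+1 ^ 2 by rewrite -{1}[n.+1]expn1 leq_pexp2l.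
have : 0 < n.+1 ^ 2 by rewrite expn_gt0.
move: (n.+1 ^ 2) (csize square_c) (csize move_c) (csize unpack_c * low ^ 2) => N a b c N0 nN h1 h2 h3.
have : a * n.+1 <= a * N by rewrite leq_mul2l nN orbT.
have : c <= c * N by rewrite leq_pmulr.
rewrite !mulnDl; lia.
Qed.

Lemma main_cost s n G : s.1 0 = n -> s.1 4 = G -> s.1 5 = n.+1 -> s.1 19 = 2 ->
  cost main_c s <= csize main_c * (G + 2) ^ 5 * n.+1 ^ 5.
Proof.
move=> s0 s4 s5 s19; rewrite -mulnA -expnMn; apply: (@static_cost main_c s ((G + 2) * n.+1)) => //.
  by rewrite muln_gt0 addn_gt0 orbT.
have : all (fun y => y \in [:: 0; 4; 5; 19]) (bounds main_c) by [].
move/allP => hb y /hb; rewrite !inE => /or4P[] /eqP->; rewrite ?s0 ?s4 ?s5 ?s19; nia.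
Qed.

Lemma graph_input_entry n k (e : rel 'I_n) i j : i < n -> j < n ->
  graph_input e k (i * n + j + 2) = adj_nat e i j.
Proof.
move=> iN jN; rewrite addn2 /graph_input /= ifT; last by nia.
by rewrite subn2 /= divnMDl ?(leq_ltn_trans _ iN) // divn_small // addn0 modnMDl modn_small.
Qed.

Lemma total_cost sp cp ct cc cm A B a b c X N2 N : sp <= 200 -> cp <= (20 + a + b + c) * N2 ->
  ct <= A + B + 8 -> cc <= 10 -> cm <= X * N -> N2 <= N -> 0 < N ->
  sp + (cp + ct + cc + cm + 4) <= (A + B + (400 + a + b + c) + X) * N.
Proof.
move=> h1 h2 h3 h4 h5 h6 h7.
have := leq_pmulr (A + B) h7; have := leq_pmulr 400 h7.
have : (20 + a + b + c) * N2 <= (20 + a + b + c) * N by rewrite leq_mul2l h6 orbT.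
rewrite !mulnDl in h2 *; lia.
Qed.

Definition solve_program : program :=
  let pre := pack_code (iota 3 (low - 3)) in pre ++ ccmd (size pre) solve_c.

Lemma solve_program_correct n k (e : rel 'I_n) : 0 < n -> symmetric e -> irreflexive e ->
  let t := aeval k time_a * n.+1 ^ 5 in
  halted solve_program (run solve_program t (graph_input e k)) /\
  ((run solve_program t (graph_input e k)).2 0 = 1 <-> has_k_edge_induced_subgraph e k).
Proof.
move=> n_gt0 esym eirr t; set m0 := graph_input e k; set pre := pack_code (iota 3 (low - 3)).
have adj00 : adj_nat e 0 0 = false.
  by rewrite -[0]/(nat_of_ord (Ordinal n_gt0)) adj_natE eirr.
(* Cell 2 is the diagonal entry (0, 0), so packing starts from 0. *)
have m02 : m0 2 = 0.
  by rewrite /m0 /graph_input /=; case: ifP => // _; rewrite subnn div0n mod0n adj00.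
have bits i : 2 <= i -> m0 i <= 1.
  rewrite /m0 /graph_input; case: i => [|[|i]] //= _.
  by case: ifP => // _; case: adj_nat.
have [|//|m1 g1 [m12 m1N]] := @pack_code_correct solve_program 0 (iota 3 (low - 3)) m0.
  by move=> i ip; rewrite /solve_program -/pre nth_cat ip.
rewrite m02 in m12; rewrite add0n in g1.
pose s : state := (m1, fun i => m1 (low + i)).
have [cok lok] := andP solve_ok.
have rep : models s m1 by split.
have s00 : s.1 0 = n by rewrite /s /= m1N.
have s01 : s.1 1 = k by rewrite /s /= m1N.
set s1 := sem prep_c s.
have ag1 : agree prep_c s1 s by exact: sem_agree.
have s10 : s1.1 0 = n by rewrite ag1.1.
have s11 : s1.1 1 = k by rewrite ag1.1.
have arr1 q : q < n * n -> arr s1 0 q = m0 (q + 2) by exact: (@prep_sem m0 m1 n).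
have c1 := prep_cost s00.
have ct := thresholds_cost codeg_a class_a s1; rewrite s11 in ct.
have [[f0 f1 f3] [f4 f5 f19] fm] := constants_sem codeg_a class_a s1.
rewrite s10 in f0 f5; rewrite s11 in f1 f3 f4; rewrite codeg_aE in f3; rewrite class_aE in f4.
have semE := sem_seq5 prep_c thresholds_c consts_c main_c (Asg 0 (EV 33)) s.
have costE := cost_seq5 prep_c thresholds_c consts_c main_c (Asg 0 (EV 33)) s.
rewrite -/solve_c -/s1 in semE costE; rewrite -/thresholds_c in ct f0 f1 f3 f4 f5 f19 fm.
have cc s' : cost consts_c s' <= 10 by [].
rewrite [cost (Asg _ _) _]/= in costE.
move: (sem thresholds_c s1) (cost thresholds_c s1) ct f0 f1 f3 f4 f5 f19 fm semE costE => s2 ct_val ct.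
move: (cost consts_c s2) (cc s2) => cc_val ccE.
set s3 := sem consts_c s2 => f0 f1 f3 f4 f5 f19 fm semE costE.
clearbody s1 s3.
have eA i j : i < n -> j < n -> arr s3 0 (i * n + j) = adj_nat e i j.
  move=> iN jN; rewrite /arr fm -/(arr s1 0 _) arr1; last by clear - iN jN; nia.
  exact: graph_input_entry.
have G_gt0 : 0 < class_bd k by rewrite /class_bd !muln_gt0 !expn_gt0.
have ans : (sem solve_c s).1 0 = accepts n (adj_nat e) k (codeg_bd k) (class_bd k).
  rewrite semE; apply: etrans (upd_same _ _ _) _.
  exact: (main_sem G_gt0 (And3 f0 f1 f3) (And3 f4 f5 f19) eA).
have c4 := main_cost f0 f4 f5 f19.
have le_t : size pre + cost solve_c s <= t.
  have pre_size : size pre <= 200 by [].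
  have N25 : n.+1 ^ 2 <= n.+1 ^ 5 by rewrite leq_pexp2l.
  have N5 : 0 < n.+1 ^ 5 by rewrite expn_gt0.
  rewrite costE /t time_aE; exact: (total_cost pre_size c1 ct ccE c4 N25 N5).
have preE : solve_program = pre ++ ccmd (size pre) solve_c by [].
have [h1 h2] := run_cmd preE cok lok g1 rep le_t.
split; first exact: h1.
rewrite h2 ans; apply: iff_trans (attains_has_k_edge esym k n_gt0).
apply: iff_trans (accepts_correct k esym eirr n_gt0).
by case: accepts; split.
Qed.

(* p-Edge-Induced-Subgraph is FPT: a RAM program P decides it within
   f(k) * (n+1)^c steps (accepting iff M[0] = 1 at halting), where f is
   computable (computed by a RAM program Pf). *)
Theorem theorem5p2 :
  exists (P Pf : program) (f : nat -> nat) (c : nat),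
    (forall k : nat, exists t : nat,
        halted Pf (run Pf t (nat_input k)) /\ (run Pf t (nat_input k)).2 0 = f k) /\
    (forall (n k : nat) (e : rel 'I_n),
        0 < n -> symmetric e -> irreflexive e ->
        halted P (run P (f k * n.+1 ^ c) (graph_input e k)) /\
        ((run P (f k * n.+1 ^ c) (graph_input e k)).2 0 = 1 <->
         has_k_edge_induced_subgraph e k)).
Proof.
have [cok lok] := andP time_ok.
(* f is itself the value of an expression, and the program computing it is the compiled [time_a]. *)
exists solve_program; eexists; exists (fun k => aeval k time_a), 5; split.
  exact: (aexp_computable cok lok).
by move=> n k e n_gt0 esym eirr; exact: solve_program_correct.
Qed.
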